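(* Let $\vec r\in(0,\infty)^m$, $s\in(1,\infty]$, and let $T$ be an operator defined on $m$-tuples of functions (mapping $m$-tuples of functions in $L^\infty_c(\mathbb{R}^d)$ to measurable functions on $\mathbb{R}^d$) such that for any $f_1,\dots,f_m,g\in L^\infty_c(\mathbb{R}^d)$ there exists a sparse collection $\mathcal{S}$ with $$\int_{\mathbb{R}^d}|T(\vec f)|\cdot|g|\,\mathrm{d}x\le C_T\sum_{Q\in\mathcal{S}}\Big(\prod_{j=1}^m\langle f_j\rangle_{r_j,Q}\Big)\langle g\rangle_{s',Q}|Q|,$$ where $C_T>0$ is a constant. Let $\vec X=(X_1,\dots,X_m)$ be an $m$-tuple of Banach function spaces over a measure space $(\Omega,\mu)$ such that $\vec X\in\mathrm{UMD}_{\vec r,s}$, let $X:=\prod_{j=1}^mX_j$, and suppose that for all simple functions $f_j\in L^\infty_c(\mathbb{R}^d;X_j)$, $1\le j\le m$, the function $\widetilde T(\vec f):\mathbb{R}^d\to X$ given by $$\widetilde T(\vec f)(x,\omega):=T(\vec f(\cdot,\omega))(x),\qquad(x,\omega)\in\mathbb{R}^d\times\Omega,$$ is well-defined and strongly measurable. Then for all simple functions $f_j\in L^\infty_c(\mathbb{R}^d;X_j)$, $1\le j\le m$, and all $g\in L^\infty_c(\mathbb{R}^d)$ there exists a sparse collection of cubes $\mathcal{S}$ such that $$\int_{\mathbb{R}^d}\|\widetilde T(\vec f)\|_X\cdot|g|\,\mathrm{d}x\lesssim_{\vec X,\vec r,s}C_T\sum_{Q\in\mathcal{S}}\Big(\prod_{j=1}^m\big\langle\|f_j\|_{X_j}\big\rangle_{r_j,Q}\Big)\langle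 g\rangle_{s',Q}|Q|.$$
   Context: Function spaces. Measure spaces $(\Omega,\mu)$ are $\sigma$-finite. A quasi-Banach function space over $\Omega$ is an order ideal $X\subseteq L^0(\Omega)$ with a quasi-norm such that: $|\xi|\le|\eta|$ implies $\|\xi\|_X\le\|\eta\|_X$; there is $\xi\in X$ with $\xi>0$ a.e.; and (Fatou) if $0\le\xi_n\uparrow\xi$, $\xi_n\in X$, $\sup_n\|\xi_n\|_X<\infty$, then $\xi\in X$ and $\|\xi\|_X=\sup_n\|\xi_n\|_X$. It is a Banach function space if $\|\cdot\|_X$ is a norm. It is order-continuous if $0\le\xi_n\uparrow\xi\in X$ implies $\|\xi_n-\xi\|_X\to0$. If $X$ is an order-continuous Banach function space, its dual $X^*$ is again a Banach function space over $\Omega$ (via the pairing $\int_\Omega\xi\eta\,\mathrm d\mu$). $X$ is $p$-convex, $p\in(0,\infty)$, if $\|(\sum_k|\xi_k|^p)^{1/p}\|_X\le(\sum_k\|\xi_k\|_X^p)^{1/p}$ for all finite families. The product $\prod_jX_j$ is the space of $\xi$ with $|\xi|\le\prod_j\xi_j$ for some $0\le\xi_j\in X_j$, with $\|\xi\|:=\inf\prod_j\|\xi_j\|_{X_j}$ over such $\xi_j$. An $m$-tuple of (quasi-)Banach function spaces $\vec X=(X_1,\dots,X_m)$ consists of such spaces over the same measure space whose product is a quasi-Banach function space. For a vector $\vec r\in(0,\infty]^m$ put $\frac1r:=\sum_j\frac1{r_j}$; inequalities between vectors are coordinatewise. Hardy–Littlewood property. Let $\vec X$ be an $n$-tuple of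 quasi-Banach function spaces with product $X$ and $\vec r\in(0,\infty)^n$, with each $X_j$ being $r_j$-convex. For a finite collection $\mathcal{D}$ of cubes put $\widetilde M^{\mathcal{D}}_{\vec r}(\vec f)(x):=\sup_{Q\in\mathcal{D}}\prod_{j=1}^n\langle f_j\rangle_{r_j,Q}\mathbf 1_Q(x)$ (lattice supremum; $\langle f_j\rangle_{r_j,Q}$ is the function $\omega\mapsto(\frac1{|Q|}\int_Q|f_j(x,\omega)|^{r_j}\mathrm dx)^{1/r_j}$). $\vec X\in\mathrm{HL}_{\vec r}$ means that each $X_j$ is $r_j$-convex and for some $\vec p$ with $\vec r<\vec p\le\infty$ one has $\sup_{\mathcal{D}}\|\widetilde M^{\mathcal{D}}_{\vec r}\|_{L^{p_1}(\mathbb{R};X_1)\times\cdots\times L^{p_n}(\mathbb{R};X_n)\to L^p(\mathbb{R};X)}<\infty$, the supremum being over all finite collections $\mathcal{D}$ of cubes (intervals) in $\mathbb{R}$. (The property does not depend on the choice of $\vec p$, and one may equivalently use $\mathbb{R}^d$ in place of $\mathbb{R}$.) $\mathrm{UMD}_{\vec r,s}$. For $\vec r\in(0,\infty)^m$ and $s\in(r,\infty]$, $\vec X\in\mathrm{UMD}_{\vec r,s}$ means that $X=\prod_jX_j$ is an order-continuous Banach function space and the $(m+1)$-tuple $(X_1,\dots,X_m,X^* )$ belongs to $\mathrm{HL}_{(r_1,\dots,r_m,s')}$, where $\frac1s+\frac1{s'}=1$. Other notation. $L^\infty_c$: bounded with compact support. Cubes are half-open with sides parallel to the axes. $\mathcal{S}$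 is sparse if there are pairwise disjoint measurable $E_Q\subseteq Q$, $Q\in\mathcal S$, with $|E_Q|\ge\frac12|Q|$. For scalar functions $\langle f\rangle_{r,Q}:=(\frac1{|Q|}\int_Q|f|^r\mathrm dx)^{1/r}$. $\lesssim_{a,b,\dots}$: up to a constant depending only on $a,b,\dots$ and possibly $d,m$. *)

(* Defs.v *)
From HB Require Import structures.
From mathcomp Require Import all_boot all_order all_algebra.
From mathcomp Require Import all_classical all_reals all_analysis.
Set Implicit Arguments. Unset Strict Implicit. Unset Printing Implicit Defensive.
Import Order.TTheory GRing.Theory Num.Theory.
Import numFieldNormedType.Exports.
Local Open Scope classical_set_scope.
Local Open Scope ring_scope.
(* R^d with its product (= Borel) sigma-algebra. *)
Notation euclid R d := (d.-tuple (measurableTypeR R)).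

Section lebesgue_cons.
Local Open Scope ereal_scope.
Context {R : realType} {n : nat}.

Definition euclid_cons (p : measurableTypeR R * euclid R n) : euclid R n.+1 :=
  [tuple of p.1 :: p.2].

Lemma measurable_euclid_cons : measurable_fun [set: _] euclid_cons.
Proof.
exact: measurable_cons.
Qed.

Context (l : {sigma_finite_measure set (measurableTypeR R) -> \bar R})
  (m : {sigma_finite_measure set (euclid R n) -> \bar R}).

Definition leb_cons : set (euclid R n.+1) -> \bar R :=
  pushforward (l \x m) euclid_cons.

Let leb_cons0 : leb_cons set0 = 0.
Proof. by rewrite /leb_cons /pushforward preimage_set0 measure0. Qed.

Let leb_cons_ge0 A : 0 <= leb_cons A.
Proof. by rewrite /leb_cons /pushforward; exact: measure_ge0. Qed.

Let leb_cons_sigma_additive : semi_sigma_additive leb_cons.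
Proof.
have mf := measurable_euclid_cons.
move=> F mF tF mUF; rewrite /leb_cons /pushforward preimage_bigcup.
apply: measure_semi_sigma_additive.
- by move=> k; rewrite -[X in measurable X]setTI; exact: mf.
- apply/trivIsetP => /= i j _ _ ij; rewrite -preimage_setI.
  by move/trivIsetP : tF => /(_ _ _ _ _ ij) ->//; rewrite preimage_set0.
- by rewrite -preimage_bigcup -[X in measurable X]setTI; exact: mf.
Qed.

HB.instance Definition _ := isMeasure.Build _ _ _ leb_cons
  leb_cons0 leb_cons_ge0 leb_cons_sigma_additive.

Let euclid_uncons (t : euclid R n.+1) : measurableTypeR R * euclid R n :=
  (thead t, [tuple of behead t]).

Let measurable_euclid_uncons : measurable_fun [set: _] euclid_uncons.
Proof.
apply/measurable_fun_pair => /=; first exact: measurable_tnth.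
exact: measurable_behead.
Qed.

Let euclid_consK : cancel euclid_cons euclid_uncons.
Proof.
by move=> [x t]; rewrite /euclid_uncons /= theadE; congr pair; exact: val_inj.
Qed.

Let leb_cons_sigma_finite : sigma_finite setT leb_cons.
Proof.
have /sigma_finiteP[F [TF ndF Foo]] := sigma_finiteT l.
have /sigma_finiteP[G [TG ndG Goo]] := sigma_finiteT m.
exists (fun k => euclid_uncons @^-1` (F k `*` G k)).
  rewrite -preimage_bigcup (_ : \bigcup_i _ = setT) ?preimage_setT//.
  apply/seteqP; split => // -[x t] _.
  have [i _ Fx] : (\bigcup_i F i) x by rewrite -TF.
  have [j _ Gt] : (\bigcup_i G i) t by rewrite -TG.
  exists (maxn i j) => //; split => /=.
    by move: x Fx; exact/subsetPset/ndF/leq_maxl.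
  by move: t Gt; exact/subsetPset/ndG/leq_maxr.
move=> k; have [mF Fk] := Foo k; have [mG Gk] := Goo k; split.
  rewrite -[X in measurable X]setTI; apply: measurable_euclid_uncons => //.
  exact: measurableX.
rewrite /leb_cons /pushforward -comp_preimage.
rewrite (_ : _ \o _ = id); last by apply/funext => x /=; rewrite euclid_consK.
by rewrite preimage_id product_measure1E// lte_mul_pinfty// ge0_fin_numE.
Qed.

HB.instance Definition _ :=
  Measure_isSigmaFinite.Build _ _ _ leb_cons leb_cons_sigma_finite.

End lebesgue_cons.

(* d-dimensional Lebesgue measure; see lebesgue_box. *)
Fixpoint lebesgue (R : realType) (d : nat) :
    {sigma_finite_measure set (euclid R d) -> \bar R} :=
  match d with
  | 0%N => \d_([tuple] : euclid R 0)
  | n.+1 => leb_cons (@lebesgue_measure R) (lebesgue R n)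
  end.

Definition box (R : realType) (d : nat) (a b : 'I_d -> R) : set (euclid R d) :=
  [set x | forall i, a i <= tnth x i < b i].

Lemma lebesgue_box (R : realType) (d : nat) (a b : 'I_d -> R) :
  (forall i, a i <= b i) -> lebesgue R d (box a b) = (\prod_i (b i - a i))%:E.
Proof.
elim: d a b => [|n IHn] a b ab /=.
  by rewrite big_ord0 diracE mem_set// => -[].
rewrite big_ord_recl /leb_cons /pushforward.
have -> : euclid_cons @^-1` box a b =
    `[a ord0, b ord0[%classic `*`
    box (fun i => a (lift ord0 i)) (fun i => b (lift ord0 i)).
  apply/seteqP; split => [[x t] /= H|[x t] /= [Hx Ht] i].
    split; first by rewrite in_itv/=; exact: (H ord0).
    by move=> i; have := H (lift ord0 i); rewrite tnthS.
  have [->|] := eqVneq i ord0; first by move: Hx; rewrite in_itv.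
  rewrite eq_sym => /unlift_some[j -> _]; rewrite tnthS; exact: Ht.
rewrite product_measure1E//=.
- rewrite IHn// lebesgue_measure_itv/= lte_fin -EFinD EFinM; congr mule.
  case: ltgtP (ab ord0) => //= -> _; by rewrite subrr.
- rewrite (_ : box _ _ = \bigcap_(i in [set: 'I_n]) ((@tnth n _ ^~ i) @^-1`
     `[a (lift ord0 i), b (lift ord0 i)[%classic)); last first.
    by apply/seteqP; split => [x H i _|x H i]; have := H i; rewrite /= in_itv //=; apply.
  apply: fin_bigcap_measurable => // i _; rewrite -[X in measurable X]setTI.
  by apply: measurable_tnth => //; exact: measurable_itv.
Qed.

(* The exponent with 1 / hsum p = \sum_j 1 / p_j, with 1 / +oo = 0, 1 / 0 = +oo. *)
Definition hsum (R : realType) (n : nat) (p : 'I_n -> \bar R) : \bar R :=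
  ((\sum_j (p j)^-1)^-1)%E.

Definition snoc (A : Type) (n : nat) (u : 'I_n -> A) (a : A) : 'I_n.+1 -> A :=
  fun i => if unlift ord_max i is Some j then u j else a.

(* Elements of L^0(Omega) are represented by measurable functions; conditions on
   them hold almost everywhere, and the solidity of a function space makes
   membership and norm depend on the almost everywhere class only.  The norm is
   meaningful on members only. *)
Record funspace (R : realType) (dO : measure_display)
    (Omega : measurableType dO) := FunSpace {
  fs_mem : set (Omega -> R) ;
  fs_norm : (Omega -> R) -> R }.

Section function_spaces.
Context {R : realType} {dO : measure_display} {Omega : measurableType dO}.
Context (mu : {sigma_finite_measure set Omega -> \bar R}).
Implicit Types (X : funspace R Omega) (xi eta : Omega -> R).

Definition increases_to (u : nat -> Omega -> R) xi :=
  {ae mu, forall w, [/\ forall n, 0 <= u n w,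
    nondecreasing_seq (u ^~ w) & u ^~ w @ \oo --> xi w]}.

Record is_qbfs X : Prop := IsQBFS {
  qbfs_measurable : forall xi, fs_mem X xi -> measurable_fun setT xi ;
  qbfs_add : forall xi eta, fs_mem X xi -> fs_mem X eta ->
    fs_mem X (fun w => xi w + eta w) ;
  qbfs_scale : forall (c : R) xi, fs_mem X xi -> fs_mem X (fun w => c * xi w) ;
  qbfs_solid : forall xi eta, measurable_fun setT xi -> fs_mem X eta ->
    {ae mu, forall w, `|xi w| <= `|eta w|} ->
    fs_mem X xi /\ fs_norm X xi <= fs_norm X eta ;
  qbfs_norm_ge0 : forall xi, fs_mem X xi -> 0 <= fs_norm X xi ;
  qbfs_norm_eq0 : forall xi, fs_mem X xi ->
    fs_norm X xi = 0 <-> {ae mu, forall w, xi w = 0} ;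
  qbfs_normZ : forall (c : R) xi, fs_mem X xi ->
    fs_norm X (fun w => c * xi w) = `|c| * fs_norm X xi ;
  qbfs_normD : exists K : R, forall xi eta, fs_mem X xi -> fs_mem X eta ->
    fs_norm X (fun w => xi w + eta w) <= K * (fs_norm X xi + fs_norm X eta) ;
  qbfs_unit : exists2 xi, fs_mem X xi & {ae mu, forall w, 0 < xi w} ;
  qbfs_fatou : forall (u : nat -> Omega -> R) xi, (forall n, fs_mem X (u n)) ->
    measurable_fun setT xi -> increases_to u xi ->
    (exists M : R, forall n, fs_norm X (u n) <= M) ->
    fs_mem X xi /\ fs_norm X xi = sup (range (fun n => fs_norm X (u n))) }.

Definition is_bfs X : Prop := is_qbfs X /\
  forall xi eta, fs_mem X xi -> fs_mem X eta ->
    fs_norm X (fun w => xi w + eta w) <= fs_norm X xi + fs_norm X eta.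

Definition order_continuous X : Prop :=
  forall (u : nat -> Omega -> R) xi, (forall n, measurable_fun setT (u n)) ->
    fs_mem X xi -> increases_to u xi ->
    fs_norm X (fun w => u n w - xi w) @[n --> \oo] --> (0 : R).

Definition p_convex (p : R) X : Prop :=
  forall (N : nat) (xi : 'I_N -> Omega -> R), (forall k, fs_mem X (xi k)) ->
    fs_norm X (fun w => (\sum_k `|xi k w| `^ p) `^ p^-1) <=
    (\sum_k fs_norm X (xi k) `^ p) `^ p^-1.

(* The elements of the dual of X, identified with functions through the pairing,
   with the operator norm. *)
Definition fs_dual X : funspace R Omega := {|
  fs_mem := [set eta | [/\ measurable_fun setT eta,
    forall xi, fs_mem X xi ->
      mu.-integrable setT (fun w => (xi w * eta w)%:E) &
    exists C : R, forall xi, fs_mem X xi ->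
      `|\int[mu]_w (xi w * eta w)| <= C * fs_norm X xi]] ;
  fs_norm := fun eta => sup [set `|\int[mu]_w (xi w * eta w)| |
    xi in [set xi | fs_mem X xi /\ fs_norm X xi <= 1]] |}.

Definition factorizes (n : nat) (X : 'I_n -> funspace R Omega) xi
    (zeta : 'I_n -> Omega -> R) : Prop :=
  (forall j, fs_mem (X j) (zeta j) /\ {ae mu, forall w, 0 <= zeta j w}) /\
  {ae mu, forall w, `|xi w| <= \prod_j zeta j w}.

Definition fs_prod (n : nat) (X : 'I_n -> funspace R Omega) :
    funspace R Omega := {|
  fs_mem := [set xi | measurable_fun setT xi /\ exists zeta, factorizes X xi zeta] ;
  fs_norm := fun xi => inf [set \prod_j fs_norm (X j) (zeta j) |
    zeta in [set zeta | factorizes X xi zeta]] |}.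

Definition qbfs_tuple (n : nat) (X : 'I_n -> funspace R Omega) : Prop :=
  (forall j, is_qbfs (X j)) /\ is_qbfs (fs_prod X).

(* The norm of an extended real-valued function, +oo outside of X. *)
Definition fs_enorm X (xi : Omega -> \bar R) : \bar R :=
  if `[< {ae mu, forall w, xi w \is a fin_num} /\ fs_mem X (fine \o xi) >]
  then (fs_norm X (fine \o xi))%:E else +oo%E.

End function_spaces.

Section vector_valued_functions.
Context {R : realType} {dO : measure_display} {Omega : measurableType dO}.
Context {dT : measure_display} {T : measurableType dT}.
Context (nu : {measure set T -> \bar R}).
Implicit Types (X : funspace R Omega) (f : T -> Omega -> R).

Definition simple_function X f : Prop :=
  exists (N : nat) (A : 'I_N -> set T) (xi : 'I_N -> Omega -> R),
    [/\ forall k, measurable (A k), forall k, fs_mem X (xi k) &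
        forall x w, f x w = \sum_k \1_(A k) x * xi k w].

(* Strong measurability of x |-> f x as a map into X, for a representative f
   which is jointly measurable. *)
Definition strongly_measurable X f : Prop :=
  [/\ measurable_fun setT (fun z : T * Omega => f z.1 z.2),
      {ae nu, forall x, fs_mem X (f x)} &
      exists2 h : nat -> T -> Omega -> R, forall k, simple_function X (h k) &
        {ae nu, forall x,
          fs_norm X (fun w => h k x w - f x w) @[k --> \oo] --> (0 : R)}].

Definition bochner_norm X (p : \bar R) f : \bar R :=
  Lnorm nu p (fun x => (fs_norm X (f x))%:E).

Definition bochner_Lp X (p : \bar R) f : Prop :=
  strongly_measurable X f /\ (bochner_norm X p f < +oo)%E.

Definition avg (p : R) (f : T -> R) (Q : set T) : \bar R :=
  (((nu Q)^-1 * \int[nu]_(x in Q) (`|f x| `^ p)%:E) `^ p^-1)%E.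

End vector_valued_functions.

Section hardy_littlewood.
Context {R : realType} {dO : measure_display} {Omega : measurableType dO}.
Context (mu : {sigma_finite_measure set Omega -> \bar R}).

Definition half_open_interval (Q : set (measurableTypeR R)) : Prop :=
  exists a b : R, a < b /\ Q = `[a, b[%classic.

Definition multi_maximal (n : nat) (r : 'I_n -> R) (D : seq (set (measurableTypeR R)))
    (f : 'I_n -> measurableTypeR R -> Omega -> R)
    (x : measurableTypeR R) (w : Omega) : \bar R :=
  (\big[maxe/0]_(Q <- D)
    ((\prod_j avg lebesgue_measure (r j) (f j ^~ w) Q) * (\1_Q x)%:E))%E.

Definition HL (n : nat) (r : 'I_n -> R) (X : 'I_n -> funspace R Omega) : Prop :=
  [/\ qbfs_tuple mu X, forall j, p_convex (r j) (X j) &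
    exists2 p : 'I_n -> \bar R, (forall j, (r j)%:E < p j)%E &
    exists C : R, forall (D : seq (set (measurableTypeR R)))
        (f : 'I_n -> measurableTypeR R -> Omega -> R),
      (forall Q, Q \in D -> half_open_interval Q) ->
      (forall j, bochner_Lp lebesgue_measure (X j) (p j) (f j)) ->
      (Lnorm lebesgue_measure (hsum p)
        (fun x => fs_enorm mu (fs_prod mu X) (multi_maximal r D f x)) <=
      C%:E * \prod_j bochner_norm lebesgue_measure (X j) (p j) (f j))%E].

Definition UMD (m : nat) (r : 'I_m -> R) (s : \bar R)
    (X : 'I_m -> funspace R Omega) : Prop :=
  [/\ (hsum (fun j => (r j)%:E) < s)%E, is_bfs mu (fs_prod mu X),
      order_continuous mu (fs_prod mu X) &
      HL (snoc r (fine (hoelder_conjugate s)))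
         (snoc X (fs_dual mu (fs_prod mu X)))].

End hardy_littlewood.

Section sparse_domination.
Context {R : realType} {d : nat}.
Local Notation Rd := (euclid R d).
Local Notation leb := (lebesgue R d).

Definition cube (Q : set Rd) : Prop :=
  exists (a : 'I_d -> R) (l : R), 0 < l /\ Q = box a (fun i => a i + l).

Definition sparse (S : set (set Rd)) : Prop :=
  S `<=` cube /\
  exists E : set Rd -> set Rd, trivIset S E /\
    forall Q, S Q -> [/\ measurable (E Q), E Q `<=` Q &
      (2^-1%:E * leb Q <= leb (E Q))%E].

Definition sparse_form (m : nat) (r : 'I_m -> R) (q : R) (S : set (set Rd))
    (f : 'I_m -> Rd -> R) (g : Rd -> R) : \bar R :=
  (\esum_(Q in S) ((\prod_j avg leb (r j) (f j) Q) * avg leb q g Q * leb Q))%E.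

(* Tuples carry no topology in the library: compactness is that of row vectors. *)
Definition compact_euclid (K : set Rd) : Prop :=
  compact ((fun x : Rd => (\row_i tnth x i) : 'rV[R]_d) @` K).

Definition Linfc (f : Rd -> R) : Prop :=
  [/\ measurable_fun setT f, (Lnorm leb +oo (EFin \o f) < +oo)%E &
      exists K, compact_euclid K /\ {ae leb, forall x, ~ K x -> f x = 0}].

Context {dO : measure_display} {Omega : measurableType dO}.

(* Simple functions are automatically bounded. *)
Definition simple_Linfc (X : funspace R Omega) (f : Rd -> Omega -> R) : Prop :=
  simple_function X f /\
  exists K, compact_euclid K /\ forall x w, ~ K x -> f x w = 0.

(* F is the function (x, w) |-> T (f (., w)) x, as an element of
   L^0(R^d x Omega): since T (f (., w)) is only determined almost everywhere on
   R^d, F is a jointly measurable function that agrees with it almost everywhere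
   on R^d for almost every w; this determines F up to a null set. *)
Definition is_extension (mu : {sigma_finite_measure set Omega -> \bar R})
    (m : nat) (T : ('I_m -> Rd -> R) -> Rd -> R)
    (f : 'I_m -> Rd -> Omega -> R) (F : Rd -> Omega -> R) : Prop :=
  measurable_fun setT (fun z : Rd * Omega => F z.1 z.2) /\
  {ae mu, forall w, {ae leb, forall x, F x w = T (fun j => f j ^~ w) x}}.

End sparse_domination.

(* Main.v *)
(* For a vector-valued F = T(f), the norm of F(x) is a supremum of pairings of |F(x)| with
   countably many functionals eta_k; choosing the best one among the first n at each point x
   and calling g~(x, w) = g(x) eta_k(x)(w), the left-hand side is the integral of |F| |g~| over
   R^d x Omega. For fixed w the scalar hypothesis bounds the inner integral by a sparse form of
   f(., w), g~(., w), for a sparse collection that depends on w. By the one-third trick this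
   form is at most a constant times the integral of the maximal function of the product of the
   means along 2^d dyadic trees (and a tower of large cubes), a quantity in which the collection
   no longer appears.

   Integrating in w, the Hardy-Littlewood property of (X_1, ..., X_m, X^* ) controls this maximal
   function. The HL bound, transferred to an abstract tree through adic intervals of [0, 1),
   gives a weak-type estimate for bounded martingales, and a good-lambda argument the estimate
   in L^1. Applying it between consecutive principal cubes of the scalar functions |f_j|_{X_j}
   and g bounds the integral by the sum over the principal cubes, which form a sparse family; by
   p-convexity the norm of a mean is at most the mean of the norms. Finally one keeps the best of
   the 2^d families. *)

(* The product of the [X j] and the dual is in general only quasi-normed, so its norm cannot be
   added over many stopping stages without loss. The integral over [Omega] is additive and is
   dominated by that norm: sums are therefore taken under the integral, and HL enters only through a
   bound on the proportion of paths along which the norm of the maximal function is large. This also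
   makes the exponents of HL harmless. Data bounded by constants on the unit interval have the same
   bound in every [L^p], and the level set estimate makes sense even when the target exponent is
   below 1. Restarting at the first bad word halves the mass each time, whence the factor 2 in the
   [L^1] estimate.

   Two measurability problems shape the argument. The sparse collection given for [w] is not known
   to depend measurably on [w], so it is replaced by the majorant before integrating in [w]. Norms
   of vector-valued functions are not known to be measurable either, so their integrals are compared
   with those of measurable functions only. *)
Require Import Defs.
From HB Require Import structures.
From mathcomp Require Import all_boot all_order all_algebra.
From mathcomp Require Import all_classical all_reals all_analysis.
From mathcomp Require Import finmap measurable_realfun ess_sup_inf zify ring lra.
Import Order.TTheory GRing.Theory Num.Theory.
Import numFieldNormedType.Exports.
Local Open Scope classical_set_scope.
Local Open Scope ring_scope.
Set Implicit Arguments. Unset Strict Implicit. Unset Printing Implicit Defensive.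

(** * The Hahn-Banach theorem *)

Section hahn_banach.
Context {R : realType} {V : lmodType R} (W : set V).
Hypothesis W0 : W 0.
Hypothesis WD : forall x y, W x -> W y -> W (x + y).
Hypothesis WZ : forall (c : R) x, W x -> W (c *: x).

Definition sublinear_on (q : V -> R) :=
  (forall x y, W x -> W y -> q (x + y) <= q x + q y) /\
  (forall (c : R) x, 0 <= c -> W x -> q (c *: x) = c * q x).

Let WN x : W x -> W (- x).
Proof. by move=> Wx; rewrite -scaleN1r; exact: WZ. Qed.

Lemma sublinear_on0 q : sublinear_on q -> q 0 = 0.
Proof. by move=> [_ /(_ 0 0)]; rewrite scale0r mul0r; apply. Qed.

Lemma sublinear_onN q x : sublinear_on q -> W x -> - q (- x) <= q x.
Proof.
move=> sq Wx; rewrite lerNl -subr_ge0 opprK addrC -(sublinear_on0 sq).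
by rewrite -(subrr x); apply: sq.1 => //; exact: WN.
Qed.

Let slope (q : V -> R) (x y : V) : set R :=
  [set q (y + t *: x) - t * q x | t in [set t | 0 <= t]].

Let slope_neq0 q x y : slope q x y !=set0.
Proof. by exists (q (y + 0 *: x) - 0 * q x), 0 => //=. Qed.

Let slope_lb q x y : sublinear_on q -> W x -> W y ->
  lbound (slope q x y) (- q (- y)).
Proof.
move=> sq Wx Wy _ [t /= t0 <-].
rewrite lerBrDr addrC -sq.2// lerBlDr.
have := sq.1 (y + t *: x) (- y) (WD Wy (WZ t Wx)) (WN Wy).
by rewrite [y + _]addrC addrK.
Qed.

(** This lowers [q] as far as possible along [x]: the infimum is sublinear, at most [q], and at most
    [- q x] at [- x]. For a minimal [q] this forces [q (- x) = - q x], hence linearity. *)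
Let directional q x y := inf (slope q x y).

Let directional_le q x y (t : R) : sublinear_on q -> W x -> W y -> 0 <= t ->
  directional q x y <= q (y + t *: x) - t * q x.
Proof.
move=> sq Wx Wy t0; apply: ge_inf; last by exists t.
by exists (- q (- y)); exact: slope_lb.
Qed.

Let directional_sub q x : sublinear_on q -> W x -> sublinear_on (directional q x).
Proof.
move=> sq Wx; split=> [y z Wy Wz|c y c0 Wy].
  rewrite -lerBlDr; apply: lb_le_inf; first exact: slope_neq0.
  move=> _ [s /= s0 <-]; rewrite lerBlDl -lerBlDr.
  apply: lb_le_inf; first exact: slope_neq0.
  move=> _ [t /= t0 <-]; rewrite lerBlDr.
  apply: (le_trans (@directional_le q x (y + z) (s + t) sq Wx (WD Wy Wz) _)).
    exact: addr_ge0.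
  have -> : y + z + (s + t) *: x = (y + s *: x) + (z + t *: x).
    by rewrite scalerDl addrACA.
  have := sq.1 (y + s *: x) (z + t *: x) (WD Wy (WZ s Wx)) (WD Wz (WZ t Wx)).
  lra.
move: c0; rewrite le_eqVlt => /predU1P[<-|c0].
  rewrite scale0r mul0r; apply/eqP; rewrite eq_le; apply/andP; split.
    have := @directional_le q x 0 0 sq Wx W0 (lexx _).
    by rewrite scale0r addr0 mul0r subr0 (sublinear_on0 sq).
  apply: lb_le_inf; first exact: slope_neq0.
  by have := slope_lb sq Wx W0; rewrite oppr0 (sublinear_on0 sq) oppr0.
apply/eqP; rewrite eq_le; apply/andP; split; last first.
  apply: lb_le_inf; first exact: slope_neq0.
  move=> _ [t /= t0 <-]; rewrite -ler_pdivlMl//.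
  apply: (le_trans (@directional_le q x y (c^-1 * t) sq Wx Wy _)).
    by rewrite mulr_ge0// invr_ge0 ltW.
  have -> : y + (c^-1 * t) *: x = c^-1 *: (c *: y + t *: x).
    by rewrite scalerDr !scalerA mulVf ?gt_eqF// scale1r.
  rewrite sq.2 ?invr_ge0 ?(ltW c0)//; last by apply: WD; exact: WZ.
  by rewrite mulrBr mulrA.
rewrite -ler_pdivrMl//; apply: lb_le_inf; first exact: slope_neq0.
move=> _ [t /= t0 <-]; rewrite ler_pdivrMl//.
apply: (le_trans (@directional_le q x (c *: y) (c * t) sq Wx (WZ c Wy) _)).
  by rewrite mulr_ge0// ltW.
rewrite -scalerA -scalerDr sq.2 ?(ltW c0)//; last by apply: WD => //; exact: WZ.
by rewrite mulrBr mulrA.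
Qed.

Let directional_leq q x y : sublinear_on q -> W x -> W y ->
  directional q x y <= q y.
Proof.
move=> sq Wx Wy; have := @directional_le q x y 0 sq Wx Wy (lexx _).
by rewrite scale0r addr0 mul0r subr0.
Qed.

Let directional_opp q x : sublinear_on q -> W x -> directional q x (- x) <= - q x.
Proof.
move=> sq Wx; have := @directional_le q x (- x) 1 sq Wx (WN Wx) ler01.
by rewrite scale1r addNr (sublinear_on0 sq) mul1r sub0r.
Qed.

(* Zorn's lemma: a minimal element among the sublinear functionals below [p] is linear. *)
Theorem hahn_banach (p : V -> R) (x0 : V) : sublinear_on p -> W x0 ->
  exists f : V -> R, [/\
    forall x y, W x -> W y -> f (x + y) = f x + f y,
    forall (c : R) x, W x -> f (c *: x) = c * f x,
    forall x, W x -> f x <= p x & f x0 = p x0].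
Proof.
(* Zorn's lemma is applied below [directional p x0] and not just below [p]: its value at [- x0] is
   at most [- p x0], which yields [f x0 = p x0] at the end. *)
move=> sp Wx0; set p1 := directional p x0.
have sp1 : sublinear_on p1 by exact: directional_sub.
pose T := {q : V -> R | sublinear_on q /\ forall x, W x -> q x <= p1 x}.
pose t0 : T := exist _ p1 (conj sp1 (fun x _ => lexx _)).
pose rl (s t : T) : bool := `[< forall x, W x -> sval t x <= sval s x >].
have [| |A totA|[q [sq qp1]] /= minq] := @ZL_preorder T t0 rl.
- by move=> t; apply/asboolP.
- move=> r s t /asboolP rs /asboolP st; apply/asboolP => x Wx.
  exact: le_trans (st _ Wx) (rs _ Wx).
- have [[a Aa]|A0] := pselect (A !=set0); last first.
    by exists t0 => s As; exfalso; apply: A0; exists s.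
  pose vals x := [set sval s x | s in A].
  have vals0 x : vals x !=set0 by exists (sval a x), a.
  have valslb x : W x -> lbound (vals x) (- p1 (- x)).
    move=> Wx _ [s As <-]; have [ss sp1'] := proj2_sig s.
    apply: le_trans (sublinear_onN ss Wx).
    by rewrite lerN2; apply: sp1'; exact: WN.
  have le_vals x s : W x -> A s -> inf (vals x) <= sval s x.
    move=> Wx As; apply: ge_inf; last by exists s.
    by exists (- p1 (- x)); exact: valslb.
  have si : sublinear_on (fun x => inf (vals x)).
    split=> [x y Wx Wy|c x c0 Wx].
      rewrite -lerBlDr; apply: lb_le_inf => // _ [s As <-].
      rewrite lerBlDl -lerBlDr; apply: lb_le_inf => // _ [t At <-].
      rewrite lerBlDr.
      (* Two elements of the chain are comparable, and the smaller one serves for both arguments;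
         this makes the infimum of the chain subadditive. *)
      have [u [Au us ut]] : exists u, [/\ A u, rl s u & rl t u].
        have [st|ts] := totA _ _ As At.
          by exists t; split => //; apply/asboolP.
        by exists s; split => //; apply/asboolP.
      apply: le_trans (le_vals _ _ (WD Wx Wy) Au) _.
      apply: le_trans ((proj1 (proj2_sig u)).1 _ _ Wx Wy) _.
      rewrite addrC; apply: lerD.
        by move/asboolP: ut; apply.
      by move/asboolP: us; apply.
    move: c0; rewrite le_eqVlt => /predU1P[<-|c0].
      rewrite scale0r mul0r; apply/eqP; rewrite eq_le; apply/andP; split.
        apply: le_trans (le_vals _ _ W0 Aa) _.
        by rewrite (sublinear_on0 (proj1 (proj2_sig a))).
      apply: lb_le_inf => // _ [s As <-].
      by rewrite (sublinear_on0 (proj1 (proj2_sig s))).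
    apply/eqP; rewrite eq_le; apply/andP; split.
      rewrite -ler_pdivrMl//; apply: lb_le_inf => // _ [s As <-].
      rewrite ler_pdivrMl//; apply: le_trans (le_vals _ _ (WZ c Wx) As) _.
      by rewrite (proj1 (proj2_sig s)).2// ltW.
    apply: lb_le_inf => // _ [s As <-].
    rewrite (proj1 (proj2_sig s)).2 ?(ltW c0)// ler_wpM2l ?(ltW c0)//.
    exact: le_vals.
  have ip1 x : W x -> inf (vals x) <= p1 x.
    move=> Wx; apply: le_trans (le_vals _ _ Wx Aa) _.
    by case: (proj2_sig a) => _; apply.
  exists (exist _ (fun x => inf (vals x)) (conj si ip1) : T) => s As; apply/asboolP => x Wx /=.
  exact: le_vals.
have qN x : W x -> q (- x) = - q x.
  move=> Wx; apply/eqP; rewrite eq_le; apply/andP; split; last first.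
    by rewrite lerNl; exact: sublinear_onN.
  have sd := directional_sub sq Wx.
  have dp1 y : W y -> directional q x y <= p1 y.
    by move=> Wy; exact: le_trans (directional_leq sq Wx Wy) (qp1 _ Wy).
  have := minq (exist _ (directional q x) (conj sd dp1) : T); rewrite /rl /= => /(_ _)/asboolP qd.
  apply: le_trans (qd _ (- x) (WN Wx)) _; last exact: directional_opp.
  by apply/asboolP => y Wy; exact: directional_leq.
exists q; split.
- move=> x y Wx Wy; apply/eqP; rewrite eq_le; apply/andP; split; first exact: sq.1.
  have := sq.1 _ _ (WN Wx) (WN Wy).
  by rewrite -opprD !qN//; [lra | exact: WD].
- move=> c x Wx; have [c0|c0] := leP 0 c; first exact: sq.2.
  rewrite -[c]opprK scaleNr qN; last exact: WZ.
  by rewrite sq.2 ?oppr_ge0 ?(ltW c0)// -mulNr.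
- move=> x Wx; apply: le_trans (qp1 _ Wx) _; exact: directional_leq.
- apply/eqP; rewrite eq_le; apply/andP; split.
    apply: le_trans (qp1 _ Wx0) _; exact: directional_leq.
  rewrite -lerN2 -qN//; apply: le_trans (qp1 _ (WN Wx0)) _.
  exact: directional_opp.
Qed.

End hahn_banach.

(** * Banach function spaces and norming functionals *)

Section arbitrary_integrands.
Context {d} {T : measurableType d} {R : realType}.
Context (mu : {measure set T -> \bar R}).
Import HBNNSimple.

(** The integral of the positive part of [f] is a supremum over simple functions below it,
    measurable or not, and each of these is almost everywhere at most [g]. *)
Lemma integral_le_ae_measurable (f g : T -> \bar R) :
  measurable_fun setT g -> (forall x, 0 <= g x)%E ->
  {ae mu, forall x, (f x <= g x)%E} ->
  (\int[mu]_x f x <= \int[mu]_x g x)%E.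
Proof.
move=> mg g0 fg; rewrite integralE.
have f_ge0 : (0 <= \int[mu]_x f^\- x)%E by exact: integral_ge0.
apply: (@le_trans _ _ (\int[mu]_x f^\+ x)%E).
  by rewrite geeDl// oppe_le0.
rewrite ge0_integralTE//; apply: ge_ereal_sup => _ [h /= hf <-].
rewrite -integralT_nnsfun; apply: ae_ge0_le_integral => //.
- by move=> x _; rewrite lee_fin.
- exact/measurable_EFinP.
apply: filterS fg => x fgx _; apply: le_trans (hf x) _.
by rewrite funeposE ge_max fgx g0.
Qed.

(** The function [c] on [A] is one of the simple functions in the supremum that defines the
    integral; this gives Chebyshev's inequality for norms of unknown measurability. *)
Lemma integral_ge_cst_indic (f : T -> \bar R) (A : set T) (c : R) :
  measurable A -> 0 <= c -> (forall x, 0 <= f x)%E ->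
  (forall x, A x -> c%:E <= f x)%E ->
  (c%:E * mu A <= \int[mu]_x f x)%E.
Proof.
move=> mA c0 f0 fA; rewrite ge0_integralTE//.
pose h : {nnsfun T >-> R} := scale_nnsfun (indic_nnsfun R mA) c0.
have -> : (c%:E * mu A = sintegral mu h)%E.
  by rewrite (sintegralrM mu c (indic_nnsfun R mA)) sintegral_indic.
apply: ereal_sup_ubound; exists h => // x.
have -> : h x = c * \1_A x by [].
rewrite indicE; case: (boolP (x \in A)) => [|_]; last by rewrite mulr0 f0.
by rewrite in_setE mulr1; exact: fA.
Qed.

End arbitrary_integrands.

Section function_space_theory.
Context {R : realType} {dO : measure_display} {Omega : measurableType dO}.
Context (mu : {sigma_finite_measure set Omega -> \bar R}).
Variable X : funspace R Omega.
Hypothesis hX : is_qbfs mu X.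
Implicit Types xi eta h : Omega -> R.

Lemma qbfs_mem0 : fs_mem X (fun=> 0).
Proof.
have [xi mxi _] := qbfs_unit hX.
have := qbfs_scale hX 0 mxi.
by under eq_fun do rewrite mul0r.
Qed.

Lemma qbfs_mem_le xi eta : measurable_fun setT xi -> fs_mem X eta ->
  (forall w, `|xi w| <= `|eta w|) -> fs_mem X xi.
Proof. by move=> mxi meta le; case: (qbfs_solid hX mxi meta (aeW mu le)). Qed.

Lemma qbfs_norm_le xi eta : measurable_fun setT xi -> fs_mem X eta ->
  (forall w, `|xi w| <= `|eta w|) -> fs_norm X xi <= fs_norm X eta.
Proof. by move=> mxi meta le; case: (qbfs_solid hX mxi meta (aeW mu le)). Qed.

Lemma qbfs_norm0 : fs_norm X (fun=> 0) = 0.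
Proof. by apply/(qbfs_norm_eq0 hX qbfs_mem0); apply: aeW. Qed.

Lemma qbfs_mem_abs xi : fs_mem X xi -> fs_mem X (fun w => `|xi w|).
Proof.
move=> mxi; apply: (qbfs_mem_le _ mxi) => [|w]; last by rewrite normr_id.
by apply: measurableT_comp => //; exact: (qbfs_measurable hX mxi).
Qed.

Lemma qbfs_norm_abs xi : fs_mem X xi -> fs_norm X (fun w => `|xi w|) = fs_norm X xi.
Proof.
move=> mxi; have m1 := qbfs_measurable hX mxi.
have m2 := qbfs_measurable hX (qbfs_mem_abs mxi).
apply/eqP; rewrite eq_le; apply/andP; split; apply: qbfs_norm_le => //.
- by move=> w; rewrite normr_id.
- exact: qbfs_mem_abs.
- by move=> w; rewrite normr_id.
Qed.

Lemma qbfs_memN xi : fs_mem X xi -> fs_mem X (fun w => - xi w).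
Proof.
move=> mxi; have := qbfs_scale hX (-1) mxi.
by under eq_fun do rewrite mulN1r.
Qed.

Lemma qbfs_memB xi eta : fs_mem X xi -> fs_mem X eta ->
  fs_mem X (fun w => xi w - eta w).
Proof. by move=> mxi /qbfs_memN; exact: (qbfs_add hX). Qed.

Lemma qbfs_normN xi : fs_mem X xi -> fs_norm X (fun w => - xi w) = fs_norm X xi.
Proof.
move=> mxi; under eq_fun do rewrite -mulN1r.
by rewrite (qbfs_normZ hX)// normrN1 mul1r.
Qed.

Lemma qbfs_mem_sum (I : Type) (s : seq I) (xi : I -> Omega -> R) :
  (forall i, fs_mem X (xi i)) -> fs_mem X (fun w => \sum_(i <- s) xi i w).
Proof.
move=> mxi; elim: s => [|i s IHs].
  by under eq_fun do rewrite big_nil; exact: qbfs_mem0.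
by under eq_fun do rewrite big_cons; exact: (qbfs_add hX).
Qed.

Lemma qbfs_mem_max xi eta : fs_mem X xi -> fs_mem X eta ->
  fs_mem X (fun w => Num.max (xi w) (eta w)).
Proof.
move=> mxi meta.
apply: (qbfs_mem_le _ (qbfs_add hX (qbfs_mem_abs mxi) (qbfs_mem_abs meta))).
  by apply: measurable_maxr; [exact: (qbfs_measurable hX mxi)|
    exact: (qbfs_measurable hX meta)].
move=> w; rewrite [leRHS]ger0_norm ?addr_ge0//.
by case: (leP (xi w) (eta w)); rewrite ?lerDl ?lerDr.
Qed.

Lemma fs_dual_ge0 eta : 
  fs_mem (fs_dual mu X) eta -> 0 <= fs_norm (fs_dual mu X) eta.
Proof.
move=> [_ _ [C hC]] /=; apply: (@le_trans _ _ `|\int[mu]_w (0 * eta w)|) => //.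
apply: sup_ubound; last first.
  by exists (fun=> 0) => //; split; [exact: qbfs_mem0|rewrite qbfs_norm0].
exists `|C| => _ [xi [mxi n1] <-]; apply: le_trans (hC _ mxi) _.
apply: (@le_trans _ _ (`|C| * fs_norm X xi)).
  by rewrite ler_wpM2r ?ler_norm// (qbfs_norm_ge0 hX).
by rewrite ler_piMr.
Qed.

Lemma fs_dual_bound xi eta : fs_mem X xi -> fs_mem (fs_dual mu X) eta ->
  `|\int[mu]_w (xi w * eta w)| <= fs_norm X xi * fs_norm (fs_dual mu X) eta.
Proof.
move=> mxi meta; have [_ ieta [C hC]] := meta.
have := qbfs_norm_ge0 hX mxi; rewrite le_eqVlt => /predU1P[n0|n0].
  by move: (hC _ mxi); rewrite -n0 mulr0 mul0r.
have mxi' := qbfs_scale hX (fs_norm X xi)^-1 mxi.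
rewrite -ler_pdivrMl//; apply: sup_ubound.
  exists `|C| => _ [zeta [mzeta n1] <-]; apply: le_trans (hC _ mzeta) _.
  apply: (@le_trans _ _ (`|C| * fs_norm X zeta)).
    by rewrite ler_wpM2r ?ler_norm// (qbfs_norm_ge0 hX).
  by rewrite ler_piMr.
exists (fun w => (fs_norm X xi)^-1 * xi w).
  by split => //; rewrite (qbfs_normZ hX)// normfV gtr0_norm// mulVf// gt_eqF.
under eq_Rintegral do rewrite -mulrA.
rewrite RintegralZl//; last exact: ieta.
by rewrite normrM normfV (gtr0_norm n0).
Qed.

End function_space_theory.

Section positive_functional.
Context {R : realType} {dO : measure_display} {Omega : measurableType dO}.
Context (mu : {sigma_finite_measure set Omega -> \bar R}).
Variable X : funspace R Omega.
Hypothesis hX : is_bfs mu X.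
Hypothesis ocX : order_continuous mu X.
Let qX : is_qbfs mu X := hX.1.
Variable f : (Omega -> R) -> R.
Hypothesis fD : forall x y, fs_mem X x -> fs_mem X y ->
  f (fun w => x w + y w) = f x + f y.
Hypothesis fZ : forall c x, fs_mem X x -> f (fun w => c * x w) = c * f x.
Hypothesis f_pos : forall x, fs_mem X x -> (forall w, 0 <= x w) -> 0 <= f x.
Hypothesis f_le : forall x, fs_mem X x -> `|f x| <= fs_norm X x.
Variable e : Omega -> R.
Hypothesis me : fs_mem X e.
Hypothesis e_ge0 : forall w, 0 <= e w.

Let indic_mem A : measurable A -> fs_mem X (fun w => \1_A w * e w).
Proof.
move=> mA; have m1 := qbfs_measurable qX me.
apply: (qbfs_mem_le qX _ me); first exact: measurable_funM.
by move=> w; rewrite normrM ler_piMl// ger0_norm// indicE; case: (_ \in _).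
Qed.

Let f0 : f (fun=> 0) = 0.
Proof.
have -> : (fun=> 0) = (fun w => 0 * e w) by apply/funext => w; rewrite mul0r.
by rewrite fZ// mul0r.
Qed.

Let f_sum (I : Type) (s : seq I) (x : I -> Omega -> R) :
  (forall i, fs_mem X (x i)) -> f (fun w => \sum_(i <- s) x i w) = \sum_(i <- s) f (x i).
Proof.
move=> mx; elim: s => [|i s IHs].
  by rewrite big_nil -f0; congr f; apply/funext => w; rewrite big_nil.
rewrite big_cons -IHs -fD//; last exact: (qbfs_mem_sum qX).
by congr f; apply/funext => w; rewrite big_cons.
Qed.

Let f_ae0 x : fs_mem X x -> {ae mu, forall w, x w = 0} -> f x = 0.
Proof.
move=> mx /(qbfs_norm_eq0 qX mx) n0; apply/eqP; rewrite -normr_le0 -n0.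
exact: f_le.
Qed.

Let f_cvg (u : nat -> Omega -> R) x : (forall n, fs_mem X (u n)) -> fs_mem X x ->
  increases_to mu u x -> f (u n) @[n --> \oo] --> f x.
Proof.
move=> mem_u mx ux.
have c0 := ocX (fun n => qbfs_measurable qX (mem_u n)) mx ux.
apply/subr_cvg0; apply: norm_cvg0.
apply: (@squeeze_cvgr _ _ _ _ (fun=> 0) (fun n => fs_norm X (fun w => u n w - x w))) => //; last exact: cvg_cst.
apply: nearW => n; rewrite normr_ge0/=.
have -> : f (u n) - f x = f (fun w => u n w - x w).
  rewrite fD//; last exact: (qbfs_memN qX).
  congr (_ + _); rewrite -mulN1r -fZ//; congr f.
  by apply/funext => w; rewrite mulN1r.
exact/f_le/(qbfs_memB qX).
Qed.

(** The weight [e] is there because indicators need not lie in [X], while their products with a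
    member do. *)
Definition functional_measure (A : set Omega) : \bar R :=
  (f (fun w => \1_A w * e w))%:E.
Local Notation nu := functional_measure.

Let nu0 : nu set0 = 0%E.
Proof.
rewrite /nu -[RHS]/(0%:E); congr (_%:E); rewrite -f0; congr f.
by apply/funext => w; rewrite indic0 mul0r.
Qed.

(* Negative values can only occur on non-measurable sets, so they are truncated. *)
Definition functional_measure_pos (A : set Omega) : \bar R := maxe (nu A) 0%E.
Local Notation nup := functional_measure_pos.

Let nupE A : measurable A -> nup A = nu A.
Proof.
move=> mA; apply/max_idPl; rewrite lee_fin; apply: f_pos; first exact: indic_mem.
by move=> w; rewrite mulr_ge0.
Qed.

Let nup0 : nup set0 = 0%E.
Proof. by rewrite nupE. Qed.

Let nup_ge0 A : (0 <= nup A)%E.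
Proof. by rewrite le_max lexx orbT. Qed.

Let nup_sigma_additive : semi_sigma_additive nup.
Proof.
move=> F mF tF mUF; rewrite nupE// /nu.
have -> : (fun n => \sum_(0 <= i < n) nup (F i))%E =
    (fun n => (f (fun w => \sum_(i < n) \1_(F i) w * e w))%:E).
  apply/funext => n; under eq_bigr do rewrite nupE// /nu.
  by rewrite sumEFin big_mkord f_sum// => i; exact: indic_mem.
apply: cvg_EFin; first by apply: nearW => n.
(* Sigma-additivity is order continuity applied to the increasing partial sums. *)
apply: f_cvg.
- by move=> n; apply: (qbfs_mem_sum qX) => i; exact: indic_mem.
- exact: indic_mem.
apply: aeW => w; split.
- by move=> n; apply: sumr_ge0 => i _; rewrite mulr_ge0.
- apply/nondecreasing_seqP => n; rewrite big_ord_recr/= lerDl mulr_ge0//.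
apply: cvg_near_cst.
have [[i _ Fiw]|Fw] := pselect ((\bigcup_n F n) w); last first.
  apply: nearW => n; rewrite indicE memNset// mul0r big1// => i _.
  by rewrite indicE memNset ?mul0r// => Fiw; apply: Fw; exists i.
exists i.+1 => //= n /= ilen; rewrite (bigD1 (Ordinal ilen))//= big1 => [|j ji].
  by rewrite addr0 !indicE !mem_set//; exists i.
rewrite indicE memNset ?mul0r// => Fjw.
move/negP: ji; apply; apply/eqP/val_inj => /=.
by apply: contrapT => /eqP ji; move/trivIsetP: tF => /(_ _ _ I I ji)/seteqP[/(_ w) + _]; apply.
Qed.

HB.instance Definition _ := isMeasure.Build _ _ _ nup nup0 nup_ge0
  nup_sigma_additive.

Let nup_fin : fin_num_fun nup.
Proof. by move=> A mA; rewrite nupE. Qed.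

HB.instance Definition _ := Measure_isFinite.Build _ _ _ nup nup_fin.

Let nup_dom : nup `<< mu.
Proof.
apply/null_content_dominatesP => A mA A0; rewrite nupE// /nu f_ae0//.
  exact: indic_mem.
exists A; split => // w /= wA; apply: contrapT => Aw; apply: wA.
by rewrite indicE memNset// mul0r.
Qed.

Import HBNNSimple.

Let f_nnsfun (s : {nnsfun Omega >-> R}) :
  (f (fun w => s w * e w))%:E = (\int[nup]_w (s w)%:E)%E.
Proof.
rewrite integralT_nnsfun sintegralE.
rewrite fsbig_finite//=.
have -> : (fun w => s w * e w) = (fun w => \sum_(y <- fset_set (range s))
    y * (\1_(s @^-1` [set y]) w * e w)).
  apply/funext => w; rewrite {1}fimfunE fsbig_finite//= mulr_suml.
  by apply: eq_bigr => y _; rewrite mulrA.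
rewrite f_sum => [|y]; last by apply: (qbfs_scale qX); exact: indic_mem.
rewrite -sumEFin; apply: eq_bigr => y _.
by rewrite fZ ?nupE// ?EFinM//; exact: indic_mem.
Qed.

Let measurable_e_inv : measurable_fun setT (fun w => (e w)^-1).
Proof.
rewrite (_ : (fun w => _) = (fun w => e w `^ (-1))); last first.
  by apply/funext => w; rewrite powR_inv1.
exact: (measurableT_comp (measurable_powR (-1)) (qbfs_measurable qX me)).
Qed.

(** Simple functions [s n] increasing to [h / e] give members [s n * e] of [X] increasing to [h];
    order continuity on one side and monotone convergence on the other compute the same limit. *)
Lemma functional_measureE h : {ae mu, forall w, 0 < e w} ->
    fs_mem X h -> (forall w, 0 <= h w) ->
  (f h)%:E = (\int[nup]_w (h w / e w)%:E)%E.
Proof.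
move=> epos mh h_ge0.
have mg : measurable_fun setT (fun w => (h w / e w)%:E).
  apply/measurable_EFinP; apply: measurable_funM; first exact: (qbfs_measurable qX mh).
  exact: measurable_e_inv.
pose s n := nnsfun_approx measurableT mg n.
have g_ge0 w : (0 <= (h w / e w)%:E)%E by rewrite lee_fin divr_ge0.
have scvg w : s n w @[n --> \oo] --> h w / e w.
  by have := cvg_nnsfun_approx measurableT mg (fun x _ => g_ge0 x) (I : setT w) => /fine_cvg.
have snd w : nondecreasing_seq (s ^~ w).
  by move=> m n mn; have /lefP := nd_nnsfun_approx measurableT mg mn; exact.
have sle n w : s n w <= h w / e w.
  rewrite -(cvg_lim _ (scvg w))//; apply: nondecreasing_cvgn_le => //.
  by apply/cvg_ex; exists (h w / e w).
have smem n : fs_mem X (fun w => s n w * e w).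
  apply: (qbfs_solid qX _ mh _).1; first by apply: measurable_funM => //; exact: (qbfs_measurable qX me).
  apply: filterS epos => w ew; rewrite !ger0_norm ?mulr_ge0//.
  by rewrite -ler_pdivlMr.
have c1 : (\int[nup]_w (s n w)%:E)%E @[n --> \oo] --> (\int[nup]_w (h w / e w)%:E)%E.
  have -> : (\int[nup]_w (h w / e w)%:E = \int[nup]_w limn (fun n => (s n w)%:E))%E.
    apply: eq_integral => w _; apply/esym/cvg_lim => //; apply: cvg_EFin => //.
    by apply: nearW.
    exact: scvg.
  apply: cvg_monotone_convergence => //.
  - by move=> n; apply/measurable_EFinP.
  - by move=> n w _; rewrite lee_fin.
  - by move=> w _ m n mn; rewrite lee_fin; exact: snd.
have c2 : (\int[nup]_w (s n w)%:E)%E @[n --> \oo] --> (f h)%:E.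
  rewrite (_ : (fun n => _) = (fun n => (f (fun w => s n w * e w))%:E)); last first.
    by apply/funext => n; rewrite f_nnsfun.
  apply: cvg_EFin; first exact: nearW.
  apply: f_cvg => //; apply: filterS epos => w ew; split.
  - by move=> n; rewrite mulr_ge0.
  - by move=> m n mn; rewrite ler_wpM2r// snd.
  - by rewrite -[h w](divfK (lt0r_neq0 ew)); apply: cvgMr_tmp.
exact: cvg_unique c2 c1.
Qed.

(** The measure is absolutely continuous because functions vanishing almost everywhere have norm
    zero. With its Radon-Nikodym derivative [D], [f h] is the integral of [h / e * D], so that the
    density sought is [D / e]. *)
Lemma functional_density : {ae mu, forall w, 0 < e w} ->
  exists eta : Omega -> R, [/\ measurable_fun setT eta, forall w, 0 <= eta w &
    forall h, fs_mem X h -> (forall w, 0 <= h w) ->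
      (\int[mu]_w (h w * eta w)%:E = (f h)%:E)%E].
Proof.
move=> epos; pose D := Radon_Nikodym_SigmaFinite.f nup mu.
have D_ge0 w : (0 <= D w)%E by exact: Radon_Nikodym_SigmaFinite.f_ge0.
have D_fin w : D w \is a fin_num by exact: Radon_Nikodym_SigmaFinite.f_fin_num.
have mD : measurable_fun setT D.
  by apply: (measurable_int mu); exact: Radon_Nikodym_SigmaFinite.f_integrable.
exists (fun w => fine (D w) / e w); split.
- by apply: measurable_funM => //; exact: measurableT_comp.
- by move=> w; rewrite divr_ge0// fine_ge0.
move=> h mh h_ge0; rewrite functional_measureE//.
rewrite -(@Radon_Nikodym_SigmaFinite.change_of_variables _ _ _ _ mu nup_dom)//.
- by apply: eq_integral => w _; rewrite mulrCA mulrC EFinM fineK.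
- by move=> w; rewrite lee_fin divr_ge0.
- apply/measurable_EFinP; apply: measurable_funM => //.
  exact: (qbfs_measurable qX mh).
Qed.

End positive_functional.

Section norming.
Context {R : realType} {dO : measure_display} {Omega : measurableType dO}.
Context (mu : {sigma_finite_measure set Omega -> \bar R}).

(* Hahn-Banach for [h |-> ||max(h, 0)||], whose dominated functionals are
   positive; order continuity makes them integrals. *)
Lemma fs_dual_norming (X : funspace R Omega) xi :
    is_bfs mu X -> order_continuous mu X -> fs_mem X xi ->
  exists eta, [/\ fs_mem (fs_dual mu X) eta, fs_norm (fs_dual mu X) eta <= 1,
    forall w, 0 <= eta w,
    (\int[mu]_w (`|xi w| * eta w)%:E = (fs_norm X xi)%:E)%E &
    forall h, fs_mem X h ->
      (\int[mu]_w (`|h w| * eta w)%:E <= (fs_norm X h)%:E)%E].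
Proof.
move=> hX ocX mxi; have qX := hX.1.
have [e0 me0 e0pos] := qbfs_unit qX.
pose e w := `|e0 w|.
have me : fs_mem X e by exact: (qbfs_mem_abs qX).
have epos : {ae mu, forall w, 0 < e w}.
  by apply: filterS e0pos => w; rewrite /e normr_gt0; exact: lt0r_neq0.
pose V : lmodType R := (Omega -> R^o).
pose p (h : V) := fs_norm X (fun w => Num.max (h w) 0).
have mem_pos h : fs_mem X h -> fs_mem X (fun w => Num.max (h w) 0).
  by move=> mh; apply: (qbfs_mem_max qX) => //; exact: (qbfs_mem0 qX).
have p_le h : fs_mem X h -> p h <= fs_norm X h.
  move=> mh; apply: (qbfs_norm_le qX) => //.
    exact: (qbfs_measurable qX (mem_pos _ mh)).
  by move=> w; rewrite /Order.max; case: ifP => _; rewrite ?normr0.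
have sp : @sublinear_on R V (fs_mem X) p.
  split=> [x y mx my|c x c0 mx].
    apply: le_trans (hX.2 _ _ (mem_pos _ mx) (mem_pos _ my)).
    apply: (qbfs_norm_le qX).
    - exact: (qbfs_measurable qX (mem_pos _ (qbfs_add qX mx my))).
    - by apply: (qbfs_add qX); exact: mem_pos.
    move=> w; rewrite !ger0_norm; last 2 first.
    - by rewrite addr_ge0// le_max lexx orbT.
    - by rewrite le_max lexx orbT.
    rewrite ge_max; apply/andP; split; last by rewrite addr_ge0// le_max lexx orbT.
    by apply: lerD; rewrite le_max lexx.
  rewrite -[c in RHS]ger0_norm// -(qbfs_normZ qX)//; last exact: mem_pos.
  by congr fs_norm; apply/funext => w; rewrite maxr_pMr// mulr0.
have [f [fD fZ fp fxi]] := @hahn_banach R V (fs_mem X) (qbfs_mem0 qX)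
  (qbfs_add qX) (qbfs_scale qX) p (fun w => `|xi w|) sp (qbfs_mem_abs qX mxi).
have f_le x : fs_mem X x -> `|f x| <= fs_norm X x.
  move=> mx; rewrite ler_norml; apply/andP; split.
    rewrite lerNl; have -> : - f x = f (fun w => - x w).
      rewrite -mulN1r -fZ//; congr f; apply/funext => w /=.
      exact: scaleN1r.
    rewrite -(qbfs_normN qX)//; apply: le_trans (p_le _ (qbfs_memN qX mx)).
    exact/fp/(qbfs_memN qX).
  exact: le_trans (fp _ mx) (p_le _ mx).
(* For [x >= 0] the function [max (- x) 0] vanishes, so that [f (- x) <= p (- x) = 0]. *)
have f_pos x : fs_mem X x -> (forall w, 0 <= x w) -> 0 <= f x.
  move=> mx x0; rewrite -lerN2 oppr0.
  have -> : - f x = f (fun w => - x w).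
    rewrite -mulN1r -fZ//; congr f; apply/funext => w /=.
    exact: scaleN1r.
  apply: le_trans (fp _ (qbfs_memN qX mx)) _.
  rewrite /p (_ : (fun w => _) = (fun=> 0)) ?(qbfs_norm0 qX)//.
  by apply/funext => w; apply/max_idPr; rewrite oppr_le0.
have [eta [meta eta0 etaE]] := @functional_density R dO Omega mu X hX ocX f
  fD fZ f_pos f_le e me (fun=> normr_ge0 _) epos.
have etaEabs h : fs_mem X h -> (\int[mu]_w (`|h w| * eta w)%:E = (f (fun w => `|h w|))%:E)%E.
  by move=> mh; rewrite etaE//; exact: (qbfs_mem_abs qX).
have eta_le h : fs_mem X h -> (\int[mu]_w (`|h w| * eta w)%:E <= (fs_norm X h)%:E)%E.
  move=> mh; rewrite etaEabs// lee_fin -(qbfs_norm_abs qX)//.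
  exact/(le_trans (ler_norm _))/f_le/(qbfs_mem_abs qX).
have int_eta h : fs_mem X h -> mu.-integrable setT (fun w => (h w * eta w)%:E).
  move=> mh; apply/integrableP; split.
    by apply/measurable_EFinP/measurable_funM => //; exact: (qbfs_measurable qX).
  under eq_integral do rewrite abse_EFin normrM (ger0_norm (eta0 _)).
  by rewrite etaEabs// ltry.
have bnd h : fs_mem X h -> `|\int[mu]_w (h w * eta w)| <= fs_norm X h.
  move=> mh; apply: le_trans (le_normr_Rintegral measurableT (int_eta _ mh)) _.
  rewrite -lee_fin /Rintegral fineK.
    under eq_integral do rewrite normrM (ger0_norm (eta0 _)).
    exact: eta_le.
  under eq_integral do rewrite normrM (ger0_norm (eta0 _)).
  by rewrite etaEabs.
have mdual : fs_mem (fs_dual mu X) eta.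
  by split => //; exists 1 => h mh; rewrite mul1r; exact: bnd.
exists eta; split => //.
- apply: ge_sup.
    by exists `|\int[mu]_w (0 * eta w)|, (fun=> 0) => //; split;
      [exact: (qbfs_mem0 qX)|rewrite (qbfs_norm0 qX)].
  by move=> _ [h [mh h1] <-]; exact: le_trans (bnd _ mh) h1.
rewrite etaEabs// fxi /p -(qbfs_norm_abs qX mxi); congr (_%:E); congr fs_norm.
by apply/funext => w; apply/max_idPl.
Qed.

End norming.

(** * Martingales and principal words on a regular tree *)

(* The nodes of the regular tree with branching set D are the words over D,
   the most recent letter first: the children of w are the words a :: w. *)
Section tree.
Context {R : realType} {D : finType}.
Hypothesis D_gt0 : (0 < #|D|)%N.
Local Notation B := (#|D|%:R : R).
Implicit Types (h F : seq D -> R) (u v w x y : seq D).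

Let B_gt0 : 0 < B. Proof. by rewrite ltr0n. Qed.
Let B_neq0 : B != 0. Proof. by rewrite gt_eqF. Qed.

Fixpoint tavg (N : nat) h : R :=
  if N is N'.+1 then tavg N' (fun v => B^-1 * \sum_a h (a :: v)) else h [::].

Lemma eq_tavg N h1 h2 : (forall v, size v = N -> h1 v = h2 v) ->
  tavg N h1 = tavg N h2.
Proof.
elim: N h1 h2 => [|N IHN] h1 h2 eqh /=; first exact: eqh.
by apply: IHN => v vN; congr (_ * _); apply: eq_bigr => a _; apply: eqh => /=; rewrite vN.
Qed.

Lemma le_tavg N h1 h2 : (forall v, size v = N -> h1 v <= h2 v) ->
  tavg N h1 <= tavg N h2.
Proof.
elim: N h1 h2 => [|N IHN] h1 h2 leh /=; first exact: leh.
apply: IHN => v vN; rewrite ler_wpM2l ?invr_ge0 ?ler0n//.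
by apply: ler_sum => a _; apply: leh => /=; rewrite vN.
Qed.

Lemma tavgD N h1 h2 : tavg N (fun v => h1 v + h2 v) = tavg N h1 + tavg N h2.
Proof.
elim: N h1 h2 => [//|N IHN] h1 h2 /=; rewrite -IHN; apply: eq_tavg => v _.
by rewrite big_split mulrDr.
Qed.

Lemma tavgZ N c h : tavg N (fun v => c * h v) = c * tavg N h.
Proof.
elim: N h => [//|N IHN] h /=; rewrite -IHN; apply: eq_tavg => v _.
by rewrite -mulr_sumr mulrCA.
Qed.

Lemma tavg_cst N c : tavg N (fun=> c) = c.
Proof.
elim: N => [//|N IHN] /=; rewrite -[RHS]IHN; apply: eq_tavg => v _.
by rewrite sumr_const -[c *+ _]mulr_natl mulKf.
Qed.

Lemma tavg_sum (I : Type) (s : seq I) N (h : I -> seq D -> R) :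
  tavg N (fun v => \sum_(i <- s) h i v) = \sum_(i <- s) tavg N (h i).
Proof.
elim: s => [|i s IHs].
  by rewrite big_nil -[RHS](tavg_cst N); apply: eq_tavg => v _; rewrite big_nil.
by rewrite big_cons -IHs -tavgD; apply: eq_tavg => v _; rewrite big_cons.
Qed.

Lemma tavg_ge0 N h : (forall v, size v = N -> 0 <= h v) -> 0 <= tavg N h.
Proof. by move=> h0; rewrite -(tavg_cst N 0); exact: le_tavg. Qed.

Lemma tavg_cat M N h :
  tavg (M + N) h = tavg N (fun u => tavg M (fun v => h (v ++ u))).
Proof. by elim: M h => [//|M IHM] h /=; rewrite IHM. Qed.

(** The recursion of [tavg] averages over the newest letter; here the oldest one is split off, that
    is a child of the root, as arguments that restart at a child require. *)
Lemma tavgS N h : tavg N.+1 h = B^-1 * \sum_a tavg N (fun v => h (v ++ [:: a])).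
Proof. by rewrite -addn1 tavg_cat. Qed.

Definition martingale F := forall w, F w = B^-1 * \sum_a F (a :: w).

Lemma martingale_shift F u : martingale F -> martingale (fun w => F (w ++ u)).
Proof. by move=> mF w; rewrite mF. Qed.

Lemma martingale_child F a w : martingale F -> (forall v, 0 <= F v) ->
  F (a :: w) <= B * F w.
Proof.
move=> mF F0; rewrite [F w]mF mulrA mulfV// mul1r (bigD1 a)//= lerDl.
exact: sumr_ge0.
Qed.

Lemma martingale_eq0 F w : martingale F -> (forall v, 0 <= F v) -> F [::] = 0 ->
  F w = 0.
Proof.
move=> mF F0 Fnil; elim: w => [//|a w IHw]; apply/eqP; rewrite eq_le F0 andbT.
by have := martingale_child a w mF F0; rewrite IHw mulr0.
Qed.

(** The suffixes of [v] are the nodes on the path from the root to [v], so this is the maximal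
    function along the path. *)
Fixpoint msup F v : R := if v is a :: v' then Num.max (F v) (msup F v') else F [::].

Lemma msup_self F v : F v <= msup F v.
Proof. by case: v => [//|a v] /=; rewrite le_max lexx. Qed.

Lemma msup_cat F v u :
  msup F (v ++ u) = Num.max (msup (fun w => F (w ++ u)) v) (msup F u).
Proof.
elim: v => [|a v IHv] /=; first by apply/esym/max_idPr/msup_self.
by rewrite IHv maxA.
Qed.

Lemma msup_ge F v u : F u <= msup F (v ++ u).
Proof. by rewrite msup_cat le_max msup_self orbT. Qed.

Lemma msup_le F v c : (forall x y, v = x ++ y -> F y <= c) -> msup F v <= c.
Proof.
elim: v => [|a v IHv] h /=; first exact: (h [::] [::]).
rewrite ge_max (h [::] (a :: v))//=; apply: IHv => x y vE.
by apply: (h (a :: x)); rewrite vE.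
Qed.

Lemma le_msup F1 F2 v : (forall x y, v = x ++ y -> F1 y <= F2 y) ->
  msup F1 v <= msup F2 v.
Proof.
by move=> le12; apply: msup_le => x y vE; rewrite (le_trans (le12 _ _ vE))// vE msup_ge.
Qed.

Lemma msup_ge0 F v : (forall w, 0 <= F w) -> 0 <= msup F v.
Proof. by move=> F0; exact: le_trans (F0 v) (msup_self _ _). Qed.

(* Doob's maximal inequality. *)
Lemma martingale_maximal F (c : R) N : martingale F -> (forall w, 0 <= F w) -> 0 < c ->
  tavg N (fun v => (c < msup F v)%R%:R) <= F [::] / c.
Proof.
move=> + + c0; elim: N F => [|N IHN] F mF F0.
  rewrite /=; have [cF|_] := ltP c (F [::]); last by rewrite divr_ge0// ltW.
  by rewrite ler_pdivlMr// mul1r ltW.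
have [cF|Fc] := ltP c (F [::]).
  apply: (@le_trans _ _ 1); last by rewrite ler_pdivlMr// mul1r ltW.
  rewrite -[leRHS](tavg_cst N.+1).
  by apply: le_tavg => v _; case: (_ < _).
rewrite tavgS [F [::]]mF -mulrA mulr_suml ler_wpM2l ?invr_ge0 ?ler0n//.
apply: ler_sum => a _; rewrite (@eq_tavg _ _ (fun v => (c < msup (fun w => F (w ++ [:: a])) v)%R%:R)).
  by apply: IHN => [|w]; [exact: martingale_shift|exact: F0].
move=> v _; rewrite msup_cat/= !lt_max [c < F [::]]ltNge Fc orbF.
have := msup_ge (fun w => F (w ++ [:: a])) v [::]; rewrite cats0/= => Fa.
by rewrite orb_idr// => /lt_le_trans; apply.
Qed.

(* The principal words: [prn w] is the last element of the stopping-time sequence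
   along the path to [w], a new element being selected when [stop] holds. *)
Fixpoint prn (stop : rel (seq D)) w : seq D :=
  if w is a :: w' then if stop (prn stop w') w then w else prn stop w' else [::].

Section principal.
Variable stop : rel (seq D).
Local Notation prn := (prn stop).

Lemma prn_idem w : prn (prn w) = prn w.
Proof. by elim: w => [//|a w IHw] /=; case: ifP => //= ->. Qed.

Lemma prn_suffix w : exists x, w = x ++ prn w.
Proof.
elim: w => [|a w [x xE]]; first by exists [::].
rewrite /=; case: ifP => _; first by exists [::].
by exists (a :: x); rewrite {1}xE.
Qed.

Lemma size_prn w : (size (prn w) <= size w)%N.
Proof. by have [x {2}->] := prn_suffix w; rewrite size_cat leq_addl. Qed.

Lemma prn_cons_eq a y u : prn (a :: y ++ u) = u ->
  ~~ stop u (a :: y ++ u) /\ prn (y ++ u) = u.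
Proof.
rewrite /=; case: ifP => [_ /(congr1 size)|st pu].
  by rewrite /= size_cat => /eqP; rewrite -addSn -[X in _ == X]add0n eqn_add2r.
by rewrite pu in st; rewrite st.
Qed.

(** The path below [u] is cut at the first word whose principal word is no longer [u]. That word
    itself is kept, which costs one branching factor in [phi_stopped_le]. *)
Fixpoint stopped u y : seq D :=
  if y is a :: y' then if prn (y' ++ u) == u then y else stopped u y' else [::].

Lemma stopped_id u y : prn (y ++ u) = u -> stopped u y = y.
Proof. by case: y => [//|a y] /prn_cons_eq[_ /eqP /= ->]. Qed.

(** Optional stopping: before the cut a step is one of [F], and past it all children share the same
    value. *)
Lemma martingale_stopped F u : martingale F ->
  martingale (fun y => F (stopped u y ++ u)).
Proof.
move=> mF y /=; have [yu|_] := eqVneq (prn (y ++ u)) u; last first.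
  by rewrite sumr_const -(mulr_natl (F _)) mulKf.
by rewrite stopped_id// mF.
Qed.

End principal.
End tree.

Section weighted_principal.
Context {R : realType} {D : finType} {n : nat}.
Hypothesis D_gt0 : (0 < #|D|)%N.
Local Notation B := (#|D|%:R : R).
Variable phi : 'I_n -> seq D -> R.
Hypothesis phi_mart : forall j, martingale (phi j).
Hypothesis phi_ge0 : forall j w, 0 <= phi j w.
Variable c : R.
Hypothesis c_ge1 : 1 <= c.

Definition exceeds (u w : seq D) : bool := [exists j, c * phi j u < phi j w].
Local Notation prn := (prn exceeds).

Let B_ge1 : 1 <= B. Proof. by rewrite ler1n. Qed.
Let c_gt0 : 0 < c. Proof. exact: lt_le_trans c_ge1. Qed.

(** Up to the word before the cut, [phi j] is at most [c * phi j u]; one more step of a nonnegative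
    martingale multiplies by at most the number of children. *)
Lemma phi_stopped_le j u y : phi j (stopped exceeds u y ++ u) <= B * c * phi j u.
Proof.
elim: y => [|a y IHy] /=.
  by rewrite -[leLHS]mul1r ler_wpM2r// mulr_ege1.
case: ifPn => [/eqP yu|//].
apply: le_trans (martingale_child D_gt0 a _ (@phi_mart j) (@phi_ge0 j)) _.
rewrite -mulrA ler_wpM2l ?(le_trans ler01)//.
case: y yu {IHy} => [_|b y /prn_cons_eq[/existsPn/(_ j) + _]].
  by rewrite /= -[leLHS]mul1r ler_wpM2r.
by rewrite -leNgt.
Qed.

(** The sum of the ratios of [phi j] to [phi j u] is a martingale with initial value at most [n],
    and it exceeds [c] on every path that leaves [u]. Doob's inequality bounds the proportion of
    these paths by [n / c], hence by one half. *)
Lemma principal_children_measure u N : prn u = u -> c = (2 * n.+1)%:R ->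
  tavg N (fun x => (prn (x ++ u) != u)%:R : R) <= 2^-1.
Proof.
move=> pu cE; pose psi y := \sum_j phi j (y ++ u) / phi j u.
have psi_mart : martingale psi.
  move=> y; rewrite /psi exchange_big mulr_sumr; apply: eq_bigr => j _.
  by rewrite -mulr_suml mulrA -(@phi_mart j).
have psi_ge0 y : 0 <= psi y by apply: sumr_ge0 => j _; rewrite divr_ge0.
apply: (@le_trans _ _ (tavg N (fun x => (c < msup psi x)%R%:R))).
  apply: le_tavg => x _; rewrite ler_nat.
  suff : prn (x ++ u) != u -> c < msup psi x by case: eqP => //= _ ->.
  elim: x => [|a x IHx]; first by rewrite pu eqxx.
  have [xu|xu] := eqVneq (prn (x ++ u)) u; last by move=> _; rewrite /= lt_max IHx ?orbT.
  rewrite [prn _]/= xu; case: ifPn => [/existsP[j cj] _|_]; last by rewrite eqxx.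
  rewrite /= lt_max; apply/orP; left.
  (* An index with [phi j u = 0] cannot cause a stop, since [phi j] then vanishes on all descendants
     of [u]. *)
  have pj : 0 < phi j u.
    rewrite lt_neqAle phi_ge0 andbT eq_sym; apply/eqP => pj.
    have := @martingale_eq0 _ _ D_gt0 (fun w => phi j (w ++ u)) (a :: x)
      (martingale_shift _ (@phi_mart j)) (fun=> phi_ge0 _ _) pj.
    by move=> pa; move: cj; rewrite pj -cat_cons pa mulr0 ltxx.
  rewrite /psi (bigD1 j)//=; apply: (@lt_le_trans _ _ (phi j (a :: x ++ u) / phi j u)).
    by rewrite ltr_pdivlMr.
  by rewrite lerDl; apply: sumr_ge0 => i _; rewrite divr_ge0.
apply: le_trans (martingale_maximal D_gt0 _ psi_mart psi_ge0 c_gt0) _.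
rewrite ler_pdivrMr// cE /psi /=; apply: (@le_trans _ _ (\sum_(j < n) 1)).
  apply: ler_sum => j _; have [->|pj] := eqVneq (phi j u) 0; first by rewrite mul0r.
  by rewrite divff.
by rewrite sumr_const card_ord natrM mulKf// ler_nat.
Qed.

End weighted_principal.

(* [J] is an integral and [nrm] a lattice norm dominating it on the space [mem];
   [memY j], [nrmY j] are the factors of [mem], [nrm]. *)
Section good_lambda.
Context {R : realType} {D : finType} {Om : Type} {n : nat}.
Hypothesis D_gt0 : (0 < #|D|)%N.
Local Notation B := (#|D|%:R : R).
Variables (mem : set (Om -> R)) (J nrm : (Om -> R) -> R).
Hypothesis mem0 : mem (fun=> 0).
Hypothesis memD : forall x y, mem x -> mem y -> mem (fun w => x w + y w).
Hypothesis memZ : forall c x, mem x -> mem (fun w => c * x w).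
Hypothesis mem_max : forall x y, mem x -> mem y -> mem (fun w => Num.max (x w) (y w)).
Hypothesis JD : forall x y, mem x -> mem y -> J (fun w => x w + y w) = J x + J y.
Hypothesis JZ : forall c x, mem x -> J (fun w => c * x w) = c * J x.
Hypothesis J_le : forall x y, mem x -> mem y -> (forall w, x w <= y w) -> J x <= J y.
Hypothesis J_nrm : forall x, mem x -> J x <= nrm x.
Hypothesis nrm_le : forall x y, mem x -> mem y -> (forall w, 0 <= x w <= y w) ->
  nrm x <= nrm y.
Variables (rho : 'I_n -> R) (memY : 'I_n -> set (Om -> R)) (nrmY : 'I_n -> (Om -> R) -> R).

(** The means of [rho j]-th powers are martingales, those of the functions themselves are not what
    HL multiplies: [al j] is the martingale, its root the power mean. *)
Definition root_of (al : 'I_n -> seq D -> Om -> R) j w : Om -> R :=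
  fun o => al j w o `^ (rho j)^-1.

Definition root_prod (al : 'I_n -> seq D -> Om -> R) w : Om -> R :=
  fun o => \prod_j root_of al j w o.

Definition bounded_martingale (al : 'I_n -> seq D -> Om -> R) (lam : 'I_n -> R) :=
  [/\ forall j o, martingale (fun w => al j w o), forall j w o, 0 <= al j w o,
      forall j w, memY j (root_of al j w) &
      forall j w, nrmY j (root_of al j w) <= lam j].

Definition pmax (P : seq D -> Om -> R) v : Om -> R := fun o => msup (P ^~ o) v.

Hypothesis root_prod_mem : forall al lam w, bounded_martingale al lam ->
  mem (root_prod al w).
Hypothesis root_prod_nrm : forall al lam w, bounded_martingale al lam ->
  nrm (root_prod al w) <= \prod_j lam j.
Variable A : R.
Hypothesis A_ge1 : 1 <= A.
Hypothesis weak_type : forall al lam N, (forall j, 0 < lam j) ->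
  bounded_martingale al lam ->
  tavg N (fun v => (A * \prod_j lam j < nrm (pmax (root_prod al) v))%R%:R : R) <= 2^-1.

Let B_ge1 : 1 <= B. Proof. by rewrite ler1n. Qed.

Let J0 : J (fun=> 0) = 0.
Proof.
rewrite -[RHS](mul0r (J (fun=> 0))) -JZ//; congr J.
by apply/funext => w; rewrite mul0r.
Qed.

Lemma mem_sum (I : Type) (s : seq I) (h : I -> Om -> R) : (forall i, mem (h i)) ->
  mem (fun w => \sum_(i <- s) h i w).
Proof.
move=> mh; elim: s => [|i s IHs]; first by under eq_fun do rewrite big_nil.
by under eq_fun do rewrite big_cons; exact: memD.
Qed.

Lemma J_sum (I : Type) (s : seq I) (h : I -> Om -> R) : (forall i, mem (h i)) ->
  J (fun w => \sum_(i <- s) h i w) = \sum_(i <- s) J (h i).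
Proof.
move=> mh; elim: s => [|i s IHs].
  by under eq_fun do rewrite big_nil; rewrite big_nil J0.
by under eq_fun do rewrite big_cons; rewrite big_cons -IHs JD//; exact: mem_sum.
Qed.

Lemma mem_tavg N (h : seq D -> Om -> R) : (forall v, mem (h v)) ->
  mem (fun o => tavg N (h ^~ o)).
Proof.
elim: N h => [|N IHN] h mh /=; first exact: mh.
by apply: (IHN (fun v o => B^-1 * \sum_a h (a :: v) o)) => v; apply/memZ/mem_sum.
Qed.

Lemma J_tavg N (h : seq D -> Om -> R) : (forall v, mem (h v)) ->
  J (fun o => tavg N (h ^~ o)) = tavg N (fun v => J (h v)).
Proof.
elim: N h => [//|N IHN] h mh /=.
rewrite (IHN (fun v o => B^-1 * \sum_a h (a :: v) o)); last first.
  by move=> v; apply/memZ/mem_sum.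
apply: eq_tavg => v _; rewrite JZ; last exact: mem_sum.
by rewrite J_sum.
Qed.

Let mem_pmax P v : (forall w, mem (P w)) -> mem (pmax P v).
Proof. by move=> mP; elim: v => [|a v IHv] /=; [exact: mP|exact: mem_max]. Qed.

Lemma bounded_martingale_shift al lam u : bounded_martingale al lam ->
  bounded_martingale (fun j w => al j (w ++ u)) lam.
Proof.
move=> [mal al0 mY nY]; split.
- by move=> j o; exact: (martingale_shift _ (mal j o)).
- by move=> j w o; exact: al0.
- by move=> j w; exact: mY.
- by move=> j w; exact: nY.
Qed.

Section restart.
Variable bad : pred (seq D).
Hypothesis bad_nil : ~~ bad [::].
Hypothesis bad_cons : forall a v, bad v -> bad (a :: v).

(** As [bad] passes to descendants, the bad words on a path are those from the first bad one on;
    this is the maximum of [P] over them, and 0 if there are none. *)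
Fixpoint bad_part (P : seq D -> Om -> R) v : Om -> R :=
  if v is a :: v' then
    if bad v then
      if bad v' then fun o => Num.max (P v o) (bad_part P v' o) else P v
    else fun=> 0
  else fun=> 0.

(** A prefix in the sense of the path from the root; as a list it is the longest good suffix of
    [v]. *)
Fixpoint good_prefix v : seq D :=
  if v is a :: v' then if bad v then good_prefix v' else v else [::].

Let bad_part_good P v : ~~ bad v -> bad_part P v = fun=> 0.
Proof. by case: v => [//|a v] /= /negbTE ->. Qed.

Let good_prefix_id v : ~~ bad v -> good_prefix v = v.
Proof. by case: v => [//|a v] /= /negbTE ->. Qed.

Let good_prefixP v : ~~ bad (good_prefix v).
Proof. by elim: v => [//|a v IHv] /=; case: ifPn. Qed.

Let mem_bad_part P v : (forall w, mem (P w)) -> mem (bad_part P v).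
Proof.
move=> mP; elim: v => [//|a v IHv] /=.
by case: ifP => // _; case: ifP => // _; exact: mem_max.
Qed.

Let bad_part_cat P v u : bad u -> (forall a u', u = a :: u' -> ~~ bad u') ->
  bad_part P (v ++ u) = pmax (fun w => P (w ++ u)) v.
Proof.
move=> bu pu; elim: v => [|a v IHv] /=.
  case: u bu pu => [|a u] bu pu; first by rewrite (negbTE bad_nil) in bu.
  by rewrite /= bu (negbTE (pu _ _ erefl)).
have bvu : bad (v ++ u) by elim: v {IHv} => [//|b v IHv] /=; exact: bad_cons.
by rewrite bad_cons// bvu IHv.
Qed.

Let pmax_le P v o : (forall w o, 0 <= P w o) ->
  pmax P v o <= pmax P (good_prefix v) o + bad_part P v o.
Proof.
move=> P0; elim: v => [|a v IHv]; first by rewrite addr0.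
rewrite /=; have [bav|gav] := boolP (bad (a :: v)); last by rewrite addr0.
have [bv|gv] := boolP (bad v).
  rewrite /pmax/= ge_max; apply/andP; split.
    apply: ler_wpDl; first by apply: msup_ge0 => w; exact: P0.
    by rewrite le_max lexx.
  by apply: le_trans IHv _; rewrite lerD2l le_max lexx orbT.
rewrite good_prefix_id// /pmax/= ge_max ler_wpDl//=; last by apply: msup_ge0 => w; exact: P0.
by rewrite lerDl.
Qed.

(** The maximum is at most the one on the good prefix, whose integral is at most [K], plus the one
    over the bad words. The latter starts afresh at each first bad word, where the bound [2 * K] for
    smaller depth applies, and bad words carry at most half of the mass: [K + 2 * K / 2 = 2 * K]. *)
Lemma tavg_restart P (K : R) N : (forall w o, 0 <= P w o) -> (forall w, mem (P w)) ->
    (forall v, ~~ bad v -> nrm (pmax P v) <= K) ->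
    tavg N (fun v => (bad v)%:R : R) <= 2^-1 -> 0 <= K ->
    (forall i u, (i < N)%N -> tavg i (fun v => J (pmax (fun w => P (w ++ u)) v)) <= 2 * K) ->
  tavg N (fun v => J (pmax P v)) <= 2 * K.
Proof.
move=> P0 mP goodP hbad K0 IHN.
have claim i u : (i <= N)%N -> ~~ bad u ->
    tavg i (fun v => J (bad_part P (v ++ u))) <=
    2 * K * tavg i (fun v => (bad (v ++ u))%:R).
  elim: i u => [|i IHi] u iN gu.
    by rewrite /= bad_part_good// J0 mulr_ge0// mulr_ge0.
  rewrite !tavgS mulrCA ler_wpM2l ?invr_ge0//.
  rewrite mulr_sumr; apply: ler_sum => a _.
  (* If [a :: u] is bad it is the first bad word, [u] being good; from there on the bad part is the
     full maximal function of the shifted family. *)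
  have [bau|gau] := boolP (bad (a :: u)); last first.
    have := IHi _ (ltnW iN) gau.
    by under eq_tavg do rewrite -cat1s catA; under [X in _ <= _ * X -> _]eq_tavg do rewrite -cat1s catA.
  rewrite [X in _ * X](@eq_tavg _ _ _ _ (fun=> 1)); last first.
    move=> v _; rewrite -catA/=; suff -> : bad (v ++ a :: u) by [].
    by elim: v => [//|b v IHv] /=; exact: bad_cons.
  rewrite tavg_cst// mulr1.
  rewrite (@eq_tavg _ _ _ _ (fun v => J (pmax (fun w => P (w ++ a :: u)) v))); first exact: IHN.
  by move=> v _; rewrite -catA/= bad_part_cat// => b u' [_ <-].
have claim0 : tavg N (fun v => J (bad_part P v)) <= K.
  have := claim N [::] (leqnn _) bad_nil.
  rewrite (@eq_tavg _ _ _ _ (fun v => J (bad_part P v))); last by move=> v _; rewrite cats0.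
  rewrite (@eq_tavg _ _ _ (fun v => (bad (v ++ [::]))%:R) (fun v => (bad v)%:R)); last by move=> v _; rewrite cats0.
  by move=> h; nra.
apply: (@le_trans _ _ (tavg N (fun v => K + J (bad_part P v)))).
  apply: le_tavg => v _.
  apply: (@le_trans _ _ (J (fun o => pmax P (good_prefix v) o + bad_part P v o))).
    apply: J_le; [exact: mem_pmax| |by move=> o; exact: pmax_le].
    by apply: memD; [exact: mem_pmax|exact: mem_bad_part].
  rewrite JD; [|exact: mem_pmax|exact: mem_bad_part].
  rewrite lerD2r; apply: le_trans (J_nrm _) _; first exact: mem_pmax.
  exact: goodP.
rewrite tavgD tavg_cst//; lra.
Qed.

End restart.

Let root_prod_ge0 al w o : 0 <= root_prod al w o.
Proof. by apply: prodr_ge0 => j _; exact: powR_ge0. Qed.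

(** A word is bad once the norm of the running maximum exceeds [A * \prod_j lam j]. Badness is
    inherited since the maximum grows, the root is good since [A >= 1], and shifted martingales obey
    the same bounds, so that strong induction on the depth supplies the restart. *)
Let tavg_pmax_pos al lam N : (forall j, 0 < lam j) -> bounded_martingale al lam ->
  tavg N (fun v => J (pmax (root_prod al) v)) <= 2 * (A * \prod_j lam j).
Proof.
move=> lam0; elim/ltn_ind: N al => N IHN al bal.
have mP w : mem (root_prod al w) by exact: root_prod_mem bal.
have lam_ge0 : 0 <= \prod_j lam j by apply: prodr_ge0 => j _; exact: ltW.
apply: (@tavg_restart (fun v => A * \prod_j lam j < nrm (pmax (root_prod al) v))) => //.
- rewrite -leNgt /pmax/=; apply: le_trans (root_prod_nrm _ bal) _.
  by rewrite ler_peMl.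
- move=> a v /lt_le_trans; apply; apply: nrm_le; [exact: mem_pmax..|].
  move=> o; rewrite /pmax /= le_max lexx orbT andbT.
  by apply: msup_ge0 => w; exact: root_prod_ge0.
- by move=> v; rewrite -leNgt.
- exact: weak_type.
- by rewrite mulr_ge0// (le_trans ler01).
- by move=> i u iN; apply: (IHN i iN); exact: bounded_martingale_shift.
Qed.

Lemma tavg_pmax_le al lam N : (forall j, 0 <= lam j) -> bounded_martingale al lam ->
  tavg N (fun v => J (pmax (root_prod al) v)) <= 2 * (A * \prod_j lam j).
Proof.
move=> lam0 bal; have [lam_gt0|] := pselect (forall j, 0 < lam j).
  exact: tavg_pmax_pos.
move=> /existsNP[j0 /negP]; rewrite -leNgt => lam_le0.
have lamj0 : lam j0 = 0 by apply/eqP; rewrite eq_le lam_le0 lam0.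
rewrite (bigD1 j0)//= lamj0 mul0r !mulr0; apply/ler_addgt0Pr => e e0.
rewrite add0r; pose K := 2 * (A * \prod_(j | j != j0) (lam j + 1)).
have K0 : 0 < K.
  rewrite /K mulr_gt0// mulr_gt0//; first exact: lt_le_trans A_ge1.
  by apply: prodr_gt0 => j _; rewrite ltr_wpDl.
(* The vanishing bound is raised to [e / K] and the others by 1: all become positive, and the total
   bound becomes exactly [e]. *)
pose lam' j := if j == j0 then e / K else lam j + 1.
have bal' : bounded_martingale al lam'.
  case: bal => [m1 m2 m3 m4]; split => // j w; apply: le_trans (m4 _ _) _.
  rewrite /lam'; case: eqP => [->|_]; first by rewrite lamj0 divr_ge0 ?ltW.
  by rewrite lerDl.
have lam'0 j : 0 < lam' j.
  by rewrite /lam'; case: eqP => _; [rewrite divr_gt0|rewrite ltr_wpDl].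
apply: le_trans (tavg_pmax_pos N lam'0 bal') _.
rewrite (bigD1 j0)//= {1}/lam' eqxx.
rewrite (eq_bigr (fun j => lam j + 1)) => [|j /negbTE jj0]; last by rewrite /lam' jj0.
have mulCA4 (a b x y : R) : a * (b * (x * y)) = x * (a * (b * y)) by ring.
by rewrite mulCA4 -/K divfK// gt_eqF.
Qed.

(** Every word on a path belongs to its principal word, so the maximum is at most a sum over the
    principal words [u] of the path of the maxima over the words belonging to [u]. On these,
    martingales stopped on leaving [u] satisfy [tavg_pmax_le] with bounds proportional to the roots
    of [phi j u]. *)
Theorem tavg_pmax_principal al (phi : 'I_n -> seq D -> R) (c : R) N : 1 <= c ->
    (forall j, martingale (phi j)) -> (forall j w, 0 <= phi j w) ->
    (forall j, 0 < rho j) ->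
    (forall j o, martingale (fun w => al j w o)) -> (forall j w o, 0 <= al j w o) ->
    (forall j w, memY j (root_of al j w)) ->
    (forall j w, nrmY j (root_of al j w) <= phi j w `^ (rho j)^-1) ->
    (forall w, mem (root_prod al w)) ->
  tavg N (fun v => J (pmax (root_prod al) v)) <=
  2 * A * (\prod_j (B * c) `^ (rho j)^-1) *
  \sum_(k < N.+1) tavg k (fun u =>
    (prn (exceeds phi c) u == u)%:R * \prod_j phi j u `^ (rho j)^-1).
Proof.
move=> c1 mphi phi0 rho0 mal al0 mY nY mP.
have Bc0 : 0 <= B * c by rewrite mulr_ge0// (le_trans ler01).
pose pr := prn (exceeds phi c).
pose L u x : Om -> R :=
  pmax (fun y o => (pr (y ++ u) == u)%:R * root_prod al (y ++ u) o) x.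
have mL u x : mem (L u x) by apply: mem_pmax => w; exact: memZ.
(* Before the next principal word the means [phi j] stay below [B * c * phi j u], so
   that [al] stopped there is a bounded martingale. *)
have local u M : pr u = u -> tavg M (fun x => J (L u x)) <=
    2 * (A * \prod_j ((B * c) `^ (rho j)^-1 * phi j u `^ (rho j)^-1)).
  move=> pu; pose al' j y o := al j (stopped (exceeds phi c) u y ++ u) o.
  have bal' : bounded_martingale al' (fun j => (B * c) `^ (rho j)^-1 * phi j u `^ (rho j)^-1).
    split.
    - move=> j o; exact: (@martingale_stopped _ _ D_gt0 _ (fun w => al j w o)).
    - by move=> j w o; exact: al0.
    - by move=> j w; exact: mY.
    - move=> j w; apply: le_trans (nY _ _) _; rewrite -powRM//.
      apply: ge0_ler_powR; rewrite ?nnegrE ?invr_ge0 ?(ltW (rho0 _)) ?mulr_ge0//.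
        exact: le_trans ler01 c1.
      exact: phi_stopped_le.
  have le0 j : 0 <= (B * c) `^ (rho j)^-1 * phi j u `^ (rho j)^-1.
    by rewrite mulr_ge0// powR_ge0.
  apply: le_trans (tavg_pmax_le M le0 bal').
  apply: le_tavg => x _; apply: J_le => //.
    by apply: mem_pmax => w; exact: root_prod_mem bal'.
  move=> o; apply: le_msup => z y _.
  have [yu|_] := eqVneq (pr (y ++ u)) u; last by rewrite mul0r root_prod_ge0.
  rewrite mul1r (_ : root_prod al' y o = root_prod al (y ++ u) o)//.
  by rewrite /root_prod /root_of /al' stopped_id.
(* [drop (N - k) v] is the word of length [k] on the path to [v], and it contributes only if it is
   principal. *)
pose T (k : nat) v := (pr (drop (N - k) v) == drop (N - k) v)%:R *
  J (L (drop (N - k) v) (take (N - k) v)).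
apply: (@le_trans _ _ (tavg N (fun v => \sum_(k < N.+1) T k v))).
  apply: le_tavg => v vN.
  pose S (k : 'I_N.+1) o := (pr (drop (N - k) v) == drop (N - k) v)%:R *
    L (drop (N - k) v) (take (N - k) v) o.
  have mS k : mem (S k) by exact: memZ.
  have S0 k o : 0 <= S k o.
    rewrite mulr_ge0//; apply: msup_ge0 => w; rewrite mulr_ge0//.
  have -> : \sum_(k < N.+1) T k v = J (fun o => \sum_(k < N.+1) S k o).
    by rewrite J_sum//; apply: eq_bigr => k _; rewrite JZ.
  apply: J_le; [exact: mem_pmax|exact: mem_sum|move=> o].
  apply: msup_le => x y vE.
  have [z zE] := prn_suffix (exceeds phi c) y; rewrite -/pr in zE.
  have kN : (size (pr y) < N.+1)%N.
    by rewrite ltnS -vN vE size_cat (leq_trans (size_prn _ _))// leq_addl.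
  apply: (@le_trans _ _ (S (Ordinal kN) o)); last first.
    by rewrite (bigD1 (Ordinal kN))//= lerDl; apply: sumr_ge0.
  have vE' : v = (x ++ z) ++ pr y by rewrite -catA -zE.
  have sE : (N - size (pr y))%N = size (x ++ z) by rewrite -vN vE' size_cat addnK.
  have dE : drop (N - size (pr y)) v = pr y by rewrite sE vE' drop_size_cat.
  have tE : take (N - size (pr y)) v = x ++ z by rewrite sE vE' take_size_cat.
  rewrite /S /= dE tE {1}/pr prn_idem eqxx mul1r /L /pmax.
  apply: le_trans (msup_ge _ x z).
  by rewrite -zE eqxx mul1r.
rewrite tavg_sum// mulr_sumr; apply: ler_sum => k _.
have -> : tavg N (T k) = tavg ((N - k) + k) (T k) by rewrite subnK// -ltnS.
rewrite tavg_cat -tavgZ; apply: le_tavg => u uk.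
rewrite (@eq_tavg _ _ _ _ (fun x => (pr u == u)%:R * J (L u x))); last first.
  by move=> x xk; rewrite /T -xk drop_size_cat// take_size_cat.
rewrite tavgZ; have [pu|_] := eqVneq (pr u) u; last by rewrite !mul0r mulr0.
rewrite !mul1r; apply: le_trans (local _ _ pu) _.
by rewrite big_split/= !mulrA.
Qed.

End good_lambda.

(** * From the Hardy-Littlewood property to martingales *)

Section words.
Context {R : realType} {D : finType}.

Fixpoint words (N : nat) : seq (seq D) :=
  if N is N'.+1 then [seq a :: w | w <- words N', a <- enum D] else [:: [::]].

Lemma mem_words N w : (w \in words N) = (size w == N).
Proof.
elim: N w => [|N IHN] w; first by rewrite inE size_eq0.
apply/allpairsP/eqP => [[[v a] /= [+ _ ->]]|].
  by rewrite IHN => /eqP <-.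
case: w => [//|a w] /= [wN]; exists (w, a); split => //=; last by rewrite mem_enum.
by rewrite IHN wN.
Qed.

Lemma uniq_words N : uniq (words N).
Proof.
elim: N => [//|N IHN]; apply: allpairs_uniq => //; first exact: enum_uniq.
by move=> [v a] [w b] _ _ /= [-> ->].
Qed.

Lemma tavgE N (h : seq D -> R) :
  tavg N h = #|D|%:R^-1 ^+ N * \sum_(v <- words N) h v.
Proof.
elim: N h => [|N IHN] h /=; first by rewrite expr0 mul1r big_seq1.
rewrite IHN big_allpairs_dep/= -mulr_sumr mulrA exprSr; congr (_ * _).
by apply: eq_bigr => v _; rewrite big_enum.
Qed.

End words.

Section set_tree.
Context {R : realType} {D : finType}.
Hypothesis D_gt0 : (0 < #|D|)%N.
Context {d} {T : measurableType d} (nu : {measure set T -> \bar R}).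
Local Notation B := (#|D|%:R : R).

(** Adic intervals of the line and dyadic cubes of [R^d] are instances over the same branching set,
    which is how an estimate on the line reaches cubes. [V] is the measure of the root. *)
Record set_tree (U : seq D -> set T) (V : R) : Prop := SetTree {
  st_gt0 : 0 < V ;
  st_measurable : forall w, measurable (U w) ;
  st_cover : forall w x, U w x <-> exists a, U (a :: w) x ;
  st_disjoint : forall a b w x, U (a :: w) x -> U (b :: w) x -> a = b ;
  st_measure : forall w, nu (U w) = (V * B^-1 ^+ size w)%:E }.

Variables (U : seq D -> set T) (V : R).
Hypothesis hU : set_tree U V.

Let B_gt0 : 0 < B. Proof. by rewrite ltr0n. Qed.

Lemma st_sub v w : U (v ++ w) `<=` U w.
Proof. by elim: v => [//|a v IHv] x Ux; apply/IHv/(st_cover hU); exists a. Qed.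

Lemma st_size_inj v w x : U v x -> U w x -> size v = size w -> v = w.
Proof.
elim: v w => [|a v IHv] [|b w]//= Uv Uw [vw].
have E : v = w by apply: IHv => //; apply/(st_cover hU); [exists a|exists b].
by rewrite E in Uv *; rewrite (st_disjoint hU Uv Uw).
Qed.

Lemma st_leaf N w x : U w x -> exists2 v, size v = N & U (v ++ w) x.
Proof.
move=> Uw; elim: N => [|N [v vN /(st_cover hU)[a Ua]]]; first by exists [::].
by exists (a :: v) => //=; rewrite vN.
Qed.

Lemma st_word N x : U [::] x -> exists2 v, size v = N & U v x.
Proof. by move=> /(st_leaf N)[v vN]; rewrite cats0; exists v. Qed.

Lemma st_measure_gt0 w : (0 < nu (U w))%E.
Proof. by rewrite (st_measure hU) lte_fin mulr_gt0 ?(st_gt0 hU)// exprn_gt0// invr_gt0. Qed.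

Lemma st_integral (f : T -> \bar R) w : measurable_fun setT f ->
  (forall x, 0 <= f x)%E ->
  (\int[nu]_(x in U w) f x = \sum_a \int[nu]_(x in U (a :: w)) f x)%E.
Proof.
move=> mf f0.
have UE : U w = \big[setU/set0]_(a <- index_enum D) U (a :: w).
  apply/seteqP; split => x.
    move=> /(st_cover hU)[a Ua]; rewrite -bigcup_seq; exists a => //=.
    exact: mem_index_enum.
  by rewrite -bigcup_seq => -[a _ Ua]; apply/(st_cover hU); exists a.
rewrite UE ge0_integral_bigsetU//.
- by move=> a; exact: (st_measurable hU).
- exact: index_enum_uniq.
- by move=> a b _ _ [x [Ua Ub]]; exact: (st_disjoint hU Ua Ub).
- exact: measurable_funTS.
Qed.

Definition tmean (f : T -> \bar R) w : R := fine ((nu (U w))^-1 * \int[nu]_(x in U w) f x)%E.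

Section tmean.
Variable f : T -> \bar R.
Hypothesis mf : measurable_fun setT f.
Hypothesis f0 : (forall x, 0 <= f x)%E.
Hypothesis f_fin : (\int[nu]_(x in U [::]) f x < +oo)%E.

Let int_fin w : (\int[nu]_(x in U w) f x)%E \is a fin_num.
Proof.
rewrite ge0_fin_numE; last by apply: integral_ge0.
apply: le_lt_trans f_fin; apply: ge0_subset_integral => //.
- exact: (st_measurable hU).
- exact: (st_measurable hU).
- exact: measurable_funTS.
- by move=> x Ux; apply: (@st_sub w); rewrite cats0.
Qed.

Let int_inv w : ((nu (U w))^-1)%E = ((V * B^-1 ^+ size w)^-1)%:E.
Proof.
rewrite (st_measure hU) inver ifF//; apply/negbTE.
by rewrite mulf_neq0 ?expf_neq0 ?invr_neq0 ?gt_eqF// (st_gt0 hU).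
Qed.

Lemma tmeanE w : ((tmean f w)%:E = (nu (U w))^-1 * \int[nu]_(x in U w) f x)%E.
Proof. by rewrite /tmean fineK// int_inv fin_numM. Qed.

Lemma tmean_martingale : martingale (tmean f).
Proof.
move=> w; apply: EFin_inj; rewrite tmeanE EFinM -sumEFin st_integral//.
under [in RHS]eq_bigr => a _ do rewrite tmeanE int_inv/=.
rewrite -ge0_sume_distrr; last by move=> a _; exact: integral_ge0.
rewrite muleA; congr (_ * _)%E; rewrite int_inv -EFinM; congr (_%:E).
by rewrite exprS !invfM invrK mulrCA mulKf// gt_eqF.
Qed.

End tmean.

Lemma st_integral_step N (h : seq D -> R) : (forall v, 0 <= h v) ->
  (\int[nu]_x (\sum_(v <- words N) h v * \1_(U v) x)%:E = (V * tavg N h)%:E)%E.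
Proof.
move=> h0; under eq_integral do rewrite -sumEFin.
rewrite ge0_integral_sum//; last 2 first.
- move=> v; apply/measurable_EFinP/measurable_funM => //.
  by apply: measurable_indic; exact: (st_measurable hU).
- by move=> v x _; rewrite lee_fin mulr_ge0.
rewrite tavgE mulr_sumr mulr_sumr -sumEFin big_seq [RHS]big_seq.
apply: eq_bigr => v; rewrite mem_words => /eqP vN.
under eq_integral do rewrite EFinM.
rewrite ge0_integralZl_EFin//; last first.
  by apply/measurable_EFinP/measurable_indic; exact: (st_measurable hU).
rewrite integral_indic ?setIT//; last exact: (st_measurable hU).
by rewrite (st_measure hU) vN -EFinM mulrC mulrA.
Qed.

Lemma st_step_val N (h : seq D -> R) v x : size v = N -> U v x ->
  \sum_(u <- words N) h u * \1_(U u) x = h v.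
Proof.
move=> vN Uv; rewrite (bigD1_seq v) ?uniq_words ?mem_words ?vN//=.
rewrite indicE mem_set// mulr1 big_seq_cond big1 ?addr0// => u /andP[].
rewrite mem_words => /eqP uN uv; rewrite indicE memNset ?mulr0// => Uu.
by move/eqP: uv; apply; apply: st_size_inj Uu Uv _; rewrite uN.
Qed.

Lemma st_step_out N (h : seq D -> R) x : ~ U [::] x ->
  \sum_(u <- words N) h u * \1_(U u) x = 0.
Proof.
move=> Ux; rewrite big1// => u _; rewrite indicE memNset ?mulr0// => Uu.
by apply: Ux; apply: (@st_sub u); rewrite cats0.
Qed.

Lemma st_measure_leaves N (b : pred (seq D)) :
  let G := \big[setU/set0]_(v <- words N | b v) U v in
  measurable G /\ nu G = (V * tavg N (fun v => (b v)%:R))%:E.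
Proof.
move=> G; have mG : measurable G.
  by apply: bigsetU_measurable => v _; exact: (st_measurable hU).
split => //; rewrite -(@st_integral_step N (fun v => (b v)%:R))//.
rewrite -[in LHS](setIT G) -integral_indic//; apply: eq_integral => x _; congr (_%:E).
have GP : G x <-> exists u, [/\ size u = N, b u & U u x].
  rewrite /G -bigcup_seq_cond; split => [[u /= /andP[]]|[u [uN bu Uu]]].
    by rewrite mem_words => /eqP uN bu Uu; exists u.
  by exists u => //=; rewrite mem_words uN eqxx.
have [Ux|Ux] := pselect (U [::] x); last first.
  rewrite st_step_out// indicE memNset// => /GP[u [_ _ Uu]].
  by apply: Ux; apply: (@st_sub u); rewrite cats0.
have [v vN Uv] := st_word N Ux.
rewrite (st_step_val _ vN Uv) indicE; congr (_%:R); congr nat_of_bool.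
apply/idP/idP => [/set_mem/GP[u [uN bu Uu]]|bv].
  by rewrite (st_size_inj Uv Uu)// uN.
by apply/mem_set/GP; exists v.
Qed.

End set_tree.

Section adic_intervals.
Context {R : realType} {D : finType}.
Hypothesis D_gt0 : (0 < #|D|)%N.
Local Notation B := (#|D|%:R : R).

(** The number whose expansion in base [#|D|] has the ranks of the letters of [w] as digits, the
    oldest letter just after the point. *)
Fixpoint adic_left (w : seq D) : R :=
  if w is a :: w' then adic_left w' + (enum_rank a)%:R * B^-1 ^+ size w else 0.

Definition adic_interval (w : seq D) : set (measurableTypeR R) :=
  `[adic_left w, adic_left w + B^-1 ^+ size w[%classic.

Lemma adic_interval_tree : set_tree (@lebesgue_measure R) adic_interval 1.
Proof.
have B0 : 0 < B by rewrite ltr0n.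
have Bi0 k : 0 < B^-1 ^+ k by rewrite exprn_gt0// invr_gt0.
have ivlP w x : adic_interval w x <-> adic_left w <= x < adic_left w + B^-1 ^+ size w.
  by rewrite /adic_interval /= in_itv.
split => //.
- by move=> w; exact: measurable_itv.
- move=> w x; rewrite ivlP; split=> [/andP[lx xr]|[a]].
    pose y := (x - adic_left w) / B^-1 ^+ (size w).+1.
    have y0 : 0 <= y by rewrite divr_ge0 ?subr_ge0// ltW.
    have /andP[ky yk] := truncn_itv y0.
    have kB : (Num.truncn y < #|D|)%N.
      rewrite -(ltr_nat R); apply: le_lt_trans ky _.
      rewrite ltr_pdivrMr// ltrBlDl; apply: lt_le_trans xr _.
      by rewrite lerD2l exprS mulrA divff ?gt_eqF// mul1r.
    exists (enum_val (Ordinal kB)); rewrite ivlP/= enum_valK/=.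
    move: ky yk; rewrite ler_pdivlMr// ltr_pdivrMr// => ky yk.
    rewrite -natr1 mulrDl mul1r in yk; apply/andP; split; lra.
  rewrite ivlP/= => /andP[lx xr].
  have rk : (enum_rank a)%:R + 1 <= B by rewrite natr1 ler_nat.
  apply/andP; split.
    by apply: le_trans lx; rewrite lerDl mulr_ge0// ltW.
  apply: lt_le_trans xr _; rewrite -addrA lerD2l.
  rewrite -[X in _ + X]mul1r -mulrDl exprS mulrA -[leRHS]mul1r.
  apply: ler_wpM2r; first exact: ltW.
  by rewrite ler_pdivrMr// mul1r.
- move=> a b w x; rewrite !ivlP/= => /andP[la xa] /andP[lb xb].
  apply/enum_rank_inj/val_inj/eqP; rewrite eqn_leq.
  have lt1 k l : k * B^-1 ^+ (size w).+1 < l * B^-1 ^+ (size w).+1 + B^-1 ^+ (size w).+1 ->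
      k < l + 1 by rewrite -[X in _ + X]mul1r -mulrDl ltr_pM2r.
  apply/andP; split; rewrite -ltnS -(ltr_nat R) -natr1; apply: lt1.
    by move: (le_lt_trans la xb); rewrite -addrA ltrD2l.
  by move: (le_lt_trans lb xa); rewrite -addrA ltrD2l.
- move=> w; transitivity (@lebesgue_measure R
    (`[adic_left w, adic_left w + B^-1 ^+ size w[%classic : set R)); first by [].
  rewrite lebesgue_measure_itv/= lte_fin ltrDl Bi0.
  by rewrite -EFinD addrAC subrr add0r mul1r.
Qed.

End adic_intervals.

Section lnorm_bounds.
Context {d} {T : measurableType d} {R : realType} (nu : {measure set T -> \bar R}).

(** On a set of measure one the exponent does not matter: a bounded function has the same bound in
    every [L^p]. *)
Lemma Lnorm_le_indic (p : \bar R) (f : T -> \bar R) (E : set T) (lam : R) :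
  (0 < p)%E -> 0 <= lam -> measurable E -> nu E = 1%E ->
  (forall x, 0 <= f x)%E -> (forall x, (f x <= (lam * \1_E x)%:E)%E) ->
  (Lnorm nu p f <= lam%:E)%E.
Proof.
move=> p0 lam0 mE nuE f0 fE; rewrite unlock; case: p p0 => [p p0|_|//]; last first.
  case: ifP => // _; apply/ess_supP/aeW => x /=; rewrite gee0_abs//.
  by apply: le_trans (fE x) _; rewrite lee_fin ler_piMr// indicE; case: (_ \in _).
rewrite lte_fin in p0.
have -> : lam%:E = ((lam `^ p)%:E `^ p^-1)%E.
  by rewrite poweR_EFin -powRrM mulfV ?gt_eqF// powRr1.
have itv0y (x : \bar R) : (0 <= x)%E -> x \in `[0%E, +oo%E].
  by move=> x0; rewrite in_itv/= x0 leey.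
apply: gt0_ler_poweR; rewrite ?invr_ge0 ?(ltW p0)//.
- by apply: itv0y; rewrite integral_ge0// => x _; exact: poweR_ge0.
- by apply: itv0y; rewrite lee_fin powR_ge0.
apply: (@le_trans _ _ (\int[nu]_x (lam `^ p * \1_E x)%:E)%E).
  apply: integral_le_ae_measurable => //.
  - by apply/measurable_EFinP/measurable_funM => //; exact: measurable_indic.
  - by move=> x; rewrite lee_fin mulr_ge0 ?powR_ge0.
  apply: aeW => x; have := fE x; have := f0 x; rewrite indicE.
  case: (x \in E) => fx0; rewrite ?mulr1 ?mulr0 => fx.
    rewrite gee0_abs// -poweR_EFin.
    by apply: gt0_ler_poweR; rewrite ?(ltW p0)//; exact: itv0y.
  have -> : f x = 0%E by apply/eqP; rewrite eq_le fx fx0.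
  by rewrite abse0 poweR0r// gt_eqF.
under eq_integral do rewrite EFinM.
rewrite ge0_integralZl_EFin ?powR_ge0//; last by apply/measurable_EFinP/measurable_indic.
by rewrite integral_indic// setIT nuE mule1.
Qed.

End lnorm_bounds.

Lemma measurable_fun_bigprod {d} {T : measurableType d} {R : realType} (I : Type)
    (s : seq I) (f : I -> T -> R) : (forall i, measurable_fun setT (f i)) ->
  measurable_fun setT (fun x => \prod_(i <- s) f i x).
Proof.
move=> mf; elim: s => [|i s IHs]; first by under eq_fun do rewrite big_nil; exact: measurable_cst.
by under eq_fun do rewrite big_cons; exact: measurable_funM.
Qed.

Lemma hsum_gt0 (R : realType) (n : nat) (p : 'I_n -> \bar R) (r : 'I_n -> R) :
    (forall j, 0 < r j) -> (forall j, ((r j)%:E < p j)%E) ->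
  (0 < hsum p)%E /\ (hsum p = +oo%E \/ exists2 q, 0 < q & hsum p = q%:E).
Proof.
move=> r0 rp; have p0 j : (0 < p j)%E by apply: lt_trans (rp j); rewrite lte_fin.
have /choice[q qE] : forall j, exists q, 0 <= q /\ ((p j)^-1 = q%:E)%E.
  move=> j.
  case: (p j) (p0 j) => [x|_|//].
    by rewrite lte_fin => x0; exists x^-1; rewrite invr_ge0 ltW// inver gt_eqF.
  by exists 0; rewrite invey.
rewrite /hsum; under eq_bigr => j _ do rewrite (qE j).2.
rewrite sumEFin inver; case: ifPn => [_|s0]; first by split => //; left.
have sp : 0 < \sum_j q j.
  by rewrite lt_neqAle eq_sym s0/= sumr_ge0// => j _; exact: (qE j).1.
by split; [rewrite lte_fin invr_gt0|right; exists (\sum_j q j)^-1; rewrite ?invr_gt0].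
Qed.

Section product_space.
Context {R : realType} {dO : measure_display} {Omega : measurableType dO}.
Context (mu : {sigma_finite_measure set Omega -> \bar R}) (n : nat).
Variable Y : 'I_n -> funspace R Omega.
Hypothesis hY : forall j, is_qbfs mu (Y j).

Lemma fs_prod_mem (z : 'I_n -> Omega -> R) : (forall j, fs_mem (Y j) (z j)) ->
  (forall j w, 0 <= z j w) -> fs_mem (fs_prod mu Y) (fun w => \prod_j z j w).
Proof.
move=> mz z0; split.
  by apply: measurable_fun_bigprod => j; exact: (qbfs_measurable (hY j)).
exists z; split; first by move=> j; split => //; exact: aeW.
by apply: aeW => w; rewrite ger0_norm ?prodr_ge0.
Qed.

Lemma fs_prod_norm_le (z : 'I_n -> Omega -> R) : (forall j, fs_mem (Y j) (z j)) ->
  (forall j w, 0 <= z j w) ->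
  fs_norm (fs_prod mu Y) (fun w => \prod_j z j w) <= \prod_j fs_norm (Y j) (z j).
Proof.
move=> mz z0; apply: ge_inf.
  exists 0 => _ [zeta [mzeta _] <-]; apply: prodr_ge0 => j _.
  exact: (qbfs_norm_ge0 (hY j) (mzeta j).1).
exists z => //; split; first by move=> j; split => //; exact: aeW.
by apply: aeW => w; rewrite ger0_norm ?prodr_ge0.
Qed.

Lemma fs_prod_norm_le_prod (z : 'I_n -> Omega -> R) (lam : 'I_n -> R) :
  (forall j, fs_mem (Y j) (z j)) -> (forall j w, 0 <= z j w) ->
  (forall j, fs_norm (Y j) (z j) <= lam j) ->
  fs_norm (fs_prod mu Y) (fun w => \prod_j z j w) <= \prod_j lam j.
Proof.
move=> mz z0 zl; apply: le_trans (fs_prod_norm_le mz z0) _.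
by apply: ler_prod => j _; rewrite (qbfs_norm_ge0 (hY j))/=.
Qed.

End product_space.

(** * The weak-type estimate for bounded martingales *)

Section HL_weak_type.
Context {R : realType} {dO : measure_display} {Omega : measurableType dO}.
Context (mu : {sigma_finite_measure set Omega -> \bar R}) (n : nat).
Context {D : finType}.
Hypothesis D_gt0 : (0 < #|D|)%N.
Variables (r : 'I_n -> R) (Y : 'I_n -> funspace R Omega).
Hypothesis r_gt0 : forall j, 0 < r j.
Hypothesis hHL : HL mu r Y.
Local Notation B := (#|D|%:R : R).
Local Notation U := (@adic_interval R D).
Local Notation leb := (@lebesgue_measure R).
Let hY j : is_qbfs mu (Y j). Proof. by case: hHL => -[+ _] _ _; apply. Qed.
Let hprod : is_qbfs mu (fs_prod mu Y). Proof. by case: hHL => -[]. Qed.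
Let hU := @adic_interval_tree R D D_gt0.

Local Notation bmart := (bounded_martingale r (fun j => fs_mem (Y j)) (fun j => fs_norm (Y j))).

Section step_functions.
Variables (al : 'I_n -> seq D -> Omega -> R) (lam : 'I_n -> R) (N : nat).
Hypothesis lam_gt0 : forall j, 0 < lam j.
Hypothesis bal : bmart al lam.

(** The test functions for HL, constant on the adic intervals of level [N] and zero outside of the
    unit interval. *)
Let f j (x : measurableTypeR R) o := \sum_(v <- words N) root_of r al j v o * \1_(U v) x.

Let root_ge0 j v o : 0 <= root_of r al j v o. Proof. exact: powR_ge0. Qed.
Let root_mem j v : fs_mem (Y j) (root_of r al j v). Proof. by case: bal. Qed.

Let f_val j v x : size v = N -> U v x -> f j x = root_of r al j v.
Proof. by move=> vN Uv; apply/funext => o; rewrite /f (st_step_val hU _ vN Uv). Qed.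

Let f_out j x : ~ U [::] x -> f j x = fun=> 0.
Proof. by move=> Ux; apply/funext => o; rewrite /f (st_step_out hU). Qed.

Let f_cases j x : (exists v, [/\ size v = N, U v x & f j x = root_of r al j v]) \/
  (~ U [::] x /\ f j x = fun=> 0).
Proof.
have [Ux|Ux] := pselect (U [::] x); last by right; split => //; exact: f_out.
have [v vN Uv] := st_word hU N Ux.
by left; exists v; split => //; exact: f_val.
Qed.

Let f_mem j x : fs_mem (Y j) (f j x).
Proof.
by have [[v [_ _ ->]]|[_ ->]] := f_cases j x; [exact: root_mem|exact: (qbfs_mem0 (hY j))].
Qed.

Let f_simple j : simple_function (Y j) (f j).
Proof.
exists (size (@words D N)), (fun k => U (nth [::] (words N) k)),
  (fun k => root_of r al j (nth [::] (words N) k)); split => //.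
  by move=> k; exact: (st_measurable hU).
move=> x o; rewrite /f (big_nth [::]) big_mkord.
by apply: eq_bigr => k _; rewrite mulrC.
Qed.

Let f_norm j x : fs_norm (Y j) (f j x) <= lam j * \1_(U [::]) x.
Proof.
have [[v [_ Uv ->]]|[Ux ->]] := f_cases j x.
  rewrite indicE mem_set ?mulr1; first by case: bal.
  by apply: (st_sub hU) (v) _ _ _; rewrite cats0.
by rewrite (qbfs_norm0 (hY j)) mulr_ge0// ltW.
Qed.

Let f_Lp j (p : \bar R) : (0 < p)%E -> bochner_Lp leb (Y j) p (f j) /\
  (bochner_norm leb (Y j) p (f j) <= (lam j)%:E)%E.
Proof.
move=> p0; have nle : (bochner_norm leb (Y j) p (f j) <= (lam j)%:E)%E.
  apply: (Lnorm_le_indic p0 (ltW (lam_gt0 j)) (st_measurable hU [::])).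
  - by rewrite (st_measure hU)/= expr0 mulr1.
  - by move=> x; rewrite lee_fin (qbfs_norm_ge0 (hY j)).
  - by move=> x; rewrite lee_fin.
split => //; split; last by apply: le_lt_trans nle _; rewrite ltry.
split; last first.
- exists (fun=> f j) => //; apply: aeW => x.
  have -> : (fun w => f j x w - f j x w) = fun=> 0 by apply/funext => w; rewrite subrr.
  by rewrite (qbfs_norm0 (hY j)); exact: cvg_cst.
- exact: aeW.
apply: measurable_sum => v; apply: measurable_funM.
  by apply: measurableT_comp; [exact: (qbfs_measurable (hY j) (root_mem j v))|exact: measurable_snd].
apply: measurableT_comp; last exact: measurable_fst.
by apply: measurable_indic; exact: (st_measurable hU).
Qed.

(** Induction from the leaves upwards: by the martingale property the integral of the [r j]-th power
    over [U w] is [al j w] times the length of [U w]. *)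
Let f_avg j o w : (size w <= N)%N ->
  avg leb (r j) (f j ^~ o) (U w) = (root_of r al j w o)%:E.
Proof.
move=> wN; have [mal al0 _ _] := bal.
pose g x := (`|f j x o| `^ r j)%:E.
have mf : measurable_fun setT (f j ^~ o).
  apply: measurable_sum => v; apply: measurable_funM => //.
  by apply: measurable_indic; exact: (st_measurable hU).
have mg : measurable_fun setT g.
  apply/measurable_EFinP; apply: (measurableT_comp (measurable_powR (r j))).
  exact: measurableT_comp.
have g0 x : (0 <= g x)%E by rewrite lee_fin powR_ge0.
have int_g i v : (size v + i)%N = N ->
    (\int[leb]_(x in U v) g x = (B^-1 ^+ size v * al j v o)%:E)%E.
  elim: i v => [|i IHi] v vN.
    rewrite (@eq_integral _ _ _ _ _ (cst (al j v o)%:E)); last first.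
      move=> x /set_mem Uv; rewrite /g (f_val _ _ Uv) -?vN ?addn0//.
      rewrite ger0_norm// /root_of -powRrM mulVf ?gt_eqF// powRr1//; exact: al0.
    rewrite integral_cst; last exact: (st_measurable hU).
    by rewrite (st_measure hU) -EFinM mul1r mulrC.
  rewrite (st_integral hU)//.
  under eq_bigr do rewrite IHi ?addSnnS//.
  rewrite sumEFin (mal j o v) mulr_sumr mulr_sumr; congr (_%:E).
  by apply: eq_bigr => a _; rewrite /= exprS mulrCA mulrA.
rewrite /avg (int_g (N - size w)%N) ?subnKC// (st_measure hU) mul1r.
have B0 : B^-1 ^+ size w != 0 by rewrite expf_neq0// invr_neq0// pnatr_eq0 -lt0n.
by rewrite inver (negbTE B0) -EFinM mulKf// poweR_EFin.
Qed.

Let Dl := [seq U w | w <- flatten [seq words k | k <- iota 0 N.+1]].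

Let Dl_mem w : (size w <= N)%N -> U w \in Dl.
Proof.
move=> wN; apply: map_f; apply/flattenP; exists (words (size w)).
  by apply: map_f; rewrite mem_iota.
by rewrite mem_words.
Qed.

(** Each suffix [y] of [v] gives an interval of the collection containing [x], whose averages are
    the roots at [y]. If the maximal function is not in the space, its extended norm is [+oo]. *)
Let maximal_ge v x : size v = N -> U v x ->
  ((fs_norm (fs_prod mu Y) (pmax (root_prod r al) v))%:E <=
   fs_enorm mu (fs_prod mu Y) (multi_maximal r Dl f x))%E.
Proof.
move=> vN Uv; rewrite /fs_enorm; case: asboolP => [[mfin mmem]|_]; last exact: leey.
have mP w : fs_mem (fs_prod mu Y) (root_prod r al w).
  by apply: (fs_prod_mem hY).
have mpm u : fs_mem (fs_prod mu Y) (pmax (root_prod r al) u).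
  by elim: u => [|a u IHu]; [exact: mP|exact: (qbfs_mem_max hprod)].
have P0 w o : 0 <= root_prod r al w o by apply: prodr_ge0 => j _; exact: powR_ge0.
rewrite lee_fin; apply: (qbfs_solid hprod _ mmem _).2; first exact: (qbfs_measurable hprod).
apply: filterS mfin => o ofin.
rewrite ger0_norm ?msup_ge0//; apply: le_trans _ (ler_norm _).
apply: msup_le => z y vE; rewrite -lee_fin fineK//.
have yN : (size y <= N)%N by rewrite -vN vE size_cat leq_addl.
rewrite /multi_maximal.
apply: le_trans; last exact: (le_bigmax_seq _ _ xpredT _ (Dl_mem yN) isT).
rewrite /=.
under eq_bigr do rewrite f_avg//.
rewrite prodEFin indicE mem_set ?mule1//.
by move: Uv; rewrite vE; exact: (st_sub hU).
Qed.

Let Fmax x := fs_enorm mu (fs_prod mu Y) (multi_maximal r Dl f x).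

Let Fmax_ge0 x : (0 <= Fmax x)%E.
Proof.
by rewrite /Fmax /fs_enorm; case: asboolP => // -[_ /(qbfs_norm_ge0 hprod)].
Qed.

Let lam_prod_gt0 : 0 < \prod_j lam j.
Proof. by apply: prodr_gt0 => j _; exact: lam_gt0. Qed.

Let Fmax_Lnorm (p : 'I_n -> \bar R) (C : R) : (forall j, 0 < p j)%E ->
  (forall (Ds : seq (set (measurableTypeR R))) fs,
      (forall Q, Q \in Ds -> half_open_interval Q) ->
      (forall j, bochner_Lp leb (Y j) (p j) (fs j)) ->
      (Lnorm leb (hsum p)
        (fun x => fs_enorm mu (fs_prod mu Y) (multi_maximal r Ds fs x)) <=
      C%:E * \prod_j bochner_norm leb (Y j) (p j) (fs j))%E) ->
  (Lnorm leb (hsum p) Fmax <= (`|C| * \prod_j lam j)%:E)%E.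
Proof.
move=> p0 hC; apply: le_trans (hC Dl f _ _) _.
- move=> _ /mapP[w _ ->]; exists (adic_left w), (adic_left w + B^-1 ^+ size w).
  by split => //; rewrite ltrDl exprn_gt0// invr_gt0 ltr0n.
- by move=> j; exact: (f_Lp j (p0 j)).1.
have bE j : exists2 b : R, 0 <= b <= lam j & bochner_norm leb (Y j) (p j) (f j) = b%:E.
  have bl := (f_Lp j (p0 j)).2; have b0 := Lnorm_ge0 leb (p j) (fun x => (fs_norm (Y j) (f j x))%:E).
  have bfin : bochner_norm leb (Y j) (p j) (f j) \is a fin_num.
    by rewrite ge0_fin_numE//; apply: le_lt_trans bl _; rewrite ltry.
  exists (fine (bochner_norm leb (Y j) (p j) (f j))); last by rewrite fineK.
  by rewrite fine_ge0//= -lee_fin fineK.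
have /choice[b hb] : forall j, exists b : R, 0 <= b <= lam j /\ bochner_norm leb (Y j) (p j) (f j) = b%:E.
  by move=> j; have [b ? ?] := bE j; exists b.
rewrite (eq_bigr (fun j => (b j)%:E)); last by move=> j _; exact: (hb j).2.
rewrite prodEFin -EFinM lee_fin.
apply: (@le_trans _ _ (`|C| * \prod_j b j)).
  by rewrite ler_wpM2r ?ler_norm// prodr_ge0// => j _; case: (hb j) => /andP[].
by rewrite ler_wpM2l//; apply: ler_prod => j _; exact: (hb j).1.
Qed.

Let Fmax_weak (A : R) (b := fun v => A * \prod_j lam j < fs_norm (fs_prod mu Y) (pmax (root_prod r al) v))
    (G := \big[setU/set0]_(v <- words N | b v) U v) x : G x -> ((A * \prod_j lam j)%:E <= Fmax x)%E.
Proof.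
rewrite /G -bigcup_seq_cond => -[v /= /andP[]]; rewrite mem_words => /eqP vN bv Uv.
by apply: le_trans (maximal_ge vN Uv); rewrite lee_fin ltW.
Qed.

(** The level lies strictly above the essential bound, because of the added 1, so the bad leaves
    form a null set. *)
Let weak_infty (C : R) : (Lnorm leb +oo Fmax <= (`|C| * \prod_j lam j)%:E)%E ->
  tavg N (fun v => ((`|C| + 1) * \prod_j lam j < fs_norm (fs_prod mu Y) (pmax (root_prod r al) v))%R%:R : R) <= 2^-1.
Proof.
pose bad v := (`|C| + 1) * \prod_j lam j <
  fs_norm (fs_prod mu Y) (pmax (root_prod r al) v).
have [mG GE] := st_measure_leaves hU N bad; rewrite mul1r in GE.
rewrite -[X in _ -> is_true X]/(tavg N (fun v => (bad v)%:R : R) <= 2^-1) unlock ifT; last first.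
  apply: (@lt_le_trans _ _ (leb (U [::]))); first exact: (st_measure_gt0 D_gt0 hU).
  apply: le_measure => //; apply/mem_set; [exact: (st_measurable hU)|exact: measurableT].
move=> /ess_supP aeF; suff : leb (\big[setU/set0]_(v <- words N | bad v) U v) = 0%E.
  by rewrite GE => -[->]; rewrite invr_ge0.
apply/eqP; rewrite eq_le measure_ge0 andbT.
case: aeF => Z [mZ Z0 FZ]; rewrite -Z0; apply: le_measure; [exact/mem_set|exact/mem_set|].
move=> x Gx; apply: FZ => /= Fx.
have := le_trans (Fmax_weak Gx) (lee_abs _); move=> /le_trans/(_ Fx).
by rewrite lee_fin leNgt ltr_pM2r// ltrDl ltr01.
Qed.

(** Chebyshev's inequality: the factor [2] to the power [q^-1] doubles the [q]-th power of the
    level, which leaves at most half of the unit interval. *)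
Let weak_fin (C q : R) : 0 < q -> (Lnorm leb q%:E Fmax <= (`|C| * \prod_j lam j)%:E)%E ->
  tavg N (fun v => ((`|C| + 1) * 2 `^ q^-1 * \prod_j lam j < fs_norm (fs_prod mu Y) (pmax (root_prod r al) v))%R%:R : R) <= 2^-1.
Proof.
pose A := (`|C| + 1) * 2 `^ q^-1.
pose bad v := A * \prod_j lam j < fs_norm (fs_prod mu Y) (pmax (root_prod r al) v).
have [mG GE] := st_measure_leaves hU N bad; rewrite mul1r in GE.
move=> q0 Fle; rewrite -[X in is_true X]/(tavg N (fun v => (bad v)%:R : R) <= 2^-1).
have C1 : 0 < `|C| + 1 by rewrite ltr_wpDl.
have A0 : 0 < A by rewrite mulr_gt0// powR_gt0.
pose W := ((`|C| + 1) * \prod_j lam j) `^ q.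
have W0 : 0 < W by rewrite powR_gt0// mulr_gt0.
have AE : (A * \prod_j lam j) `^ q = 2 * W.
  rewrite /A /W mulrAC powRM ?powR_ge0//; last by rewrite mulr_ge0// ltW.
  by rewrite -powRrM mulVf ?gt_eqF// powRr1// mulrC.
have itv0y (x : \bar R) : (0 <= x)%E -> x \in `[0%E, +oo%E].
  by move=> x0; rewrite in_itv/= x0 leey.
have le1 : (\int[leb]_x (`|Fmax x| `^ q) <= W%:E)%E.
  rewrite -(poweR_Lnorm leb Fmax) ?gt_eqF//.
  apply: (@le_trans _ _ ((`|C| * \prod_j lam j)%:E `^ q)%E).
    apply: gt0_ler_poweR; rewrite ?(ltW q0)//; apply: itv0y; first exact: Lnorm_ge0.
    by rewrite lee_fin mulr_ge0// ltW.
  rewrite poweR_EFin lee_fin; apply: ge0_ler_powR; rewrite ?(ltW q0)// ?nnegrE.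
  - by rewrite mulr_ge0// ltW.
  - by rewrite mulr_ge0// ltW.
  - by rewrite ler_pM2r// lerDl.
have := @integral_ge_cst_indic _ _ _ leb (fun x => `|Fmax x| `^ q)%E _ (2 * W) mG.
move=> /(_ _ _ _)/le_trans/(_ le1); rewrite GE -EFinM lee_fin => h.
suff : 2 * W * tavg N (fun v => (bad v)%:R) <= W by move=> {}h; nra.
apply: h; first by rewrite mulr_ge0// ltW.
- by move=> x; exact: poweR_ge0.
- move=> x Gx; rewrite gee0_abs// -AE -poweR_EFin; apply: gt0_ler_poweR.
  + exact: ltW.
  + by apply: itv0y; rewrite lee_fin mulr_ge0// ltW.
  + exact: itv0y.
  + exact: Fmax_weak.
Qed.

Lemma HL_step_weak (p : 'I_n -> \bar R) (C : R) : (forall j, ((r j)%:E < p j)%E) ->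
  (forall (Ds : seq (set (measurableTypeR R))) fs,
      (forall Q, Q \in Ds -> half_open_interval Q) ->
      (forall j, bochner_Lp leb (Y j) (p j) (fs j)) ->
      (Lnorm leb (hsum p)
        (fun x => fs_enorm mu (fs_prod mu Y) (multi_maximal r Ds fs x)) <=
      C%:E * \prod_j bochner_norm leb (Y j) (p j) (fs j))%E) ->
  tavg N (fun v => ((`|C| + 1) * (if hsum p is q%:E then 2 `^ q^-1 else 1)
    * \prod_j lam j < fs_norm (fs_prod mu Y) (pmax (root_prod r al) v))%R%:R : R) <= 2^-1.
Proof.
move=> rp hC; have p0 j : (0 < p j)%E by apply: lt_trans (rp j); rewrite lte_fin.
have := Fmax_Lnorm p0 hC.
have [_ [->|[q q0 ->]]] := hsum_gt0 r_gt0 rp; first by rewrite mulr1; exact: weak_infty.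
exact: weak_fin.
Qed.

End step_functions.

Theorem HL_weak_type : exists2 A : R, 1 <= A &
  forall (al : 'I_n -> seq D -> Omega -> R) lam N, (forall j, 0 < lam j) -> bmart al lam ->
  tavg N (fun v => (A * \prod_j lam j <
    fs_norm (fs_prod mu Y) (pmax (root_prod r al) v))%R%:R : R) <= 2^-1.
Proof.
case: (hHL) => _ _ [p rp [C hC]].
(* The added 1 also ensures [A >= 1], without which the root could be bad in the restart
   argument. *)
exists ((`|C| + 1) * (if hsum p is q%:E then 2 `^ q^-1 else 1)); last first.
  by move=> al lam N lam0 bal; exact: (HL_step_weak N lam0 bal rp hC).
rewrite -[leLHS]mulr1; apply: ler_pM => //; first by rewrite lerDr.
have [_ [->//|[q q0 ->]]] := hsum_gt0 r_gt0 rp.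
apply: (@le_trans _ _ (1 `^ q^-1)); first by rewrite powR1.
apply: ge0_ler_powR; rewrite ?nnegrE ?invr_ge0 ?ler1n//; exact: ltW.
Qed.

End HL_weak_type.

Lemma snoc_max (A : Type) (n : nat) (u : 'I_n -> A) (a : A) : snoc u a ord_max = a.
Proof. by rewrite /snoc unlift_none. Qed.

Lemma snoc_widen (A : Type) (n : nat) (u : 'I_n -> A) (a : A) j :
  snoc u a (widen_ord (leqnSn n) j) = u j.
Proof.
have -> : widen_ord (leqnSn n) j = lift ord_max j.
  by apply: val_inj; rewrite /= /bump leqNgt ltn_ord.
by rewrite /snoc liftK.
Qed.

Lemma snocP (A : Type) (n : nat) (u : 'I_n -> A) (a : A) (P : 'I_n.+1 -> A -> Prop) :
  (forall j, P (widen_ord (leqnSn n) j) (u j)) -> P ord_max a ->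
  forall j, P j (snoc u a j).
Proof.
move=> Pu Pa j; rewrite /snoc; case: unliftP => [i ->|->//].
have -> : lift ord_max i = widen_ord (leqnSn n) i; last exact: Pu.
by apply: val_inj; rewrite /= /bump leqNgt ltn_ord.
Qed.

Lemma hoelder_conjugate_gt0 (R : realType) (s : \bar R) : (1 < s)%E ->
  0 < fine (hoelder_conjugate s).
Proof.
rewrite /hoelder_conjugate; case: s => [s||//]; last by rewrite eqxx ltr01.
rewrite lte_fin => s1 /=; have s0 : 0 < s by apply: lt_trans s1.
rewrite eqe gt_eqF// -EFinB inver subr_eq0 gt_eqF//= mulr_gt0// invr_gt0.
by rewrite subr_gt0.
Qed.

(** * The integral over [Omega] on the product with the dual space *)

Section dual_pairing.
Context {R : realType} {dO : measure_display} {Omega : measurableType dO}.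
Context (mu : {sigma_finite_measure set Omega -> \bar R}) (m : nat).
Variable X : 'I_m -> funspace R Omega.
Hypothesis hX : forall j, is_qbfs mu (X j).
Hypothesis hprodX : is_qbfs mu (fs_prod mu X).
Let Y := snoc X (fs_dual mu (fs_prod mu X)).
Hypothesis hprodY : is_qbfs mu (fs_prod mu Y).

(** The first [m] factors multiply to a member of the product of the [X j], and the last one is a
    dual element: the duality bound gives the product of all the norms. *)
Let factor xi (zeta : 'I_m.+1 -> Omega -> R) : measurable_fun setT xi ->
    factorizes mu Y xi zeta ->
  (\int[mu]_w `|(xi w)%:E| <= (\prod_j fs_norm (Y j) (zeta j))%:E)%E.
Proof.
move=> mxi [mz xiz].
pose z w := \prod_(j < m) zeta (widen_ord (leqnSn m) j) w.
have mz' j : fs_mem (X j) (zeta (widen_ord (leqnSn m) j)) /\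
    {ae mu, forall w, 0 <= zeta (widen_ord (leqnSn m) j) w}.
  by have := mz (widen_ord (leqnSn m) j); rewrite /Y snoc_widen.
have [mmax max0] : fs_mem (fs_dual mu (fs_prod mu X)) (zeta ord_max) /\
    {ae mu, forall w, 0 <= zeta ord_max w}.
  by have := mz ord_max; rewrite /Y snoc_max.
have z0 : {ae mu, forall w, forall j, 0 <= zeta j w}.
  by apply: filter_forall => j; case: (mz j).
have zfac : factorizes mu X z (fun j => zeta (widen_ord (leqnSn m) j)).
  by split => //; apply: filterS z0 => w z0; rewrite ger0_norm// prodr_ge0.
have zmem : fs_mem (fs_prod mu X) z.
  split; last by exists (fun j => zeta (widen_ord (leqnSn m) j)).
  by apply: measurable_fun_bigprod => j; exact: (qbfs_measurable (hX j) (mz' j).1).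
have znorm : fs_norm (fs_prod mu X) z <= \prod_(j < m) fs_norm (X j) (zeta (widen_ord (leqnSn m) j)).
  apply: ge_inf; last by exists (fun j => zeta (widen_ord (leqnSn m) j)).
  exists 0 => _ [zz [mzz _] <-]; apply: prodr_ge0 => j _.
  exact: (qbfs_norm_ge0 (hX j) (mzz j).1).
have iz : mu.-integrable setT (fun w => (z w * zeta ord_max w)%:E) by case: mmax => _ + _; apply.
apply: (@le_trans _ _ (\int[mu]_w (z w * zeta ord_max w))%:E).
  rewrite /Rintegral fineK; last exact: integrable_fin_num.
  have mzz : measurable_fun setT (fun w => (z w * zeta ord_max w)%:E).
    exact: (measurable_int mu).
  apply: (@le_trans _ _ (\int[mu]_w `|(z w * zeta ord_max w)%:E|)%E).
    apply: ae_ge0_le_integral => //.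
    - by apply: measurableT_comp => //; exact/measurable_EFinP.
    - exact: measurableT_comp.
    apply: filterS2 z0 xiz => w z0 xiz _ /=; rewrite lee_fin.
    by apply: le_trans xiz _; rewrite big_ord_recr/=; exact: ler_norm.
  rewrite le_eqVlt; apply/orP; left; apply/eqP; apply: ae_eq_integral => //.
    exact: measurableT_comp.
  apply: filterS z0 => w z0 _ /=; rewrite ger0_norm// mulr_ge0//.
  exact: prodr_ge0.
rewrite lee_fin; apply: le_trans (ler_norm _) _.
apply: le_trans (fs_dual_bound hprodX zmem mmax) _.
rewrite big_ord_recr/= /Y snoc_max ler_wpM2r ?(fs_dual_ge0 hprodX)//.
by apply: le_trans znorm _; apply: ler_prod => j _; rewrite snoc_widen lexx andbT (qbfs_norm_ge0 (hX j) (mz' j).1).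
Qed.

Lemma fs_prod_dual_integrable xi : fs_mem (fs_prod mu Y) xi ->
  mu.-integrable setT (EFin \o xi).
Proof.
move=> [mxi [zeta xiz]]; apply/integrableP; split; first exact/measurable_EFinP.
by apply: le_lt_trans (factor mxi xiz) _; rewrite ltry.
Qed.

Lemma fs_prod_dual_integral_le xi : fs_mem (fs_prod mu Y) xi ->
  \int[mu]_w xi w <= fs_norm (fs_prod mu Y) xi.
Proof.
move=> mxi; have [m1 [zeta0 xiz0]] := mxi.
apply: lb_le_inf; first by exists (\prod_j fs_norm (Y j) (zeta0 j)), zeta0.
move=> _ [zeta xiz <-]; apply: le_trans (ler_norm _) _.
apply: le_trans (le_normr_Rintegral measurableT (fs_prod_dual_integrable mxi)) _.
rewrite -lee_fin /Rintegral fineK; first exact: factor.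
by have := integrable_fin_num measurableT (integrable_abse (fs_prod_dual_integrable mxi)).
Qed.

End dual_pairing.

Section umd_tree.
Context {R : realType} {dO : measure_display} {Omega : measurableType dO}.
Context (mu : {sigma_finite_measure set Omega -> \bar R}) (m : nat).
Variables (X : 'I_m -> funspace R Omega) (r : 'I_m -> R) (s : \bar R).
Hypothesis hX : forall j, is_qbfs mu (X j).
Hypothesis r_gt0 : forall j, 0 < r j.
Hypothesis s_gt1 : (1 < s)%E.
Hypothesis hU : UMD mu r s X.
Context {D : finType}.
Hypothesis D_gt0 : (0 < #|D|)%N.
Local Notation rho := (snoc r (fine (hoelder_conjugate s))).
Local Notation Y := (snoc X (fs_dual mu (fs_prod mu X))).

Lemma snoc_conjugate_gt0 j : 0 < rho j.
Proof. by apply: (@snocP _ _ _ _ (fun _ x => 0 < x)) => //; exact: hoelder_conjugate_gt0. Qed.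

(* More than twice the number of stopping conditions, so that by Doob's inequality the principal
   words strictly above a given one carry at most half of its measure. *)
Definition stop_ratio : R := (2 * m.+2)%:R.

(** The good-lambda theorem with the integral over [Omega] as [J] and the quasi-norm of the product
    as [nrm]; additivity of [J] comes from integrability of all members. *)
Theorem umd_tree : exists2 K : R, 0 <= K &
  forall (al : 'I_m.+1 -> seq D -> Omega -> R) (phi : 'I_m.+1 -> seq D -> R) (N : nat),
    (forall j, martingale (phi j)) -> (forall j w, 0 <= phi j w) ->
    (forall j o, martingale (fun w => al j w o)) -> (forall j w o, 0 <= al j w o) ->
    (forall j w, fs_mem (Y j) (root_of rho al j w)) ->
    (forall j w, fs_norm (Y j) (root_of rho al j w) <= phi j w `^ (rho j)^-1) ->
  mu.-integrable setT (fun o => (tavg N (fun v => pmax (root_prod rho al) v o))%:E) /\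
  \int[mu]_o (tavg N (fun v => pmax (root_prod rho al) v o)) <=
  K * \sum_(k < N.+1) tavg k (fun u =>
    (prn (exceeds phi stop_ratio) u == u)%:R * \prod_j phi j u `^ (rho j)^-1).
Proof.
case: hU => _ [hprodX _] _ hHL.
have hprod : is_qbfs mu (fs_prod mu Y) by case: hHL => -[].
have hY j : is_qbfs mu (Y j) by case: hHL => -[+ _] _ _; apply.
have [A A1 weak] := HL_weak_type D_gt0 snoc_conjugate_gt0 hHL.
exists (2 * A * (\prod_j (#|D|%:R * stop_ratio) `^ (rho j)^-1)).
  apply: mulr_ge0; first by rewrite mulr_ge0// (le_trans ler01).
  by apply: prodr_ge0 => j _; exact: powR_ge0.
move=> al phi N mphi phi0 mal al0 mY nY.
have int_mem xi : fs_mem (fs_prod mu Y) xi -> mu.-integrable setT (EFin \o xi).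
  exact: fs_prod_dual_integrable.
have mP w : fs_mem (fs_prod mu Y) (root_prod rho al w).
  by apply: (fs_prod_mem hY) => [j|j o]; [exact: mY|exact: powR_ge0].
have mpm v : fs_mem (fs_prod mu Y) (pmax (root_prod rho al) v).
  by elim: v => [|a v IHv]; [exact: mP|exact: (qbfs_mem_max hprod)].
have JD x y : fs_mem (fs_prod mu Y) x -> fs_mem (fs_prod mu Y) y ->
    \int[mu]_w (x w + y w) = \int[mu]_w x w + \int[mu]_w y w.
  by move=> mx my; rewrite RintegralD//; exact: int_mem.
have JZ c x : fs_mem (fs_prod mu Y) x -> \int[mu]_w (c * x w) = c * \int[mu]_w x w.
  by move=> mx; rewrite RintegralZl//; exact: int_mem.
split.
  apply: int_mem; apply: (mem_tavg (qbfs_mem0 hprod) (qbfs_add hprod) (qbfs_scale hprod)) => v.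
  exact: mpm.
rewrite (@J_tavg _ _ _ (fs_mem (fs_prod mu Y)) (fun x => \int[mu]_w x w)
  (qbfs_mem0 hprod) (qbfs_add hprod) (qbfs_scale hprod) JD JZ)//.
apply: (@tavg_pmax_principal _ _ _ _ D_gt0 (fs_mem (fs_prod mu Y))
  (fun x => \int[mu]_w x w) (fs_norm (fs_prod mu Y)) (qbfs_mem0 hprod)
  (qbfs_add hprod) (qbfs_scale hprod) (qbfs_mem_max hprod) JD JZ _ _ _ rho
  (fun j => fs_mem (Y j)) (fun j => fs_norm (Y j))) => //.
- by move=> x y mx my xy; apply: le_Rintegral => //; [exact: int_mem|exact: int_mem].
- by move=> x mx; exact: fs_prod_dual_integral_le.
- move=> x y mx my xy; apply: (qbfs_norm_le hprod) => //; first exact: (qbfs_measurable hprod).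
  by move=> w; case/andP: (xy w) => x0 xley; rewrite !ger0_norm// (le_trans x0).
- move=> al' lam w [_ _ m1 _]; apply: (fs_prod_mem hY) => [j|j o]; [exact: m1|exact: powR_ge0].
- move=> al' lam w [_ _ m1 m2]; apply: (fs_prod_norm_le_prod hY) => // j o; exact: powR_ge0.
- by rewrite /stop_ratio ler1n.
- exact: snoc_conjugate_gt0.
Qed.

End umd_tree.

(** * Shifted dyadic cubes *)

Section dyadic_cubes.
Context {R : realType} {d : nat}.
Local Notation Rd := (euclid R d).
Local Notation leb := (lebesgue R d).
Local Notation D := {ffun 'I_d -> bool}.
Local Notation B := (#|{: D}|%:R : R).

Lemma measurable_box (a b : 'I_d -> R) : measurable (box a b).
Proof.
have -> : box a b = \bigcap_(i in [set: 'I_d]) ((@tnth d _ ^~ i) @^-1`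
    (`[a i, b i[%classic : set (measurableTypeR R))).
  by apply/seteqP; split => [x H i _|x H i]; have := H i; rewrite /= in_itv //=; apply.
apply: fin_bigcap_measurable => // i _; rewrite -[X in measurable X]setTI.
by apply: measurable_tnth => //; exact: measurable_itv.
Qed.

Lemma lebesgue_cube (a : 'I_d -> R) (l : R) : 0 <= l ->
  leb (box a (fun i => a i + l)) = (l ^+ d)%:E.
Proof.
move=> l0; rewrite lebesgue_box; last by move=> i; rewrite lerDl.
congr (_%:E); rewrite (eq_bigr (fun=> l)); last by move=> i _; rewrite addrAC subrr add0r.
by rewrite prodr_const card_ord.
Qed.

Lemma card_digits : B = 2 ^+ d.
Proof. by rewrite card_ffun card_bool card_ord natrX. Qed.

Section tree.
Variables (o : 'I_d -> R) (H : R).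
Hypothesis H_gt0 : 0 < H.

Fixpoint corner (w : seq D) (i : 'I_d) : R :=
  if w is a :: w' then corner w' i + (if a i then H * 2^-1 ^+ size w else 0) else o i.

Definition side (k : nat) : R := H * 2^-1 ^+ k.

Definition dyadic_cube (w : seq D) : set Rd :=
  box (corner w) (fun i => corner w i + side (size w)).

Let side_gt0 k : 0 < side k.
Proof. by rewrite mulr_gt0// exprn_gt0. Qed.

Let side_half k : side k = side k.+1 + side k.+1.
Proof. by rewrite /side exprS; field. Qed.

Lemma dyadic_cube_tree : set_tree leb dyadic_cube (H ^+ d).
Proof.
split.
- exact: exprn_gt0.
- by move=> w; exact: measurable_box.
- move=> w x; split=> [wx|[a ax] i].
    exists [ffun i => corner w i + side (size w).+1 <= tnth x i] => i /=.
    rewrite ffunE -/(side (size w).+1); have /andP[] := wx i.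
    rewrite (side_half (size w)) => l1 l2.
    case: (leP (corner w i + side (size w).+1) (tnth x i)) => cx; apply/andP; split; lra.
  have /andP[] := ax i; rewrite /= -/(side (size w).+1) (side_half (size w)).
  have := side_gt0 (size w).+1; case: (a i) => /= h l1 l2; apply/andP; split; lra.
- move=> a b w x ax bx; apply/ffunP => i.
  have /andP[] := ax i; have /andP[] := bx i; rewrite /= -/(side (size w).+1).
  case: (a i); case: (b i) => //= l1 l2 l3 l4; exfalso; lra.
- move=> w; transitivity ((side (size w) ^+ d)%:E).
    exact: (lebesgue_cube (corner w) (ltW (side_gt0 (size w)))).
  by rewrite /side exprMn -exprM card_digits -exprVn -exprM mulnC.
Qed.

(** The letters of [w] are the binary digits of the [p i], so every cell of the grid of level [k] is
    a cube of the tree. *)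
Lemma corner_natP (k : nat) (p : 'I_d -> nat) : (forall i, p i < 2 ^ k)%N ->
  exists2 w, size w = k & forall i, corner w i = o i + (p i)%:R * side k.
Proof.
elim: k p => [|k IHk] p hp.
  exists [::] => // i; have := hp i; rewrite expn0 ltnS leqn0 => /eqP ->.
  by rewrite mul0r addr0.
have [i|w wk wE] := IHk (fun i => (p i)./2).
  by rewrite ltn_half_double -mul2n -expnS.
exists ([ffun i => odd (p i)] :: w) => [|i] /=; first by rewrite wk.
rewrite ffunE wk wE -/(side k.+1) side_half -[in RHS](odd_double_half (p i)) natrD -mul2n natrM.
by case: (odd (p i)) => /=; ring.
Qed.

End tree.

End dyadic_cubes.

(** * Arbitrary cubes inside shifted dyadic cubes or tower cubes *)

Section one_third_trick.
Context {R : realType} {d : nat}.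
Local Notation Rd := (euclid R d).
Variable M : R.
Hypothesis M_gt0 : 0 < M.

Definition shift_origin (t : 'I_d -> bool) (i : 'I_d) : R := if t i then - M else - (2 * M).

(* For the one-third trick: in each coordinate the two top intervals [-M, 2M) and [-2M, M)
   are a third of their length apart. *)
Definition shifted_cube (t : {ffun 'I_d -> bool}) := dyadic_cube (shift_origin t) (3 * M).

(** Cubes centred at the origin, for those too large for the trees. The smallest one contains the
    top cubes of all trees, so that each tree together with the tower is nested. *)
Definition tower (k : nat) : set Rd :=
  box (fun=> - (3 * 2 ^+ k * M)) (fun=> - (3 * 2 ^+ k * M) + 6 * 2 ^+ k * M).

Let pow2_gt0 k : 0 < 2 ^+ k :> R. Proof. by rewrite exprn_gt0. Qed.

Let exists_pow2 (a b : R) : 0 < a -> exists k : nat, b < 2 ^+ k * a.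
Proof.
move=> a0; exists (Num.truncn (`|b| / a)).+1; rewrite -ltr_pdivrMr//.
apply: (@le_lt_trans _ _ (`|b| / a)); first by rewrite ler_pM2r ?invr_gt0// ler_norm.
have /andP[_ /lt_trans] := truncn_itv (divr_ge0 (normr_ge0 b) (ltW a0)); apply.
by rewrite -natrX ltr_nat ltn_expl.
Qed.

(* A point of the grid [- 2 M + 3 u Z] and one of [- M + 3 u Z] are at distance at least
   [u = 2 ^- k * M], because 3 does not divide [2 ^ k]. *)
Let grids_apart k (p0 p1 : nat) (u : R) : 0 < u -> M = 2 ^+ k * u ->
  `|(- (2 * M) + p0%:R * (3 * u)) - (- M + p1%:R * (3 * u))| < u -> False.
Proof.
move=> u0 ME; rewrite ltr_norml => /andP[].
have -> : - (2 * M) + p0%:R * (3 * u) - (- M + p1%:R * (3 * u)) =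
    ((3 * p0)%N%:R - (2 ^ k + 3 * p1)%N%:R) * u.
  have e1 : (3 * p0)%N%:R = 3 * p0%:R :> R by rewrite natrM.
  have e2 : (2 ^ k + 3 * p1)%N%:R = 2 ^+ k + 3 * p1%:R :> R by rewrite natrD natrX natrM.
  by rewrite e1 e2 ME; ring.
move=> h1 h2.
have l1 : (2 ^ k + 3 * p1 < 3 * p0 + 1)%N.
  by rewrite -(ltr_nat R) [X in _ < X]natrD -ltrBlDl -opprB ltrNl -(ltr_pM2r u0) mulN1r.
have l2 : (3 * p0 < 2 ^ k + 3 * p1 + 1)%N.
  by rewrite -(ltr_nat R) [X in _ < X]natrD -ltrBlDl -(ltr_pM2r u0) mul1r.
have E : (2 ^ k = 3 * (p0 - p1))%N by lia.
have : (3 %| 2 ^ k)%N by rewrite E dvdn_mulr.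
by rewrite Euclid_dvdX.
Qed.

Let locate_coordinate k (q l : R) : 0 < l -> l <= 2^-1 ^+ k * M -> - M < q -> q < M / 2 ->
  exists t : bool, exists p : nat, let o := if t then - M else - (2 * M) in
    [/\ (p < 2 ^ k)%N, o + p%:R * side (3 * M) k <= q &
        q + l <= o + p%:R * side (3 * M) k + side (3 * M) k].
Proof.
move=> l0 lk qM1 qM2; set h := side _ _; pose u := 2^-1 ^+ k * M.
have u0 : 0 < u by rewrite mulr_gt0// exprn_gt0.
have hE : h = 3 * u by rewrite /h /side /u; ring.
have h0 : 0 < h by rewrite hE mulr_gt0.
have ME : M = 2 ^+ k * u by rewrite /u mulrA -exprMn mulfV// expr1n mul1r.
have get o : o <= q -> q < o + 3 * M -> exists p : nat,
    [/\ (p < 2 ^ k)%N, o + p%:R * h <= q & q < o + p%:R * h + h].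
  move=> oq qo; have y0 : 0 <= (q - o) / h by rewrite divr_ge0 ?subr_ge0// ltW.
  have /andP[ky yk] := truncn_itv y0; exists (Num.truncn ((q - o) / h)).
  set p := Num.truncn _ in ky yk *.
  rewrite ler_pdivlMr// in ky; rewrite ltr_pdivrMr// in yk.
  have e : p.+1%:R * h = p%:R * h + h by rewrite -natr1 mulrDl mul1r.
  rewrite e in yk; split; [|lra|lra].
  have h2 : 2 ^+ k * h = 3 * M by rewrite hE [in RHS]ME; ring.
  by rewrite -(ltr_nat R) -(ltr_pM2r h0) natrX h2; lra.
have [||p0 [p0k p0q qp0]] := get (- (2 * M)); [lra|lra|].
have [||p1 [p1k p1q qp1]] := get (- M); [lra|lra|].
have [ok|bad0] := leP (q + l) (- (2 * M) + p0%:R * h + h); first by exists false, p0.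
have [ok|bad1] := leP (q + l) (- M + p1%:R * h + h); first by exists true, p1.
(* If both intervals end before [q + l], their right ends, one in each grid, lie between [q] and
   [q + l] and are too close. *)
exfalso; apply: (@grids_apart k p0.+1 p1.+1 u) => //.
have e p : p.+1%:R * (3 * u) = p%:R * h + h by rewrite -(natr1 p) mulrDl mul1r hE.
have {}lk : l <= u by [].
rewrite !e ltr_norml; apply/andP; split; lra.
Qed.

Lemma box_subset (a b a' b' : 'I_d -> R) : (forall i, a' i <= a i) ->
  (forall i, b i <= b' i) -> box a b `<=` (box a' b' : set Rd).
Proof.
move=> aa bb x abx i; have /andP[l1 l2] := abx i.
by rewrite (le_trans (aa i) l1) (lt_le_trans l2 (bb i)).
Qed.

Lemma locate_small (q : 'I_d -> R) (l : R) : 0 < l -> l <= M / 2 ->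
    (forall i, - M < q i < M / 2) ->
  exists t w, box q (fun i => q i + l) `<=` shifted_cube t w /\
    side (3 * M) (size w) <= 12 * l.
Proof.
move=> l0 lM hq.
(* For the least such [k], minimality (or [l <= M / 2] if [k = 0]) gives [l <= 2^-1 ^+ k * M], so
   the cube fits into a cell of side three times that, which is less than [6 * l]. *)
have exk : exists k : nat, M < 2 ^+ k * (2 * l) by apply: exists_pow2; rewrite mulr_gt0.
have [k kP kmin] := ex_minnP exk.
have pk j : (2 ^+ j * 2^-1 ^+ j = 1 :> R) by rewrite -exprMn mulfV// expr1n.
have lk : l <= 2^-1 ^+ k * M.
  case: k kP kmin => [_ _|k kP kmin]; first by rewrite expr0 mul1r; lra.
  rewrite leNgt; apply/negP => Ml; have := kmin k.
  have : M < 2 ^+ k * (2 * l).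
    rewrite -(ltr_pM2l (pow2_gt0 k.+1)) mulrA pk mul1r in Ml.
    by apply: lt_le_trans Ml _; rewrite exprSr mulrA.
  by move=> Mk /(_ Mk); rewrite ltnn.
have /choice[t /choice[p tp]] : forall i, exists t : bool, exists p : nat,
    let o := if t then - M else - (2 * M) in
    [/\ (p < 2 ^ k)%N, o + p%:R * side (3 * M) k <= q i &
        q i + l <= o + p%:R * side (3 * M) k + side (3 * M) k].
  by move=> i; have /andP[] := hq i; exact: locate_coordinate.
pose t' : {ffun 'I_d -> bool} := [ffun i => t i].
have [w wk wE] := @corner_natP R d (shift_origin t') (3 * M) k p (fun i => let: And3 h _ _ := tp i in h).
exists t', w; split.
  apply: box_subset => i; rewrite wE /shift_origin ffunE ?wk; by case: (tp i).
have u1 : 2^-1 ^+ k * M < 2 * l.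
  by rewrite -(ltr_pM2l (pow2_gt0 k)) mulrA pk mul1r.
by rewrite wk /side -mulrA [M * _]mulrC; lra.
Qed.

Lemma locate_large (q : 'I_d -> R) (l : R) : M / 2 < l ->
    (forall i, q i < M / 2) -> (forall i, - (M / 2) < q i + l) ->
  exists k, box q (fun i => q i + l) `<=` tower k /\ 6 * 2 ^+ k * M <= 12 * l.
Proof.
move=> lM hq1 hq2.
have exk : exists k : nat, 2 * l <= 3 * 2 ^+ k * M.
  have [|k hk] := @exists_pow2 (3 * M) (2 * l); first by rewrite mulr_gt0.
  by exists k; apply: ltW; rewrite [3 * _]mulrC -mulrA.
have [k kP kmin] := ex_minnP exk; exists k; split.
  apply: box_subset => i; have := hq1 i; have := hq2 i; lra.
(* The factor 12 comes from [k = 0], where the side is [6 * M] and only [M / 2 < l] is known; for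
   larger [k] minimality gives [8 * l]. *)
case: k kP kmin => [kP _|k kP kmin]; first by rewrite expr0 mulr1; lra.
have : 3 * 2 ^+ k * M < 2 * l.
  by rewrite ltNge; apply/negP => /kmin; rewrite ltnn.
have e : 6 * 2 ^+ k.+1 * M = 4 * (3 * 2 ^+ k * M) by rewrite exprS; ring.
move=> h; rewrite e; lra.
Qed.

Lemma locate (Q : set Rd) : cube Q -> (exists x, Q x /\ forall i, `|tnth x i| < M / 2) ->
  exists Q', [/\ Q `<=` Q', (lebesgue R d Q' <= (12 ^+ d)%:E * lebesgue R d Q)%E &
    (exists t w, Q' = shifted_cube t w) \/ (exists k, Q' = tower k)].
Proof.
move=> [q [l [l0 ->]]] [x [Qx xM]].
have hx i : [/\ q i < M / 2 & - (M / 2) < q i + l].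
  by have /andP[] := Qx i; have := xM i; rewrite ltr_norml => /andP[]; split; lra.
have pl (c : R) : 0 <= c -> c <= 12 * l -> ((c ^+ d)%:E <= (12 ^+ d)%:E * (l ^+ d)%:E)%E.
  by move=> c0 cl; rewrite -EFinM lee_fin -exprMn lerXn2r// nnegrE// mulr_ge0// ltW.
rewrite lebesgue_cube ?ltW//.
have [lM|lM] := leP l (M / 2).
  have [i|t [w [sub sd]]] := @locate_small q l l0 lM.
    by have [] := hx i; rewrite andbC => -> /=; lra.
  exists (shifted_cube t w); split => //; last by left; exists t, w.
  rewrite lebesgue_cube; last by rewrite mulr_ge0 ?exprn_ge0 ?mulr_ge0 ?ltW.
  by apply: pl => //; rewrite mulr_ge0 ?exprn_ge0 ?mulr_ge0 ?ltW.
have [|i|k [sub sd]] := @locate_large q l lM; [by move=> i; case: (hx i)|by case: (hx i)|].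
exists (tower k); split => //; last by right; exists k.
have c0 : 0 <= 6 * 2 ^+ k * M by rewrite !mulr_ge0 ?exprn_ge0 ?ltW.
by rewrite lebesgue_cube//; exact: pl.
Qed.

End one_third_trick.

Lemma countable_bigcup_measurable {d} {T : measurableType d} (I : countType)
    (P : set I) (F : I -> set T) : (forall i, measurable (F i)) ->
  measurable (\bigcup_(i in P) F i).
Proof.
move=> mF; have -> : \bigcup_(i in P) F i =
    \bigcup_n (if choice.unpickle n is Some i then if `[< P i >] then F i else set0 else set0).
  apply/seteqP; split => [x [i Pi Fi]|x [n _]].
    by exists (choice.pickle i) => //; rewrite choice.pickleK; case: asboolP.
  by case: choice.unpickle => [i|//]; case: asboolP => // Pi Fi; exists i.
apply: bigcupT_measurable => n; case: choice.unpickle => [i|]; last exact: measurable0.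
by case: asboolP => _; [exact: mF|exact: measurable0].
Qed.

Lemma measureD_half {d} {T : measurableType d} {R : realType}
    (nu : {measure set T -> \bar R}) (Q V E : set T) : measurable Q -> measurable V ->
  measurable E -> (nu Q < +oo)%E -> (nu V <= 2^-1%:E * nu Q)%E -> Q `\` V `<=` E ->
  (2^-1%:E * nu Q <= nu E)%E.
Proof.
move=> mQ mV mE Qfin VQ QVE.
apply: (@le_trans _ _ (nu (Q `\` V))); last first.
  by apply: le_measure => //; apply/mem_set => //; exact: measurableD.
have -> : (nu (Q `\` V) = nu Q - nu (Q `&` V))%E by rewrite measureD.
have : (nu (Q `&` V) <= 2^-1%:E * nu Q)%E.
  apply: le_trans VQ; apply: le_measure => //; apply/mem_set => //; exact: measurableI.
have : (0 <= nu (Q `&` V))%E by exact: measure_ge0.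
have : (0 <= nu Q)%E by exact: measure_ge0.
case: (nu Q) Qfin => [a _|//|//]; case: (nu (Q `&` V)) => [b|_ _|//].
  move=> h1 h2 h3. rewrite -EFinN -EFinD -EFinM lee_fin; move: h1 h2 h3.
  by rewrite -EFinM !lee_fin; lra.
by rewrite -EFinM leye_eq.
Qed.

Section shifted_tree.
Context {R : realType} {D : finType}.
Hypothesis D_gt0 : (0 < #|D|)%N.
Context {d} {T : measurableType d} (nu : {measure set T -> \bar R}).

Lemma st_shift (U : seq D -> set T) (V : R) u : set_tree nu U V ->
  set_tree nu (fun w => U (w ++ u)) (V * #|D|%:R^-1 ^+ size u).
Proof.
case=> V0 mU cU dU nU; split.
- by rewrite mulr_gt0// exprn_gt0// invr_gt0 ltr0n.
- by move=> w; exact: mU.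
- by move=> w x; exact: cU.
- by move=> a b w x; exact: dU.
- by move=> w; rewrite nU size_cat exprD mulrA mulrAC.
Qed.

Lemma st_comparable (U : seq D -> set T) (V : R) v w x : set_tree nu U V ->
  U v x -> U w x -> (size v <= size w)%N -> exists z, w = z ++ v.
Proof.
move=> hU Uv Uw vw; exists (take (size w - size v) w).
rewrite -{1}(cat_take_drop (size w - size v) w); congr (_ ++ _).
apply: (st_size_inj hU _ Uv); last by rewrite size_drop subKn.
by apply: (st_sub hU) (take (size w - size v) w) _ _ _; rewrite cat_take_drop.
Qed.

End shifted_tree.

(** * Sparseness of the principal cubes of one tree *)

Section principal_family.
Context {R : realType} {d : nat}.
Hypothesis d_gt0 : (0 < d)%N.
Local Notation Rd := (euclid R d).
Local Notation leb := (lebesgue R d).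
Local Notation D := {ffun 'I_d -> bool}.
Variables (M : R) (t : D) (n : nat).
Hypothesis M_gt0 : 0 < M.
Variable phi : 'I_n -> seq D -> R.
Hypothesis phi_mart : forall j, martingale (phi j).
Hypothesis phi_ge0 : forall j w, 0 <= phi j w.
Local Notation c := ((2 * n.+1)%:R : R).
Local Notation pr := (prn (exceeds phi c)).
Local Notation C := (@shifted_cube R d M t).
Local Notation Tw := (@tower R d M).

(** The tower is included so that a single collection bounds both parts of the dyadic majorant. *)
Definition principal_family : set (set Rd) :=
  [set Q | (exists2 w, pr w = w & Q = C w) \/ (exists k, Q = Tw k)].
Local Notation S := principal_family.

Lemma digits_gt0 : (0 < #|{: D}|)%N.
Proof. by rewrite card_ffun card_bool expn_gt0. Qed.

Let hC : set_tree leb C ((3 * M) ^+ d).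
Proof. by apply: dyadic_cube_tree; rewrite mulr_gt0. Qed.

Let C_measure w : leb (C w) = ((3 * M * 2^-1 ^+ size w) ^+ d)%:E.
Proof. by rewrite lebesgue_cube// mulr_ge0 ?exprn_ge0 ?mulr_ge0 ?ltW. Qed.

Let Tw_side_gt0 k : 0 < 6 * 2 ^+ k * M.
Proof. by rewrite !mulr_gt0// exprn_gt0. Qed.

Let Tw_measure k : leb (Tw k) = ((6 * 2 ^+ k * M) ^+ d)%:E.
Proof. by rewrite lebesgue_cube// ltW. Qed.

Let C_side_gt0 k : 0 < 3 * M * 2^-1 ^+ k.
Proof. by rewrite !mulr_gt0// exprn_gt0// invr_gt0. Qed.

Let expn_d_inj (x y : R) : 0 < x -> 0 < y -> x ^+ d = y ^+ d -> x = y.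
Proof. by move=> x0 y0 /(pexpIrn d_gt0); apply; rewrite nnegrE ltW. Qed.

Let expn_d_half (x : R) : 0 < x -> x ^+ d <= 2^-1 * (2 * x) ^+ d.
Proof.
move=> x0; rewrite exprMn mulrA; apply: ler_peMl; first by rewrite exprn_ge0 ?ltW.
rewrite mulrC ler_pdivlMr// mul1r -[leLHS]expr1.
by apply: ler_weXn2l => //; rewrite ler1n.
Qed.

Let C_sub_C v w : C (v ++ w) `<=` C w.
Proof. exact: (st_sub hC). Qed.

Let C_neq0 w : exists x, C w x.
Proof.
apply: contrapT => /forallNP C0; have : C w = set0 by apply/seteqP; split => // x /C0.
move=> CE; have := C_measure w; rewrite CE measure0 => -[/eqP]; rewrite eq_sym expf_eq0 d_gt0/=.
by rewrite gt_eqF.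
Qed.

Let C_sub_Tw w k : C w `<=` Tw k.
Proof.
apply: subset_trans (_ : C [::] `<=` _); first by rewrite -[w]cats0; exact: C_sub_C.
have k1 : 1 <= 2 ^+ k :> R by rewrite exprn_ege1// ler1n.
have kM : M <= 2 ^+ k * M by rewrite -[leLHS]mul1r ler_pM2r.
rewrite /tower -!mulrA; move: (2 ^+ k * M) kM => p kM.
have M0 := M_gt0.
apply: box_subset => i; rewrite /= /shift_origin; case: (t i); rewrite ?/side/= ?expr0 ?mulr1; lra.
Qed.

Let Tw_mono k l : (k <= l)%N -> Tw k `<=` Tw l.
Proof.
move=> kl; have h : 2 ^+ k * M <= 2 ^+ l * M :> R by rewrite ler_pM2r// ler_weXn2l// ler1n.
rewrite /tower -!mulrA; set p := 2 ^+ k * M in h *; set q := 2 ^+ l * M in h *.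
by apply: box_subset => i; lra.
Qed.

Let measurable_C w : measurable (C w). Proof. exact: measurable_box. Qed.
Let measurable_Tw k : measurable (Tw k). Proof. exact: measurable_box. Qed.

Let Tw_inj k l : leb (Tw k) = leb (Tw l) -> k = l.
Proof.
rewrite !Tw_measure => -[/expn_d_inj]/(_ (Tw_side_gt0 _) (Tw_side_gt0 _)).
move=> /(mulIf (lt0r_neq0 M_gt0))/(mulfI (lt0r_neq0 (ltr0Sn R 5))).
by apply: ieexprIn => //; rewrite pnatr_eq1.
Qed.

Let C_Tw_lt w k : (leb (C w) < leb (Tw k))%E.
Proof.
rewrite C_measure Tw_measure lte_fin.
have h1 : 3 * M * 2^-1 ^+ size w <= 3 * M.
  apply: ler_piMr; first by rewrite mulr_ge0// ltW.
  by apply: exprn_ile1 => //; rewrite invf_le1// ler1n.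
have h2 : 6 * M <= 6 * 2 ^+ k * M.
  by rewrite ler_pM2r//; apply: ler_peMr => //; rewrite exprn_ege1// ler1n.
rewrite ltr_pXn2r ?nnegrE ?(ltW (C_side_gt0 _)) ?(ltW (Tw_side_gt0 _))//.
by have := M_gt0; lra.
Qed.

Let C_size_inj v w : leb (C v) = leb (C w) -> size v = size w.
Proof.
rewrite !C_measure => -[/expn_d_inj]/(_ (C_side_gt0 _) (C_side_gt0 _)).
move=> /(mulfI (lt0r_neq0 (mulr_gt0 (ltr0Sn R 2) M_gt0))).
apply: ieexprIn; first by rewrite invr_gt0.
by rewrite invr_eq1 pnatr_eq1.
Qed.

Let C_inj : injective C.
Proof.
move=> v w vw; have [x Cx] := C_neq0 v.
have Cx' : C w x by rewrite -vw.
by apply: (st_size_inj hC Cx Cx'); apply: C_size_inj; rewrite vw.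
Qed.

Let le_leb (P Q : set Rd) : measurable P -> measurable Q -> P `<=` Q -> (leb P <= leb Q)%E.
Proof. by move=> mP mQ PQ; apply: le_measure => //; exact/mem_set. Qed.

Let S_nested Q1 Q2 x : S Q1 -> S Q2 -> Q1 x -> Q2 x -> Q1 `<=` Q2 \/ Q2 `<=` Q1.
Proof.
move=> [[v _ ->]|[k ->]] [[w _ ->]|[l ->]] Q1x Q2x.
- have [vw|/ltnW wv] := leqP (size v) (size w).
    by have [z ->] := st_comparable hC Q1x Q2x vw; right; exact: C_sub_C.
  by have [z ->] := st_comparable hC Q2x Q1x wv; left; exact: C_sub_C.
- by left; exact: C_sub_Tw.
- by right; exact: C_sub_Tw.
- by have [kl|/ltnW lk] := leqP k l; [left|right]; exact: Tw_mono.
Qed.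

Let inner (Q : set Rd) : set Rd := \bigcup_(P in [set P | [/\ S P, P `<=` Q & P <> Q]]) P.

Let E (Q : set Rd) : set Rd := Q `\` inner Q.

Let E_disjoint : trivIset S E.
Proof.
move=> Q1 Q2 SQ1 SQ2 [x [[Q1x n1] [Q2x n2]]].
apply: contrapT => Q12; have [sub|sub] := S_nested SQ1 SQ2 Q1x Q2x.
  by apply: n2; exists Q1.
by apply: n1; exists Q2 => //; split => // /esym.
Qed.

Let measurable_inner Q : measurable (inner Q).
Proof.
have -> : inner Q =
    \bigcup_(w in [set w | [/\ pr w = w, C w `<=` Q & C w <> Q]]) C w `|`
    \bigcup_(k in [set k | Tw k `<=` Q /\ Tw k <> Q]) Tw k.
  apply/seteqP; split => [x [P [[[w pw ->]|[k ->]] sub ne] Px]|x [[w [pw sub ne] Px]|[k [sub ne] Px]]].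
  - by left; exists w.
  - by right; exists k.
  - by exists (C w) => //; split => //; left; exists w.
  - by exists (Tw k) => //; split => //; right; exists k.
by apply: measurableU; apply: countable_bigcup_measurable.
Qed.

(** The cubes [N] generations below [u] that no longer belong to [u]. Their union grows with [N] and
    in the limit contains every principal cube strictly inside [C u]. *)
Let bad_union u N : set Rd := \big[setU/set0]_(x <- words N | pr (x ++ u) != u) C (x ++ u).

Let bad_unionP u N x : bad_union u N x <-> exists y, [/\ size y = N, pr (y ++ u) != u & C (y ++ u) x].
Proof.
rewrite /bad_union -bigcup_seq_cond; split => [[y /= /andP[]]|[y [yN py Cy]]].
  by rewrite mem_words => /eqP yN py Cy; exists y.
by exists y => //=; rewrite mem_words yN eqxx.
Qed.

Let bad_union_measure u N : pr u = u ->
  measurable (bad_union u N) /\ (leb (bad_union u N) <= 2^-1%:E * leb (C u))%E.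
Proof.
move=> pu; have hCu := st_shift digits_gt0 u hC.
have [mb bE] := st_measure_leaves hCu N (fun x => pr (x ++ u) != u).
split => //; rewrite bE -[C u]/(C ([::] ++ u)) (st_measure hCu [::]) expr0 mulr1 -EFinM lee_fin.
rewrite mulrC; apply: ler_wpM2r; first exact: ltW (st_gt0 hCu).
by apply: (principal_children_measure digits_gt0 phi_mart phi_ge0) => //; rewrite ler1n.
Qed.

Let bad_union_nd u : pr u = u -> nondecreasing_seq (bad_union u).
Proof.
move=> pu; apply/nondecreasing_seqP => N; apply/subsetPset => x /bad_unionP[y [yN py]].
move=> /(st_cover hC)[a Cx]; apply/bad_unionP; exists (a :: y); split => //=; first by rewrite yN.
by apply: contra py => /eqP/prn_cons_eq[_ ->].
Qed.

Let bad_limit_measure u : pr u = u ->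
  measurable (\bigcup_N bad_union u N) /\
  (leb (\bigcup_N bad_union u N) <= 2^-1%:E * leb (C u))%E.
Proof.
move=> pu; have mb N : measurable (bad_union u N) by case: (bad_union_measure N pu).
have mU : measurable (\bigcup_N bad_union u N) by exact: bigcupT_measurable.
split => //.
have cv := @nondecreasing_cvg_mu _ _ R leb _ mb mU (bad_union_nd pu).
rewrite -(cvg_lim _ cv)//; apply: lime_le; first by apply/cvg_ex; eexists; exact: cv.
by apply: nearW => N; case: (bad_union_measure N pu).
Qed.

Let inner_C u : pr u = u -> inner (C u) `<=` \bigcup_N bad_union u N.
Proof.
move=> pu x [P [[[w pw ->]|[k ->]] sub ne] Px]; last first.
  have := le_leb (measurable_Tw k) (measurable_C u) sub.
  by rewrite leNgt C_Tw_lt.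
have Cux : C u x by exact: sub.
have [uw|/ltnW wu] := leqP (size u) (size w).
  have [z zE] := st_comparable hC Cux Px uw.
  exists (size z) => //; apply/bad_unionP; exists z; split => //; last by rewrite -zE.
  by rewrite -zE pw; apply/eqP => wE; apply: ne; rewrite wE.
have [z zE] := st_comparable hC Px Cux wu.
by exfalso; apply: ne; apply/seteqP; split => //; rewrite {1}zE; exact: C_sub_C.
Qed.

Let inner_Tw0 : inner (Tw 0) `<=` C [::].
Proof.
move=> x [P [[[w pw ->]|[k ->]] sub ne] Px].
  by rewrite -[w]cats0 in Px; exact: C_sub_C Px.
by exfalso; apply: ne; apply/seteqP; split => //; exact: Tw_mono.
Qed.

Let inner_TwS k : inner (Tw k.+1) `<=` Tw k.
Proof.
move=> x [P [[[w pw ->]|[l ->]] sub ne] Px]; first exact: C_sub_Tw Px.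
have [lk|kl] := leqP l k; first exact: (Tw_mono lk) Px.
by exfalso; apply: ne; apply/seteqP; split => //; exact: Tw_mono.
Qed.

(** The family is nested, so removing from each member all strictly smaller ones leaves disjoint
    sets. At most half is removed: by Doob's inequality from a principal cube, and from a tower cube
    because everything smaller lies in the preceding tower cube, or in the top cube of the tree, of
    half the side. *)
Theorem principal_family_sparse : sparse S.
Proof.
split.
  move=> _ [[w _ ->]|[k ->]].
    exists (corner (shift_origin M t) (3 * M) w), (side (3 * M) (size w)); split => //.
    exact: C_side_gt0.
  by exists (fun=> - (3 * 2 ^+ k * M)), (6 * 2 ^+ k * M); split.
exists E; split => // Q SQ.
have mQ : measurable Q by case: SQ => [[w _ ->]|[k ->]].
have Qfin : (leb Q < +oo)%E.
  by case: SQ => [[w _ ->]|[k ->]]; rewrite ?C_measure ?Tw_measure ltry.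
have mE : measurable (E Q) by exact: measurableD.
split => //; first by move=> x [].
have [V [mV VQ innerV]] : exists V, [/\ measurable V,
    (leb V <= 2^-1%:E * leb Q)%E & inner Q `<=` V].
  case: SQ => [[u pu ->]|[[|k] ->]].
  - by have [m1 m2] := bad_limit_measure pu; exists (\bigcup_N bad_union u N); split => //; exact: inner_C.
  - exists (C [::]); split => //.
    rewrite C_measure Tw_measure -EFinM lee_fin expr0 !mulr1.
    have -> : 6 * M = 2 * (3 * M) by ring.
    by apply: expn_d_half; rewrite mulr_gt0.
  - exists (Tw k); split => //.
    rewrite !Tw_measure -EFinM lee_fin exprS.
    have -> : 6 * (2 * 2 ^+ k) * M = 2 * (6 * 2 ^+ k * M) by ring.
    exact: expn_d_half.
apply: (measureD_half mQ mV mE Qfin VQ) => x [Qx Vx]; split => // /innerV.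
exact: Vx.
Qed.

(** [esum] counts each set once, so distinct words must give distinct cubes: the measure determines
    the length of the word and separates the tree from the tower. *)
Lemma principal_family_esum (G : set Rd -> \bar R) (N K : nat) :
  (forall Q, S Q -> 0 <= G Q)%E ->
  (\sum_(k < N) \sum_(u <- words k | pr u == u) G (C u) + \sum_(k < K) G (Tw k) <=
   \esum_(Q in S) G Q)%E.
Proof.
move=> G0; pose L := [seq u <- flatten [seq words k | k <- iota 0 N] | pr u == u].
pose ls := [seq C u | u <- L] ++ [seq Tw k | k <- iota 0 K].
have uL : uniq L.
  apply: filter_uniq; elim: N {L ls} => [//|N IHN].
  rewrite -addn1 iotaD map_cat flatten_cat cat_uniq IHN/= cats0 uniq_words andbT.
  apply/hasPn => w; rewrite add0n mem_words => /eqP wN; apply/negP.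
  move=> /flatten_mapP[k]; rewrite mem_iota add0n mem_words wN => + /eqP Nk.
  by rewrite -Nk ltnn.
have uls : uniq ls.
  rewrite cat_uniq map_inj_uniq// uL map_inj_in_uniq ?iota_uniq ?andbT/=; last first.
    by move=> k l _ _ kl; apply: Tw_inj; rewrite kl.
  apply/hasPn => _ /mapP[k _ ->]; apply/negP => /mapP[u _ TC].
  by have := C_Tw_lt u k; rewrite -TC ltxx.
have lsS : [set` ls] `<=` S.
  move=> Q /=; rewrite mem_cat => /orP[/mapP[u]|/mapP[k _ ->]]; last by right; exists k.
  by rewrite mem_filter => /andP[/eqP pu _ ->]; left; exists u.
have -> : (\sum_(k < N) \sum_(u <- words k | pr u == u) G (C u) + \sum_(k < K) G (Tw k) =
    \sum_(Q <- ls) G Q)%E.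
  rewrite big_cat !big_map/= /L big_filter; congr (_ + _)%E; last first.
    by rewrite -(big_mkord xpredT (fun k => G (Tw k))) /index_iota subn0.
  rewrite big_flatten/= big_map -(big_mkord xpredT (fun k => \sum_(u <- words k | pr u == u) G (C u))%E).
  by rewrite /index_iota subn0.
apply: esum_ge; exists [set` ls]; first by split => //; exact: finite_seq.
by rewrite fsbig_seq.
Qed.

End principal_family.

(** * Power means of vector-valued functions *)

Section power_means.
Context {d} {T : measurableType d} {R : realType} (nu : {measure set T -> \bar R}).

(** [avg] without the outer root and with real values: along a tree this is the martingale. *)
Definition pmean (p : R) (f : T -> R) (Q : set T) : R :=
  fine ((nu Q)^-1 * \int[nu]_(x in Q) (`|f x| `^ p)%:E)%E.

Definition locally_power_integrable (p : R) (f : T -> R) :=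
  measurable_fun setT f /\
  forall Q, measurable Q -> (nu Q < +oo)%E -> (\int[nu]_(x in Q) (`|f x| `^ p)%:E < +oo)%E.

Lemma measurable_fun_abs_powR (p : R) (f : T -> R) : measurable_fun setT f ->
  measurable_fun setT (fun x => (`|f x| `^ p)%:E).
Proof.
move=> mf; apply/measurable_EFinP; apply: (measurableT_comp (measurable_powR p)).
exact: measurableT_comp.
Qed.

Variables (p : R) (f : T -> R).
Hypothesis hf : locally_power_integrable p f.

Lemma pmeanE Q : measurable Q -> (0 < nu Q < +oo)%E ->
  ((pmean p f Q)%:E = (nu Q)^-1 * \int[nu]_(x in Q) (`|f x| `^ p)%:E)%E.
Proof.
move=> mQ /andP[Q0 Qfin]; have [mf ifin] := hf.
rewrite /pmean fineK// fin_numM//.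
  by case: (nu Q) Q0 Qfin => [a a0 _|//|//]; rewrite inver gt_eqF.
by rewrite ge0_fin_numE ?ifin// integral_ge0// => x _; rewrite lee_fin powR_ge0.
Qed.

Lemma pmean_ge0 Q : 0 <= pmean p f Q.
Proof.
by rewrite fine_ge0// mule_ge0// ?inve_ge0// ?integral_ge0// => x _; rewrite lee_fin powR_ge0.
Qed.

Lemma avgE Q : measurable Q -> (0 < nu Q < +oo)%E ->
  avg nu p f Q = (pmean p f Q `^ p^-1)%:E.
Proof. by move=> mQ Q0; rewrite /avg -pmeanE// poweR_EFin. Qed.

Lemma pmean_subset (K : R) Q Q' : measurable Q -> measurable Q' ->
  (0 < nu Q < +oo)%E -> (0 < nu Q' < +oo)%E -> Q `<=` Q' ->
  (nu Q' <= K%:E * nu Q)%E -> pmean p f Q <= K * pmean p f Q'.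
Proof.
move=> mQ mQ' Q0 Q'0 sub KQ; rewrite -lee_fin EFinM !pmeanE//.
have [mf ifin] := hf.
have hle : (\int[nu]_(x in Q) (`|f x| `^ p)%:E <= \int[nu]_(x in Q') (`|f x| `^ p)%:E)%E.
  apply: ge0_subset_integral => //.
  exact/measurable_funTS/measurable_fun_abs_powR.
rewrite muleA; apply: lee_pmul => //.
- by rewrite inve_ge0.
- by apply: integral_ge0 => x _; rewrite lee_fin powR_ge0.
move: Q0 Q'0 KQ => /andP[Q0 Qf] /andP[Q'0 Q'f].
case: (nu Q) Q0 Qf => [a a0 _|//|//]; case: (nu Q') Q'0 Q'f => [b b0 _|//|//].
rewrite !lte_fin in a0 b0; rewrite !inver !gt_eqF//= -!EFinM !lee_fin => ba.
by rewrite -[leLHS]mul1r ler_pdivrMr// mulrAC ler_pdivlMr// mul1r.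
Qed.

Lemma pmean_martingale {D : finType} (D_gt0 : (0 < #|D|)%N) (U : seq D -> set T) (V : R) :
  set_tree nu U V -> martingale (fun w => pmean p f (U w)).
Proof.
move=> hU; have [mf ifin] := hf.
apply: (@tmean_martingale _ _ D_gt0 _ _ nu U V hU (fun x => (`|f x| `^ p)%:E)).
- exact: measurable_fun_abs_powR.
- by move=> x; rewrite lee_fin powR_ge0.
- by apply: ifin; rewrite ?(st_measure hU) ?ltry//; exact: (st_measurable hU).
Qed.

End power_means.

Lemma sum_enum_val (R : realType) (I : finType) (F : I -> R) :
  \sum_i F i = \sum_(k < #|I|) F (enum_val k).
Proof. by rewrite -(big_enum_val F); apply: eq_bigl. Qed.

Section lattice_means.
Context {R : realType} {dO : measure_display} {Omega : measurableType dO}.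
Context (mu : {sigma_finite_measure set Omega -> \bar R}).
Context {d} {T : measurableType d} (nu : {measure set T -> \bar R}).
Variables (Y : funspace R Omega) (p : R).
Hypothesis hY : is_qbfs mu Y.
Hypothesis p_gt0 : 0 < p.
Hypothesis convY : p_convex p Y.

(** [p_convex] speaks of [fs_norm] only, which is meaningful on members; membership follows from
    solidity, with [#|I|] to the power [p^-1] times the sum of the absolute values as upper
    bound. *)
Lemma p_convex_mem (I : finType) (y : I -> Omega -> R) :
  (forall i, fs_mem Y (y i)) ->
  fs_mem Y (fun w => (\sum_i `|y i w| `^ p) `^ p^-1).
Proof.
move=> my; pose S w := \sum_i `|y i w|.
have mS : fs_mem Y S by apply: (qbfs_mem_sum hY) => i; exact: (qbfs_mem_abs hY).
apply: (qbfs_mem_le hY _ (qbfs_scale hY (#|I|%:R `^ p^-1) mS)).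
  apply: (measurableT_comp (measurable_powR p^-1)); apply: measurable_sum => i.
  apply: (measurableT_comp (measurable_powR p)); apply: measurableT_comp => //.
  exact: (qbfs_measurable hY).
move=> w; have S0 : 0 <= S w by exact: sumr_ge0.
rewrite !ger0_norm ?mulr_ge0 ?powR_ge0//.
have -> : #|I|%:R `^ p^-1 * S w = (#|I|%:R * S w `^ p) `^ p^-1.
  by rewrite powRM ?powR_ge0// -powRrM mulfV ?gt_eqF// powRr1.
apply: ge0_ler_powR; rewrite ?nnegrE ?invr_ge0 ?(ltW p_gt0) ?mulr_ge0 ?powR_ge0//.
  by apply: sumr_ge0 => i _; exact: powR_ge0.
rewrite mulr_natl -sumr_const; apply: ler_sum => i _.
apply: ge0_ler_powR; rewrite ?nnegrE ?(ltW p_gt0)//.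
by rewrite /S (bigD1 i)//= lerDl sumr_ge0.
Qed.

Lemma p_convex_weighted (I : finType) (y : I -> Omega -> R) (c lam : I -> R) :
    (forall i, fs_mem Y (y i)) -> (forall i, 0 <= c i) ->
    (forall i, fs_norm Y (y i) <= lam i) ->
  let h := fun w => (\sum_i c i * `|y i w| `^ p) `^ p^-1 in
  fs_mem Y h /\ fs_norm Y h <= (\sum_i c i * lam i `^ p) `^ p^-1.
Proof.
move=> my c0 ylam h.
pose z i w := c i `^ p^-1 * y i w.
have mz i : fs_mem Y (z i) by exact: (qbfs_scale hY).
have zE i w : `|z i w| `^ p = c i * `|y i w| `^ p.
  rewrite /z normrM powRM// ger0_norm ?powR_ge0// -powRrM mulVf ?gt_eqF//.
  by rewrite powRr1.
have hE : h = fun w => (\sum_i `|z i w| `^ p) `^ p^-1.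
  by apply/funext => w; congr (_ `^ _); apply: eq_bigr => i _; rewrite zE.
split; first by rewrite hE; exact: p_convex_mem.
have hE' : h = fun w => (\sum_(k < #|I|) `|z (enum_val k) w| `^ p) `^ p^-1.
  by rewrite hE; apply/funext => w; rewrite (sum_enum_val (fun i => `|z i w| `^ p)).
rewrite hE'; apply: le_trans (convY _) _ => //.
rewrite -(sum_enum_val (fun i => fs_norm Y (z i) `^ p)) /=.
apply: ge0_ler_powR; rewrite ?nnegrE ?invr_ge0 ?(ltW p_gt0)//.
- by apply: sumr_ge0 => i _; exact: powR_ge0.
- by apply: sumr_ge0 => i _; rewrite mulr_ge0 ?powR_ge0.
apply: ler_sum => i _; rewrite /z (qbfs_normZ hY)// powRM// ?(qbfs_norm_ge0 hY)//.
rewrite ger0_norm ?powR_ge0// -powRrM mulVf ?gt_eqF// powRr1// ler_wpM2l//.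
have n0 := qbfs_norm_ge0 hY (my i).
by apply: ge0_ler_powR; rewrite ?nnegrE ?(ltW p_gt0)//; exact: le_trans (ylam i).
Qed.

Variables (I : finType) (sigma : T -> I) (gam : T -> R) (y : I -> Omega -> R) (lam : I -> R).
Hypothesis measurable_sigma : forall i, measurable (sigma @^-1` [set i]).
Hypothesis gam_int : locally_power_integrable nu p gam.
Hypothesis y_mem : forall i, fs_mem Y (y i).
Hypothesis y_lam : forall i, fs_norm Y (y i) <= lam i.

Let lam_ge0 i : 0 <= lam i.
Proof. exact: le_trans (qbfs_norm_ge0 hY (y_mem i)) (y_lam i). Qed.

Let measurable_val (z : I -> R) : measurable_fun setT (fun x => z (sigma x)).
Proof.
rewrite (_ : (fun x => _) = (fun x => \sum_i z i * \1_(sigma @^-1` [set i]) x)).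
  by apply: measurable_sum => i; apply: measurable_funM => //; exact: measurable_indic.
apply/funext => x; rewrite (bigD1 (sigma x))//= indicE mem_set// mulr1 big1 ?addr0//.
by move=> i /eqP ix; rewrite indicE memNset ?mulr0// => /esym.
Qed.

Let powE (z : I -> R) x : `|gam x * z (sigma x)| `^ p =
  \sum_i `|z i| `^ p * (`|gam x| `^ p * \1_(sigma @^-1` [set i]) x).
Proof.
rewrite (bigD1 (sigma x))//= indicE mem_set// mulr1 big1 ?addr0.
  by rewrite normrM powRM// mulrC.
by move=> i /eqP ix; rewrite indicE memNset ?mulr0// => /esym.
Qed.

Let part i x : \bar R := (`|gam x| `^ p * \1_(sigma @^-1` [set i]) x)%:E.

Let measurable_part i : measurable_fun setT (part i).
Proof.
apply/measurable_EFinP/measurable_funM; last exact: measurable_indic.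
by apply/measurable_EFinP/measurable_fun_abs_powR; case: gam_int.
Qed.

Let part_ge0 i x : (0 <= part i x)%E.
Proof. by rewrite lee_fin mulr_ge0 ?powR_ge0. Qed.

Let int_powE (z : I -> R) Q : measurable Q ->
  (\int[nu]_(x in Q) (`|gam x * z (sigma x)| `^ p)%:E =
   \sum_i (`|z i| `^ p)%:E * \int[nu]_(x in Q) part i x)%E.
Proof.
move=> mQ; under eq_integral do rewrite powE -sumEFin.
rewrite ge0_integral_sum//.
- apply: eq_bigr => i _; under eq_integral do rewrite EFinM.
  by rewrite ge0_integralZl_EFin//; exact: (measurable_funTS (measurable_part i)).
- move=> i; under eq_fun do rewrite EFinM.
  exact/measurable_funTS/measurable_funeM/measurable_part.
Qed.

Let part_fin i Q : measurable Q -> (nu Q < +oo)%E ->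
  (\int[nu]_(x in Q) part i x)%E \is a fin_num.
Proof.
move=> mQ Qf; rewrite ge0_fin_numE ?integral_ge0//.
have [mg gfin] := gam_int; apply: le_lt_trans (gfin Q mQ Qf).
apply: ge0_le_integral => //.
- exact: measurable_funTS.
- exact/measurable_funTS/measurable_fun_abs_powR.
- by move=> x _; rewrite lee_fin ler_piMr ?powR_ge0//.
Qed.

Lemma finite_valued_power_integrable (z : I -> R) :
  locally_power_integrable nu p (fun x => gam x * z (sigma x)).
Proof.
split; first by apply: measurable_funM; [case: gam_int|exact: measurable_val].
move=> Q mQ Qf; rewrite int_powE//; apply: lte_sum_pinfty => i _.
by rewrite -(fineK (part_fin i mQ Qf)) -EFinM ltry.
Qed.

(** With finitely many values the power mean is a weighted power sum, the weights being the means of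
    the powers of [gam] over the level sets of [sigma], so p-convexity for finite families suffices.
    The scalar [gam] makes room for a [g] that is not simple. *)
Lemma finite_valued_pmean Q : measurable Q -> (0 < nu Q < +oo)%E ->
  let h := fun w => pmean nu p (fun x => gam x * y (sigma x) w) Q `^ p^-1 in
  fs_mem Y h /\ fs_norm Y h <= pmean nu p (fun x => gam x * lam (sigma x)) Q `^ p^-1.
Proof.
move=> mQ Q0 h; have /andP[Qp Qf] := Q0.
pose c i := fine ((nu Q)^-1 * \int[nu]_(x in Q) part i x)%E.
have invfin : ((nu Q)^-1)%E \is a fin_num.
  by case: (nu Q) Qp Qf => [a a0 _|//|//]; rewrite inver gt_eqF.
have cE i : ((c i)%:E = (nu Q)^-1 * \int[nu]_(x in Q) part i x)%E.
  by rewrite /c fineK// fin_numM// part_fin.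
have c0 i : 0 <= c i by rewrite fine_ge0// mule_ge0// ?inve_ge0// integral_ge0.
have meanE (z : I -> R) : pmean nu p (fun x => gam x * z (sigma x)) Q = \sum_i c i * `|z i| `^ p.
  apply: EFin_inj; rewrite (pmeanE (finite_valued_power_integrable z))//.
  rewrite int_powE// -sumEFin ge0_sume_distrr.
    by apply: eq_bigr => i _; rewrite EFinM cE muleCA [RHS]muleC.
  by move=> i _; rewrite mule_ge0 ?lee_fin ?powR_ge0// integral_ge0.
have [h1 h2] := p_convex_weighted y_mem c0 y_lam.
have hE : h = fun w => (\sum_i c i * `|y i w| `^ p) `^ p^-1.
  by apply/funext => w; rewrite /h (meanE (fun i => y i w)).
split; first by rewrite hE.
rewrite hE (meanE lam); apply: le_trans h2 _.
rewrite (eq_bigr (fun i => c i * `|lam i| `^ p))// => i _.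
by rewrite ger0_norm.
Qed.

End lattice_means.

(** * Sparse forms and the dyadic majorant *)

Section dyadic_majorant.
Context {R : realType} {d n : nat}.
Hypothesis d_gt0 : (0 < d)%N.
Local Notation Rd := (euclid R d).
Local Notation leb := (lebesgue R d).
Local Notation D := {ffun 'I_d -> bool}.
Variables (rho : 'I_n -> R) (M : R).
Hypothesis rho_gt0 : forall j, 0 < rho j.
Hypothesis M_gt0 : 0 < M.

(* [12 ^ d] comes from [locate], the factor 2 from sparseness. *)
Definition dilation_const : R := 2 * \prod_(j < n) (12 ^+ d) `^ (rho j)^-1.

Section fixed_functions.
Variable F : 'I_n -> Rd -> R.

Definition mean_prod (Q : set Rd) : R := \prod_j pmean leb (rho j) (F j) Q `^ (rho j)^-1.

(** The integral over [R^d] of the function [V N] below, see [int_V]. *)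
Definition dyadic_majorant (N : nat) : R :=
  \sum_(t : D) (3 * M) ^+ d * tavg N (fun v => msup (fun w => mean_prod (shifted_cube M t w)) v) +
  \sum_(k < N) (6 * 2 ^+ k * M) ^+ d * mean_prod (@tower R d M k).

Hypothesis F_int : forall j, locally_power_integrable leb (rho j) (F j).
Variable j0 : 'I_n.
Hypothesis F_supp : forall x, F j0 x != 0 -> forall i, `|tnth x i| < M / 2.

Let hC t : set_tree leb (shifted_cube M t) ((3 * M) ^+ d).
Proof. by apply: dyadic_cube_tree; rewrite mulr_gt0. Qed.

Lemma cube_measurable (Q : set Rd) : cube Q -> measurable Q.
Proof. by move=> [a [l [_ ->]]]; exact: measurable_box. Qed.

Lemma cube_measure_gt0 (Q : set Rd) : cube Q -> (0 < leb Q < +oo)%E.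
Proof.
move=> [a [l [l0 ->]]]; rewrite lebesgue_cube ?ltW//.
by rewrite lte_fin exprn_gt0// ltry.
Qed.

Lemma shifted_cubeP t w : cube (@shifted_cube R d M t w).
Proof.
exists (corner (shift_origin M t) (3 * M) w), (side (3 * M) (size w)); split => //.
by rewrite /side !mulr_gt0// exprn_gt0// invr_gt0.
Qed.

Let Tw_gt0 k : 0 < 6 * 2 ^+ k * M.
Proof. by rewrite !mulr_gt0// exprn_gt0. Qed.

Lemma towerP k : cube (@tower R d M k).
Proof. by exists (fun=> - (3 * 2 ^+ k * M)), (6 * 2 ^+ k * M). Qed.

Lemma mean_prod_ge0 Q : 0 <= mean_prod Q.
Proof. by apply: prodr_ge0 => j _; exact: powR_ge0. Qed.

Let V N (x : Rd) : R :=
  \sum_(t : D) \sum_(v <- @words D N) msup (fun w => mean_prod (shifted_cube M t w)) v * \1_(shifted_cube M t v) x +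
  \sum_(k < N) mean_prod (@tower R d M k) * \1_(@tower R d M k) x.

Let msup_mean_ge0 t v : 0 <= msup (fun w => mean_prod (shifted_cube M t w)) v.
Proof. by apply: msup_ge0 => w; exact: mean_prod_ge0. Qed.

Let V1_ge0 N x : 0 <= \sum_(t : D) \sum_(v <- @words D N)
  msup (fun w => mean_prod (shifted_cube M t w)) v * \1_(shifted_cube M t v) x.
Proof. by apply: sumr_ge0 => t _; apply: sumr_ge0 => v _; rewrite mulr_ge0. Qed.

Let V2_ge0 N x : 0 <= \sum_(k < N) mean_prod (@tower R d M k) * \1_(@tower R d M k) x.
Proof. by apply: sumr_ge0 => k _; rewrite mulr_ge0// mean_prod_ge0. Qed.

Let measurable_V1 N : measurable_fun setT (fun x : Rd => \sum_(t : D) \sum_(v <- @words D N)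
  msup (fun w => mean_prod (shifted_cube M t w)) v * \1_(shifted_cube M t v) x).
Proof.
apply: measurable_sum => t; apply: measurable_sum => v; apply: measurable_funM => //.
by apply: measurable_indic; exact: measurable_box.
Qed.

Let measurable_V2 N : measurable_fun setT (fun x : Rd =>
  \sum_(k < N) mean_prod (@tower R d M k) * \1_(@tower R d M k) x).
Proof.
apply: measurable_sum => k; apply: measurable_funM => //.
by apply: measurable_indic; exact: measurable_box.
Qed.

Let int_V N : (\int[leb]_x (V N x)%:E = (dyadic_majorant N)%:E)%E.
Proof.
rewrite /V; under eq_integral do rewrite EFinD.
rewrite ge0_integralD//; last 4 first.
- by move=> x _; rewrite lee_fin.
- exact/measurable_EFinP.
- by move=> x _; rewrite lee_fin.
- exact/measurable_EFinP.
rewrite /dyadic_majorant EFinD; congr (_ + _)%E.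
  under eq_integral do rewrite -sumEFin.
  rewrite ge0_integral_sum//; last 2 first.
  - move=> t; apply/measurable_EFinP; apply: measurable_sum => v; apply: measurable_funM => //.
    by apply: measurable_indic; exact: measurable_box.
  - by move=> t x _; rewrite lee_fin; apply: sumr_ge0 => v _; rewrite mulr_ge0.
  rewrite -sumEFin; apply: eq_bigr => t _.
  exact: (st_integral_step (hC t)).
under eq_integral do rewrite -sumEFin.
rewrite ge0_integral_sum//; last 2 first.
- move=> k; apply/measurable_EFinP/measurable_funM => //.
  by apply: measurable_indic; exact: measurable_box.
- by move=> k x _; rewrite lee_fin mulr_ge0 ?mean_prod_ge0.
rewrite -sumEFin; apply: eq_bigr => k _.
under eq_integral do rewrite EFinM.
rewrite ge0_integralZl_EFin ?mean_prod_ge0//; last first.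
  by apply/measurable_EFinP; apply: measurable_indic; exact: measurable_box.
rewrite integral_indic ?setIT//; last exact: measurable_box.
have TwE : leb (@tower R d M k) = ((6 * 2 ^+ k * M) ^+ d)%:E.
  by apply: lebesgue_cube; exact: ltW.
by rewrite [X in (_ * X)%E = _]TwE -EFinM mulrC.
Qed.

Let V_ge_cube N t w x : (size w <= N)%N -> shifted_cube M t w x ->
  mean_prod (shifted_cube M t w) <= V N x.
Proof.
move=> wN wx; have [z zN zx] := st_leaf (hC t) (N - size w) wx.
have zwN : size (z ++ w) = N by rewrite size_cat zN subnK.
apply: (@le_trans _ _ (\sum_(v <- @words D N)
    msup (fun w => mean_prod (shifted_cube M t w)) v * \1_(shifted_cube M t v) x)).
  rewrite (st_step_val (hC t) _ zwN zx).
  exact: (msup_ge (fun w => mean_prod (shifted_cube M t w))).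
rewrite /V (bigD1 t)//= -addrA lerDl; apply: addr_ge0; last exact: V2_ge0.
by apply: sumr_ge0 => t' _; apply: sumr_ge0 => v _; rewrite mulr_ge0.
Qed.

Let V_ge_tower N k x : (k < N)%N -> tower M k x -> mean_prod (@tower R d M k) <= V N x.
Proof.
move=> kN kx; apply: ler_wpDl; first exact: V1_ge0.
rewrite (bigD1 (Ordinal kN)) //.
apply: ler_wpDr.
  by apply: sumr_ge0 => l _; rewrite mulr_ge0 ?mean_prod_ge0.
rewrite indicE.
rewrite mem_set; last exact: kx.
by rewrite mulr1.
Qed.

Let locate_level Q : cube Q -> (exists x, Q x /\ forall i, `|tnth x i| < M / 2) ->
  exists Q' : set Rd, exists N0 : nat, [/\ cube Q', Q `<=` Q',
    (leb Q' <= (12 ^+ d)%:E * leb Q)%E &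
    forall N x, (N0 <= N)%N -> Q' x -> mean_prod Q' <= V N x].
Proof.
move=> cQ xQ; have [Q' [sub le [[t [w QE]]|[k QE]]]] := locate M_gt0 cQ xQ.
  exists Q', (size w); split => //; first by rewrite QE; exact: shifted_cubeP.
  by move=> N x wN; rewrite QE; exact: V_ge_cube.
exists Q', k.+1; split => //; first by rewrite QE; exact: towerP.
by move=> N x kN; rewrite QE; exact: V_ge_tower.
Qed.

(** A cube [Q] meeting the support box lies in a tree or tower cube of comparable measure, on which
    [V N] is at least the product of its means. As [Q] has at most twice the measure of [E Q] and
    these sets are disjoint, the sum is at most a constant times the integral of [V N]. *)
Lemma sparse_sum_le_majorant S : sparse S ->
  (\esum_(Q in S) ((\prod_j avg leb (rho j) (F j) Q) * leb Q) <=
   dilation_const%:E * ereal_sup (range (fun N => (dyadic_majorant N)%:E)))%E.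
Proof.
move=> [Scube [E [tE hE]]].
have avg_meanE Q : cube Q -> (\prod_j avg leb (rho j) (F j) Q = (mean_prod Q)%:E)%E.
  move=> cQ; rewrite /mean_prod -prodEFin; apply: eq_bigr => j _.
  by rewrite avgE//; [exact: cube_measurable|exact: cube_measure_gt0].
pose E' Q := if `[< S Q >] then E Q else set0.
have mE' Q : measurable (E' Q).
  by rewrite /E'; case: asboolP => // SQ; case: (hE Q SQ).
have mV N : measurable_fun setT (fun x => (V N x)%:E).
  by apply/measurable_EFinP/measurable_funD.
have V_ge0 N x : 0 <= V N x by rewrite addr_ge0.
have term Q : S Q -> exists N0 : nat, forall N, (N0 <= N)%N ->
    ((\prod_j avg leb (rho j) (F j) Q) * leb Q <=
     dilation_const%:E * \int[leb]_(x in E' Q) (V N x)%:E)%E.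
  move=> SQ; have cQ := Scube _ SQ; have [mEQ EQ EQh] := hE _ SQ.
  have EE : E' Q = E Q by rewrite /E' asboolT.
  have dil0 : 0 <= dilation_const.
    by rewrite mulr_ge0// prodr_ge0// => j _; exact: powR_ge0.
  have [Qx|Qx] := pselect (exists x, Q x /\ forall i, `|tnth x i| < M / 2); last first.
    (* A cube that misses the support box of [F j0] has a vanishing mean. *)
    exists 0%N => N _; rewrite avg_meanE//.
    have -> : mean_prod Q = 0.
      rewrite /mean_prod (bigD1 j0)//= (_ : pmean _ _ _ _ = 0) ?powR0 ?mul0r//.
        by rewrite invr_neq0// gt_eqF.
      rewrite /pmean integral0_eq ?mule0// => x xQ.
      suff -> : F j0 x = 0 by rewrite normr0 powR0 ?gt_eqF.
      apply: contrapT => /eqP Fx; apply: Qx; exists x; split => //.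
      exact: F_supp.
    rewrite mul0e mule_ge0 ?lee_fin// integral_ge0// => x _.
    by rewrite lee_fin.
  have [Q' [N0 [cQ' QQ' leQ' VQ']]] := locate_level cQ Qx.
  exists N0 => N N0N; rewrite avg_meanE//.
  have mean_le : mean_prod Q <= \prod_(j < n) (12 ^+ d) `^ (rho j)^-1 * mean_prod Q'.
    rewrite -big_split/=; apply: ler_prod => j _; rewrite powR_ge0/= -powRM ?pmean_ge0 ?exprn_ge0//.
    apply: ge0_ler_powR; rewrite ?nnegrE ?invr_ge0 ?(ltW (rho_gt0 _)) ?mulr_ge0 ?exprn_ge0 ?pmean_ge0//.
    apply: (pmean_subset (F_int j)) => //; [exact: cube_measurable|exact: cube_measurable
      |exact: cube_measure_gt0|exact: cube_measure_gt0].
  have Qhalf : (leb Q <= 2%:E * leb (E' Q))%E.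
    rewrite EE; move: EQh; have /andP[_] := cube_measure_gt0 cQ.
    have Qge0 : (0 <= leb Q)%E by exact: measure_ge0.
    have Ege0 : (0 <= leb (E Q))%E by exact: measure_ge0.
    case: (leb Q) Qge0 => [a a0 _|//|//]; case: (leb (E Q)) Ege0 => [b b0|_ _|//].
      rewrite -EFinM lee_fin => h; rewrite -EFinM lee_fin.
      by rewrite -(@ler_pM2l _ 2^-1) ?invr_gt0// mulKf// pnatr_eq0.
    by rewrite mulry gtr0_sg// mul1e leey.
  have int_ge : ((mean_prod Q')%:E * leb (E' Q) <= \int[leb]_(x in E' Q) (V N x)%:E)%E.
    rewrite -integral_cst//; apply: ge0_le_integral => //.
    - by move=> x _; rewrite lee_fin mean_prod_ge0.
    - exact: measurable_funTS.
    - by move=> x; rewrite EE => Ex; rewrite lee_fin VQ'//; exact/QQ'/EQ.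
  have h1 : ((mean_prod Q)%:E * leb Q <=
      (\prod_(j < n) (12 ^+ d) `^ (rho j)^-1 * mean_prod Q')%:E * (2%:E * leb (E' Q)))%E.
    apply: lee_pmul; [by rewrite lee_fin mean_prod_ge0|exact: measure_ge0|by rewrite lee_fin|exact: Qhalf].
  have h2 : (dilation_const%:E * ((mean_prod Q')%:E * leb (E' Q)) <=
      dilation_const%:E * \int[leb]_(x in E' Q) (V N x)%:E)%E.
    by apply: lee_wpmul2l => //; rewrite lee_fin.
  have h3 : ((\prod_(j < n) (12 ^+ d) `^ (rho j)^-1 * mean_prod Q')%:E * (2%:E * leb (E' Q)) =
      dilation_const%:E * ((mean_prod Q')%:E * leb (E' Q)))%E.
    by rewrite muleA -EFinM [RHS]muleA -EFinM /dilation_const; congr (_%:E * _)%E; ring.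
  by apply: le_trans h2; rewrite -h3.
apply: ge_ereal_sup => _ [A [finA AS] <-].
have /choice[lev hlev] : forall Q, exists N0 : nat, S Q -> forall N, (N0 <= N)%N ->
    ((\prod_j avg leb (rho j) (F j) Q) * leb Q <=
     dilation_const%:E * \int[leb]_(x in E' Q) (V N x)%:E)%E.
  move=> Q; have [SQ|nSQ] := pselect (S Q); last by exists 0%N.
  by have [N0 h] := term Q SQ; exists N0.
rewrite fsbig_finite//=; set s := (X in (\sum_(i <- X) _)%E).
have sS Q : Q \in s -> S Q by rewrite in_fset_set// => /set_mem/AS.
(* The sum runs over finitely many cubes, so one depth reaches all of them; the supremum over depths
   is taken afterwards. *)
pose N := (\max_(Q <- s) lev Q)%N.
have us : uniq s by exact: fset_uniq.
apply: (@le_trans _ _ (\sum_(Q <- s) dilation_const%:E * \int[leb]_(x in E' Q) (V N x)%:E)%E).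
  rewrite big_seq [leRHS]big_seq; apply: lee_sum => Q Qs; apply: hlev; first exact: sS.
  exact: leq_bigmax_seq.
rewrite -ge0_sume_distrr; last by move=> Q _; apply: integral_ge0 => x _; rewrite lee_fin.
rewrite lee_pmul2l ?fin_numE//; last first.
  by rewrite lte_fin mulr_gt0// prodr_gt0// => j _; rewrite powR_gt0// exprn_gt0.
apply: (@le_trans _ _ (dyadic_majorant N)%:E); last by apply: ereal_sup_ubound; exists N.
have tE' : trivIset [set` s] E'.
  move=> Q1 Q2 s1 s2; have S1 := sS Q1 s1; have S2 := sS Q2 s2.
  by rewrite /E' !asboolT//; exact: tE.
have V_fin0 (A0 : set Rd) x : A0 x -> (0 <= (V N x)%:E)%E by rewrite lee_fin.
rewrite -ge0_integral_bigsetU//; try exact: measurable_funTS; last exact: V_fin0.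
rewrite -int_V; apply: ge0_subset_integral => //.
- exact: bigsetU_measurable.
- by move=> x _; rewrite lee_fin.
Qed.

Lemma dyadic_majorant_nd : nondecreasing_seq dyadic_majorant.
Proof.
apply/nondecreasing_seqP => N; rewrite /dyadic_majorant; apply: lerD.
  apply: ler_sum => t _; rewrite ler_pM2l ?exprn_gt0 ?mulr_gt0//=.
  apply: le_tavg => v _.
  rewrite -[leLHS](@mulKf _ (#|{: D}|%:R)) ?pnatr_eq0 -?lt0n ?digits_gt0//.
  rewrite ler_wpM2l ?invr_ge0//; rewrite mulr_natl -sumr_const; apply: ler_sum => a _.
  by rewrite le_max lexx orbT.
by rewrite big_ord_recr/= lerDl mulr_ge0 ?mean_prod_ge0// exprn_ge0// ltW.
Qed.

End fixed_functions.
End dyadic_majorant.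

(** * Norming functionals and their measurable selection *)

Section norming_sequence.
Context {R : realType} {dO : measure_display} {Omega : measurableType dO}.
Context (mu : {sigma_finite_measure set Omega -> \bar R}).
Context {d} {T : measurableType d} (nu : {measure set T -> \bar R}).
Variable X : funspace R Omega.
Hypothesis hX : is_bfs mu X.
Hypothesis ocX : order_continuous mu X.
Let qX : is_qbfs mu X := hX.1.

(* Simple functions take countably many values; the norming functionals of all the
   values of the approximants of [F] are norming for almost every [F x]. *)
Lemma norming_sequence (F : T -> Omega -> R) : strongly_measurable nu X F ->
  exists eta : nat -> Omega -> R,
    (forall n, [/\ fs_mem (fs_dual mu X) (eta n), fs_norm (fs_dual mu X) (eta n) <= 1 &
       forall w, 0 <= eta n w]) /\
    {ae nu, forall x, fs_mem X (F x) /\ ((fs_norm X (F x))%:E <=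
      ereal_sup (range (fun n => \int[mu]_w (`|F x w| * eta n w)%:E)))%E}.
Proof.
move=> [mF aeF [h hs hF]].
have norming xi : exists eta, fs_mem X xi -> [/\ fs_mem (fs_dual mu X) eta,
    fs_norm (fs_dual mu X) eta <= 1, forall w, 0 <= eta w,
    (\int[mu]_w (`|xi w| * eta w)%:E = (fs_norm X xi)%:E)%E &
    forall h, fs_mem X h -> (\int[mu]_w (`|h w| * eta w)%:E <= (fs_norm X h)%:E)%E].
  have [mxi|] := pselect (fs_mem X xi); last by exists (fun=> 0).
  by have [eta ?] := fs_dual_norming hX ocX mxi; exists eta.
have /choice[dualize hdual] := norming.
(* The values of a simple function are combinations of fixed members with coefficients 0 and 1;
   coding them by boolean sequences makes all of them, for all [k], enumerable. *)
have /choice[vals hvals] : forall k, exists val : seq bool -> Omega -> R,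
    (forall s, fs_mem X (val s)) /\ forall x, exists s, h k x = val s.
  move=> k; have [N [A [xi [mA mxi hE]]]] := hs k.
  exists (fun s w => \sum_(i < N) (nth false s i)%:R * xi i w); split.
    by move=> s; apply: (qbfs_mem_sum qX) => i; exact: (qbfs_scale qX).
  move=> x; exists (mkseq (fun i => if insub i is Some j then x \in A j else false) N).
  apply/funext => w; rewrite hE; apply: eq_bigr => i _.
  by rewrite nth_mkseq// indicE valK.
pose eta n := if choice.unpickle n is Some (k, s) then dualize (vals k s) else dualize (fun=> 0).
have hd xi := hdual xi.
exists eta; split.
  move=> n; rewrite /eta; case: choice.unpickle => [[k s]|].
    by have [] := hd _ ((hvals k).1 s).
  by have [] := hd _ (qbfs_mem0 qX).
apply: filterS2 aeF hF => x mFx cvx; split => //.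
apply/lee_addgt0Pr => e e0.
(* The distance from [h k x] to [F x] is paid twice, in comparing the norms and in comparing the
   pairings. *)
have [k] : exists k, 2 * fs_norm X (fun w => h k x w - F x w) < e.
  have e20 : 0 < e / 2 by rewrite divr_gt0.
  have /cvgrPdist_lt/(_ _ e20)[K _ /(_ K (leqnn _))] := cvx.
  rewrite sub0r normrN => hK; exists K; rewrite mulrC -ltr_pdivlMr//.
  exact: le_lt_trans (ler_norm _) hK.
have [s hxE] := (hvals k).2 x; have mv := (hvals k).1 s.
have [_ _ e_ge0 eE e_le] := hd _ mv.
have mh : fs_mem X (h k x) by rewrite hxE.
have mhF := qbfs_memB qX mh mFx.
set del := fs_norm X _ => del_e.
have del0 : 0 <= del by exact: (qbfs_norm_ge0 qX).
have meta0 : measurable_fun setT (dualize (vals k s)).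
  by have [[]] := hd _ mv.
have mm z : fs_mem X z -> measurable_fun setT (fun w => (`|z w| * dualize (vals k s) w)%:E).
  move=> mz; apply/measurable_EFinP/measurable_funM => //.
  by apply: measurableT_comp => //; exact: (qbfs_measurable qX).
have ub : (\int[mu]_w (`|F x w| * dualize (vals k s) w)%:E <=
    ereal_sup (range (fun n => \int[mu]_w (`|F x w| * eta n w)%:E)))%E.
  apply: ereal_sup_ubound; exists (choice.pickle (k, s)) => //.
  by rewrite /eta choice.pickleK.
have n1 : fs_norm X (F x) <= fs_norm X (h k x) + del.
  have -> : F x = fun w => h k x w + - (h k x w - F x w).
    by apply/funext => w; rewrite opprB addrCA subrr addr0.
  apply: le_trans (hX.2 _ _ mh (qbfs_memN qX mhF)) _.
  by rewrite (qbfs_normN qX).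
have n2 : ((fs_norm X (h k x))%:E <= \int[mu]_w (`|F x w| * dualize (vals k s) w)%:E + del%:E)%E.
  rewrite hxE -eE; apply: (@le_trans _ _ (\int[mu]_w ((`|F x w| * dualize (vals k s) w)%:E +
      (`|h k x w - F x w| * dualize (vals k s) w)%:E))%E).
    apply: ge0_le_integral => //.
    - by move=> w _; rewrite lee_fin mulr_ge0.
    - exact: mm.
    - by apply: emeasurable_funD; exact: mm.
    - move=> w _; rewrite -EFinD lee_fin -mulrDl ler_wpM2r// -hxE.
      by rewrite -[X in `|X| <= _](subrK (F x w)) addrC; exact: ler_normD.
  rewrite ge0_integralD//.
  - by rewrite leeD2l//; exact: e_le.
  - by move=> w _; rewrite lee_fin mulr_ge0.
  - exact: mm.
  - by move=> w _; rewrite lee_fin mulr_ge0.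
  - exact: mm.
apply: (@le_trans _ _ ((fs_norm X (h k x))%:E + del%:E)%E); first by rewrite -EFinD lee_fin.
apply: (@le_trans _ _ ((\int[mu]_w (`|F x w| * dualize (vals k s) w)%:E + del%:E) + del%:E)%E).
  exact: leeD2r.
rewrite -addeA -EFinD; apply: leeD => //; rewrite lee_fin; lra.
Qed.

End norming_sequence.

Section running_argmax.
Context {d} {T : measurableType d} {R : realType}.
Variable u : nat -> T -> \bar R.
Hypothesis mu_ : forall n, measurable_fun setT (u n).

(** Ties go to the smallest index. Choosing an index, and not just the maximum, makes the selected
    functional a finite-valued function of [x]. *)
Fixpoint argmax (n : nat) (x : T) : nat :=
  if n is n'.+1 then if (u (argmax n' x) x < u n x)%E then n else argmax n' x else 0%N.

Definition running_max n x := u (argmax n x) x.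

Lemma argmax_le n x : (argmax n x <= n)%N.
Proof. by elim: n => [//|n IHn] /=; case: ifP => // _; exact: leq_trans IHn _. Qed.

Lemma running_maxS n x : running_max n.+1 x = maxe (running_max n x) (u n.+1 x).
Proof. by rewrite /running_max /= /Order.max; case: ifP. Qed.

Lemma running_max_ge i n x : (i <= n)%N -> (u i x <= running_max n x)%E.
Proof.
elim: n => [|n IHn]; first by rewrite leqn0 => /eqP ->.
rewrite leq_eqVlt running_maxS le_max => /predU1P[->|]; first by rewrite lexx orbT.
by rewrite ltnS => /IHn ->.
Qed.

Lemma running_max_nd x : nondecreasing_seq (running_max ^~ x).
Proof. by apply/nondecreasing_seqP => n; rewrite running_maxS le_max lexx. Qed.

Lemma measurable_running_max n : measurable_fun setT (running_max n).
Proof.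
elim: n => [|n IHn]; first exact: mu_.
rewrite (_ : running_max n.+1 = fun x => maxe (running_max n x) (u n.+1 x)).
  exact: measurable_maxe.
by apply/funext => x; exact: running_maxS.
Qed.

Lemma measurable_argmax n i : measurable [set x | argmax n x = i].
Proof.
elim: n i => [|n IHn] i.
  have [->|i0] := eqVneq i 0%N.
    by rewrite (_ : [set _ | _] = setT)//; apply/seteqP.
  by rewrite (_ : [set _ | _] = set0)//; apply/seteqP; split => // x /= /esym/eqP; rewrite (negbTE i0).
pose L := [set x | (running_max n x < u n.+1 x)%E].
have mL : measurable L.
  rewrite -[L]setTI; exact: (measurable_lte measurableT (measurable_running_max n) (mu_ n.+1)).
have -> : [set x | argmax n.+1 x = i] = (L `&` [set x | n.+1 = i]) `|` (~` L `&` [set x | argmax n x = i]).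
  apply/seteqP; split => x /=; rewrite /L/= /running_max.
    by case: ifPn => [h <-|/negP h]; [left|right].
  by case=> -[h]; [rewrite h|move/negP/negbTE: h => ->].
apply: measurableU; apply: measurableI => //; last exact: measurableC.
by have [->|ne] := pselect (n.+1 = i); [rewrite (_ : [set _ | _] = setT)//; apply/seteqP|
  rewrite (_ : [set _ | _] = set0)//; apply/seteqP; split].
Qed.

End running_argmax.

Section compactly_supported.
Context {R : realType} {d : nat}.
Hypothesis d_gt0 : (0 < d)%N.
Local Notation Rd := (euclid R d).
Local Notation leb := (lebesgue R d).

Lemma compact_euclid_bounded (K : set Rd) : compact_euclid K ->
  exists2 M : R, 0 < M & forall x, K x -> forall i, `|tnth x i| < M / 2.
Proof.
move=> cK; have bnd i : exists b : R, forall x, K x -> `|tnth x i| <= b.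
  have : compact ((fun A : 'rV[R]_d => A ord0 i) @` ((fun x : Rd => \row_i tnth x i) @` K)).
    apply: continuous_compact => //; apply: continuous_subspaceT => A.
    exact: coord_continuous.
  move=> /compact_bounded[b [_ hb]]; exists (b + 1) => x Kx.
  have := hb (b + 1); rewrite ltrDl ltr01 => /(_ isT); apply.
  by exists (\row_i tnth x i); [exists x|rewrite mxE].
have /choice[b hb] := bnd; exists (2 * (\sum_i `|b i| + 1)).
  by rewrite mulr_gt0// ltr_wpDl// sumr_ge0.
move=> x Kx i; rewrite mulrAC mulfV// mul1r; apply: le_lt_trans (hb i x Kx) _.
apply: (@le_lt_trans _ _ (\sum_i `|b i|)); last by rewrite ltrDl.
by rewrite (bigD1 i)//= ler_wpDr ?ler_norm// sumr_ge0.
Qed.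

(** [Lnorm] at [+oo] is the essential supremum under the condition that the whole space has positive
    measure. *)
Lemma lebesgue_setT_gt0 : (0 < leb setT)%E.
Proof.
apply: (@lt_le_trans _ _ (leb (box (fun=> 0) (fun=> 0 + 1)))).
  by rewrite (lebesgue_cube (fun=> 0))// expr1n lte_fin.
by apply: le_measure => //; apply/mem_set => //; exact: measurable_box.
Qed.

Lemma Linfc_bounded (f : Rd -> R) (c : R) (K : set Rd) : measurable_fun setT f ->
  (forall x, `|f x| <= c) -> compact_euclid K -> (forall x, ~ K x -> f x = 0) -> Linfc f.
Proof.
move=> mf fc cK fK; split => //; last by exists K; split => //; exact: aeW.
rewrite unlock lebesgue_setT_gt0; apply: (@le_lt_trans _ _ c%:E); last exact: ltry.
by apply/ess_supP/aeW => x /=; rewrite lee_fin.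
Qed.

Lemma Linfc_ae_bounded (g : Rd -> R) : Linfc g ->
  exists2 c : R, 0 <= c & {ae leb, forall x, `|g x| <= c}.
Proof.
move=> [mg]; rewrite unlock lebesgue_setT_gt0 => gfin _.
have g0 : (0 <= ess_sup leb (abse \o (EFin \o g)))%E.
  apply: ess_sup_gee; first exact: lebesgue_setT_gt0.
  by apply: aeW => x; exact: abse_ge0.
exists (fine (ess_sup leb (abse \o (EFin \o g)))); first exact: fine_ge0.
have := ess_sup_ge leb (abse \o (EFin \o g)); apply: filterS => x /=.
by rewrite -lee_fin fineK// ge0_fin_numE.
Qed.

Lemma Linfc_dominated (g h : Rd -> R) (c : R) : Linfc g -> measurable_fun setT h ->
  0 <= c -> (forall x, `|h x| <= c * `|g x|) -> Linfc h.
Proof.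
move=> Lg mh c0 hg; have [b b0 gb] := Linfc_ae_bounded Lg.
case: Lg => mg _ [K [cK gK]]; split => //.
  rewrite unlock lebesgue_setT_gt0; apply: (@le_lt_trans _ _ (c * b)%:E); last exact: ltry.
  apply/ess_supP; apply: filterS gb => x /= gx; rewrite lee_fin.
  by apply: le_trans (hg x) _; rewrite ler_wpM2l.
exists K; split => //; apply: filterS gK => x gx Kx; apply/eqP; rewrite -normr_le0.
by apply: le_trans (hg x) _; rewrite gx// normr0 mulr0.
Qed.

Lemma Linfc_power_integrable (g : Rd -> R) (p : R) : 0 < p -> Linfc g ->
  locally_power_integrable leb p g.
Proof.
move=> p0 Lg; have [b b0 gb] := Linfc_ae_bounded Lg; have [mg _ _] := Lg.
split => // Q mQ Qf.
apply: (@le_lt_trans _ _ (\int[leb]_(x in Q) (cst (b `^ p)%:E x))%E).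
  apply: ae_ge0_le_integral => //.
  - exact/measurable_funTS/measurable_fun_abs_powR.
  - by move=> x _; rewrite lee_fin powR_ge0.
  apply: filterS gb => x gx _; rewrite lee_fin.
  by apply: ge0_ler_powR; rewrite ?nnegrE// ltW.
rewrite integral_cst//; apply: lte_mul_pinfty => //; first by rewrite lee_fin powR_ge0.
Qed.

Lemma cst1_power_integrable (p : R) : locally_power_integrable leb p (fun=> 1).
Proof.
split => // Q mQ Qf; under eq_integral do rewrite normr1 powR1.
by rewrite integral_cst// mul1e.
Qed.

End compactly_supported.

Section simple_finite_valued.
Context {R : realType} {dO : measure_display} {Omega : measurableType dO}.
Context (mu : {sigma_finite_measure set Omega -> \bar R}).
Context {d} {T : measurableType d}.

(** The sets [A k] may overlap; the pattern of memberships of [x] indexes a finite partition on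
    which [f] is constant. *)
Lemma simple_functionP (X : funspace R Omega) (f : T -> Omega -> R) :
  is_qbfs mu X -> simple_function X f ->
  exists (I : finType) (sigma : T -> I) (y : I -> Omega -> R),
    [/\ forall i, measurable (sigma @^-1` [set i]), forall i, fs_mem X (y i) &
        forall x, f x = y (sigma x)].
Proof.
move=> qX [N [A [xi [mA mxi fE]]]].
exists {ffun 'I_N -> bool}, (fun x => [ffun k => x \in A k]),
  (fun (tau : {ffun 'I_N -> bool}) w => \sum_k (tau k)%:R * xi k w); split.
- move=> tau; rewrite (_ : _ @^-1` _ = \bigcap_(k in [set: 'I_N]) (if tau k then A k else ~` A k)).
    apply: fin_bigcap_measurable => // k _; case: ifP => _; first exact: mA.
    exact/measurableC/mA.
  apply/seteqP; split => [x /= <- k _|x h /=].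
    by rewrite ffunE; case: ifPn => [/set_mem//|/negP xA xAk]; apply: xA; exact: mem_set.
  apply/ffunP => k; rewrite ffunE; have := h k I; case: (tau k) => /=; first exact: mem_set.
  by move=> nA; apply/negbTE/negP => /set_mem.
- by move=> tau; apply: (qbfs_mem_sum qX) => k; exact: (qbfs_scale qX).
- by move=> x; apply/funext => w; rewrite fE; apply: eq_bigr => k _; rewrite ffunE indicE.
Qed.

End simple_finite_valued.

Lemma ge0_integral_ereal_sup_le {d} {T : measurableType d} {R : realType}
    (nu : {measure set T -> \bar R}) (f : nat -> T -> \bar R) (c : \bar R) :
  (forall n, measurable_fun setT (f n)) -> (forall n x, 0 <= f n x)%E ->
  (forall x, nondecreasing_seq (f ^~ x)) -> (forall n, \int[nu]_x f n x <= c)%E ->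
  (\int[nu]_x ereal_sup (range (f ^~ x)) <= c)%E.
Proof.
move=> mf f0 ndf fc.
have supE x : ereal_sup (range (f ^~ x)) = limn (f ^~ x).
  by apply/esym/cvg_lim => //; exact: ereal_nondecreasing_cvgn.
under eq_integral do rewrite supE.
rewrite monotone_convergence//.
apply: lime_le; last exact: nearW.
apply: ereal_nondecreasing_is_cvgn => i j ij; apply: ge0_le_integral => // x _.
exact: ndf.
Qed.

Lemma measurable_fun_ereal_sup_range {d} {T : measurableType d} {R : realType}
    (f : nat -> T -> \bar R) : (forall n, measurable_fun setT (f n)) ->
  measurable_fun setT (fun x => ereal_sup (range (f ^~ x))).
Proof.
move=> mf; have := @measurable_fun_esups _ _ _ setT f mf 0%N.
rewrite (_ : (fun x => esups (f ^~ x) 0) = fun x => ereal_sup (range (f ^~ x)))//.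
apply/funext => x; rewrite /esups /sdrop; congr ereal_sup.
by apply/seteqP; split => [_ [k _ <-]|_ [k _ <-]]; exists k.
Qed.

(** * Integration of the dyadic majorant over [Omega] *)

Section majorant_integral.
Context {R : realType} {d m : nat}.
Hypothesis d_gt0 : (0 < d)%N.
Local Notation Rd := (euclid R d).
Local Notation leb := (lebesgue R d).
Local Notation D := {ffun 'I_d -> bool}.
Context {dO : measure_display} {Omega : measurableType dO}.
Context (mu : {sigma_finite_measure set Omega -> \bar R}).

(** The interface to the tree argument: power means of [G] are members whose norms are controlled by
    those of the scalar [psi]. Stopping is decided by [psi], so the principal cubes do not depend on
    the point of [Omega]. *)
Definition mean_controlled (Y : funspace R Omega) (p : R) (G : Rd -> Omega -> R) (psi : Rd -> R) :=
  [/\ forall o, locally_power_integrable leb p (G ^~ o), locally_power_integrable leb p psi &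
    forall Q, measurable Q -> (0 < leb Q < +oo)%E ->
    let h := fun o => pmean leb p (G ^~ o) Q `^ p^-1 in
    fs_mem Y h /\ fs_norm Y h <= pmean leb p psi Q `^ p^-1].

Section principal_form.
Variables (n : nat) (rho : 'I_n -> R) (M : R) (psi : 'I_n -> Rd -> R).
Hypothesis M_gt0 : 0 < M.
Hypothesis psi_int : forall j, locally_power_integrable leb (rho j) (psi j).

Definition cube_means (t : D) (j : 'I_n) (w : seq D) : R :=
  pmean leb (rho j) (psi j) (shifted_cube M t w).

Definition principal_cubes (t : D) : set (set Rd) := principal_family M t (cube_means t).

Definition product_form (S : set (set Rd)) : \bar R :=
  (\esum_(Q in S) ((\prod_j avg leb (rho j) (psi j) Q) * leb Q))%E.

Lemma cube_means_ge0 t j w : 0 <= cube_means t j w.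
Proof. exact: pmean_ge0. Qed.

Let hC t : set_tree leb (shifted_cube M t) ((3 * M) ^+ d).
Proof. by apply: dyadic_cube_tree; rewrite mulr_gt0. Qed.

Lemma cube_means_martingale t j : martingale (cube_means t j).
Proof. exact: (pmean_martingale (psi_int j) (@digits_gt0 d) (hC t)). Qed.

Lemma sparse_principal_cubes t : sparse (principal_cubes t).
Proof.
apply: principal_family_sparse => //; first exact: cube_means_martingale.
exact: cube_means_ge0.
Qed.

Lemma product_form_ge0 S : (0 <= product_form S)%E.
Proof.
apply: esum_ge0 => Q _; apply: mule_ge0; last exact: measure_ge0.
by apply: prode_ge0 => j; rewrite /avg poweR_ge0.
Qed.

Let G (Q : set Rd) := ((\prod_j avg leb (rho j) (psi j) Q) * leb Q)%E.

Let G_cube Q : cube Q -> G Q = ((mean_prod rho psi Q)%:E * leb Q)%E.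
Proof.
move=> cQ; rewrite /G /mean_prod -prodEFin; congr (_ * _)%E; apply: eq_bigr => j _.
by rewrite avgE//; [exact: cube_measurable|exact: cube_measure_gt0].
Qed.

(** The weight of a word in [tavg k], times the measure [(3 * M) ^+ d] of the top cube, is the
    measure of its cube. *)
Lemma principal_sum_le_form t N K :
  ((((3 * M) ^+ d * \sum_(k < N) tavg k (fun u =>
    (prn (exceeds (cube_means t) (2 * n.+1)%:R) u == u)%:R *
      \prod_j cube_means t j u `^ (rho j)^-1)) +
   \sum_(k < K) (6 * 2 ^+ k * M) ^+ d * mean_prod rho psi (tower M k))%:E <=
  product_form (principal_cubes t))%E.
Proof.
have := @principal_family_esum R d d_gt0 M t n M_gt0 (cube_means t) G N K.
have G0 Q : (0 <= G Q)%E.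
  apply: mule_ge0; last exact: measure_ge0.
  by apply: prode_ge0 => j; rewrite /avg poweR_ge0.
move=> /(_ (fun Q _ => G0 Q)); apply: le_trans; rewrite le_eqVlt; apply/orP; left; apply/eqP.
rewrite EFinD; congr (_ + _)%E; last first.
  rewrite -sumEFin; apply: eq_bigr => k _; rewrite (G_cube (towerP M_gt0 k)).
  have E : leb (@tower R d M k) = ((6 * 2 ^+ k * M) ^+ d)%:E.
    by apply: lebesgue_cube; rewrite !mulr_ge0 ?exprn_ge0 ?(ltW M_gt0).
  by rewrite [X in (_ = _ * X)%E]E -EFinM mulrC.
rewrite mulr_sumr -sumEFin; apply: eq_bigr => k _.
rewrite tavgE mulrA mulr_sumr -sumEFin [RHS]big_mkcond/=.
apply: eq_big_seq => u; rewrite mem_words => /eqP uk.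
case: ifPn => _; last by rewrite mul0r mulr0.
rewrite (G_cube (shifted_cubeP M_gt0 t u)) [X in (_ = _ * X)%E](st_measure (hC t)) uk.
by rewrite -EFinM mul1r mulrC.
Qed.

(** A union of the families need not be sparse with constant one half, so the sum over the trees is
    charged to its largest term at the cost of their number. *)
Lemma best_principal_cubes : exists t,
  (\sum_(t : D) product_form (principal_cubes t) <=
   #|{: D}|%:R%:E * product_form (principal_cubes t))%E.
Proof.
pose t0 : D := [ffun=> true].
case: (@arg_maxP _ _ D t0 xpredT (fun t => product_form (principal_cubes t))) => // t _ tmax.
exists t; apply: (@le_trans _ _ (\sum_(t' : D) product_form (principal_cubes t))%E).
  by apply: lee_sum => t' _; exact: tmax.
by rewrite big_const mule_natl /enatmul Monoid.iteropE.
Qed.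

End principal_form.

Variables (X : 'I_m -> funspace R Omega) (r : 'I_m -> R) (s : \bar R).
Hypothesis hX : forall j, is_qbfs mu (X j).
Hypothesis r_gt0 : forall j, 0 < r j.
Hypothesis s_gt1 : (1 < s)%E.
Hypothesis hU : UMD mu r s X.
Local Notation rho := (snoc r (fine (hoelder_conjugate s))).
Local Notation Y := (snoc X (fs_dual mu (fs_prod mu X))).

Theorem integral_majorant_le : exists2 K : R, 0 <= K &
  forall (M : R) (G : 'I_m.+1 -> Rd -> Omega -> R) (psi : 'I_m.+1 -> Rd -> R), 0 < M ->
    (forall j, mean_controlled (Y j) (rho j) (G j) (psi j)) ->
  measurable_fun setT
    (fun o => ereal_sup (range (fun N => (dyadic_majorant rho M (fun j => G j ^~ o) N)%:E))) /\
  (\int[mu]_o ereal_sup (range (fun N => (dyadic_majorant rho M (fun j => G j ^~ o) N)%:E)) <=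
   K%:E * \sum_(t : D) product_form rho psi (principal_cubes rho M psi t))%E.
Proof.
have [_ [hprodX _] _ hHL] := hU.
have hprod : is_qbfs mu (fs_prod mu Y) by case: hHL => -[].
have hY j : is_qbfs mu (Y j) by case: hHL => -[+ _] _ _; apply.
have [K K0 tree] := umd_tree hX r_gt0 s_gt1 hU (@digits_gt0 d).
(* [K] accounts for the trees and 1 for the tower. *)
exists (K + 1); first by rewrite addr_ge0.
move=> M G psi M_gt0 hG.
have rho_gt0 j : 0 < rho j by exact: snoc_conjugate_gt0.
have psi_int j : locally_power_integrable leb (rho j) (psi j) by case: (hG j).
have G_int j o : locally_power_integrable leb (rho j) (G j ^~ o) by case: (hG j).
have G_mem j Q : cube Q ->
    fs_mem (Y j) (fun o => pmean leb (rho j) (G j ^~ o) Q `^ (rho j)^-1) /\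
    fs_norm (Y j) (fun o => pmean leb (rho j) (G j ^~ o) Q `^ (rho j)^-1) <=
      pmean leb (rho j) (psi j) Q `^ (rho j)^-1.
  move=> cQ; case: (hG j) => _ _; apply; [exact: cube_measurable|exact: cube_measure_gt0].
have hC t : set_tree leb (shifted_cube M t) ((3 * M) ^+ d).
  by apply: dyadic_cube_tree; rewrite mulr_gt0.
pose al t j w o := pmean leb (rho j) (G j ^~ o) (shifted_cube M t w).
have tree_t t N := tree (al t) (cube_means rho M psi t) N
  (cube_means_martingale M_gt0 psi_int t) (cube_means_ge0 rho M psi t)
  (fun j o => pmean_martingale (G_int j o) (@digits_gt0 d) (hC t))
  (fun j w o => pmean_ge0 _ _ _ _)
  (fun j w => (G_mem j _ (shifted_cubeP M_gt0 t w)).1)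
  (fun j w => (G_mem j _ (shifted_cubeP M_gt0 t w)).2).
pose tw k o := mean_prod rho (fun j => G j ^~ o) (@tower R d M k).
have tw_mem k : fs_mem (fs_prod mu Y) (tw k).
  apply: (fs_prod_mem hY) => [j|j o]; last exact: powR_ge0.
  exact: (G_mem j _ (towerP M_gt0 k)).1.
have tw_norm k : \int[mu]_o tw k o <= mean_prod rho psi (tower M k).
  apply: le_trans (fs_prod_dual_integral_le hX hprodX (tw_mem k)) _.
  apply: (fs_prod_norm_le_prod hY) => [j|j o|j]; last 2 first.
  - exact: powR_ge0.
  - exact: (G_mem j _ (towerP M_gt0 k)).2.
  exact: (G_mem j _ (towerP M_gt0 k)).1.
have itw k : mu.-integrable setT (EFin \o tw k).
  exact: (fs_prod_dual_integrable hX hprodX (tw_mem k)).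
pose pm t N o := tavg N (fun v => pmax (root_prod rho (al t)) v o).
have ipm t N : mu.-integrable setT (EFin \o pm t N) by case: (tree_t t N).
have pm_ge0 t N o : 0 <= pm t N o.
  apply: (tavg_ge0 (@digits_gt0 d)) => v vN; apply: msup_ge0 => w; apply: prodr_ge0 => j _; exact: powR_ge0.
have tw_ge0 k o : 0 <= tw k o by exact: mean_prod_ge0.
have majE N o : dyadic_majorant rho M (fun j => G j ^~ o) N =
    \sum_(t : D) (3 * M) ^+ d * pm t N o + \sum_(k < N) (6 * 2 ^+ k * M) ^+ d * tw k o by [].
have M3 : 0 <= (3 * M) ^+ d by rewrite exprn_ge0// mulr_ge0// ltW.
have M6 k : 0 <= (6 * 2 ^+ k * M) ^+ d by rewrite exprn_ge0// !mulr_ge0 ?exprn_ge0// ltW.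
have mpm t N : measurable_fun setT (fun o => ((3 * M) ^+ d * pm t N o)%:E).
  apply/measurable_EFinP/measurable_funM => //; apply/measurable_EFinP.
  exact: (measurable_int mu).
have mtw k : measurable_fun setT (fun o => ((6 * 2 ^+ k * M) ^+ d * tw k o)%:E).
  apply/measurable_EFinP/measurable_funM => //; apply/measurable_EFinP.
  exact: (measurable_int mu).
have m1 N : measurable_fun setT (fun o => (\sum_(t : D) (3 * M) ^+ d * pm t N o)%:E).
  by apply/measurable_EFinP; apply: measurable_sum => t; have /measurable_EFinP := mpm t N.
have m2 N : measurable_fun setT (fun o => (\sum_(k < N) (6 * 2 ^+ k * M) ^+ d * tw k o)%:E).
  by apply/measurable_EFinP; apply: measurable_sum => k; have /measurable_EFinP := mtw k.
have s1 N o : 0 <= \sum_(t : D) (3 * M) ^+ d * pm t N o.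
  by apply: sumr_ge0 => t _; exact: mulr_ge0.
have s2 N o : 0 <= \sum_(k < N) (6 * 2 ^+ k * M) ^+ d * tw k o.
  by apply: sumr_ge0 => k _; exact: mulr_ge0.
have mmaj N : measurable_fun setT (fun o => (dyadic_majorant rho M (fun j => G j ^~ o) N)%:E).
  under eq_fun do rewrite majE EFinD.
  exact: emeasurable_funD.
split; first exact: measurable_fun_ereal_sup_range.
apply: ge0_integral_ereal_sup_le => //.
- by move=> N o; rewrite majE lee_fin addr_ge0.
- by move=> o N N' NN'; rewrite lee_fin; exact: dyadic_majorant_nd.
move=> N; under eq_integral do rewrite majE EFinD.
rewrite ge0_integralD//; try by move=> o _; rewrite lee_fin.
have I1 : (\int[mu]_o (\sum_(t : D) (3 * M) ^+ d * pm t N o)%:E <=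
    K%:E * \sum_(t : D) product_form rho psi (principal_cubes rho M psi t))%E.
  under eq_integral do rewrite -sumEFin.
  rewrite ge0_integral_sum//; last by move=> t o _; rewrite lee_fin mulr_ge0.
  rewrite ge0_sume_distrr; last by move=> t _; exact: product_form_ge0.
  apply: lee_sum => t _; under eq_integral do rewrite EFinM.
  rewrite ge0_integralZl_EFin//; last first.
  - exact: (measurable_int mu (ipm t N)).
  - by move=> o _; rewrite lee_fin.
  have -> : (\int[mu]_o (pm t N o)%:E = (\int[mu]_o pm t N o)%:E)%E.
    by rewrite /Rintegral fineK//; exact: (integrable_fin_num measurableT (ipm t N)).
  have [_ le1] := tree_t t N.
  have := principal_sum_le_form M_gt0 psi_int t N.+1 0.
  rewrite big_ord0 addr0 => h.
  apply: (@le_trans _ _ (K%:E * _)%E); last by apply: lee_wpmul2l h; rewrite lee_fin.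
  by rewrite -!EFinM lee_fin mulrCA ler_wpM2l.
have I2 : (\int[mu]_o (\sum_(k < N) (6 * 2 ^+ k * M) ^+ d * tw k o)%:E <=
    1%:E * \sum_(t : D) product_form rho psi (principal_cubes rho M psi t))%E.
  (* The tower belongs to every family and is charged to one of them. *)
  rewrite mul1e (bigD1 [ffun=> true])//=.
  apply: (@le_trans _ _ (product_form rho psi (principal_cubes rho M psi [ffun=> true]))); last first.
    by rewrite leeDl// sume_ge0// => t _; exact: product_form_ge0.
  have := principal_sum_le_form M_gt0 psi_int [ffun=> true] 0 N.
  rewrite big_ord0 mulr0 add0r; apply: le_trans.
  under eq_integral do rewrite -sumEFin.
  rewrite ge0_integral_sum//; last by move=> k o _; rewrite lee_fin mulr_ge0.
  rewrite -sumEFin; apply: lee_sum => k _; under eq_integral do rewrite EFinM.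
  rewrite ge0_integralZl_EFin//; last first.
  - exact: (measurable_int mu (itw k)).
  - by move=> o _; rewrite lee_fin.
  have -> : (\int[mu]_o (tw k o)%:E = (\int[mu]_o tw k o)%:E)%E.
    by rewrite /Rintegral fineK//; exact: (integrable_fin_num measurableT (itw k)).
  by rewrite -EFinM lee_fin ler_wpM2l.
rewrite EFinD ge0_muleDl ?lee_fin//; exact: leeD.
Qed.

End majorant_integral.

(** Monotone convergence along the running maxima, whose supremum is a measurable upper function for
    the left-hand integrand. *)
Lemma integral_le_running_max {d} {T : measurableType d} {R : realType}
    (nu : {measure set T -> \bar R}) (u : nat -> T -> \bar R) (v g : T -> R) (c : \bar R) :
  (forall n, measurable_fun setT (u n)) -> (forall n x, 0 <= u n x)%E ->
  measurable_fun setT g ->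
  {ae nu, forall x, ((v x)%:E <= ereal_sup (range (u ^~ x)))%E} ->
  (forall n, \int[nu]_x (running_max u n x * `|g x|%:E) <= c)%E ->
  (\int[nu]_x (v x * `|g x|)%:E <= c)%E.
Proof.
move=> mu_ u0 mg vu hc; pose f n x := (running_max u n x * `|g x|%:E)%E.
have f0 n x : (0 <= f n x)%E by rewrite mule_ge0// ?lee_fin// /running_max.
have mf n : measurable_fun setT (f n).
  apply: emeasurable_funM; first exact: measurable_running_max.
  by apply/measurable_EFinP; exact: measurableT_comp.
apply: (@le_trans _ _ (\int[nu]_x ereal_sup (range (f ^~ x)))%E).
  apply: integral_le_ae_measurable.
  - exact: measurable_fun_ereal_sup_range.
  - by move=> x; apply: ereal_sup_ge; exists (f 0%N x) => //; exists 0%N.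
  apply: filterS vu => x vx; have [g0|] := eqVneq (g x) 0.
    rewrite g0 normr0 mulr0; apply: ereal_sup_ge.
    by exists (f 0%N x) => //; exists 0%N.
  rewrite -normr_gt0 => g0; rewrite EFinM -lee_pdivlMr//; apply: le_trans vx _.
  apply: ge_ereal_sup => _ [n _ <-]; rewrite lee_pdivlMr//.
  apply: ereal_sup_ge; exists (f n x); first by exists n.
  by apply: lee_wpmul2r; [rewrite lee_fin ltW|exact: running_max_ge].
apply: ge0_integral_ereal_sup_le => // x i j ij.
by apply: lee_wpmul2r; [rewrite lee_fin|exact: running_max_nd].
Qed.

Section euclidean.
Context {R : realType} {d : nat}.
Local Notation Rd := (euclid R d).
Local Notation leb := (lebesgue R d).
Context {dO : measure_display} {Omega : measurableType dO}.
Context (mu : {sigma_finite_measure set Omega -> \bar R}).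

Lemma finite_valued_mean_controlled (Y : funspace R Omega) (p : R) (I : finType)
    (sigma : Rd -> I) (gam : Rd -> R) (y : I -> Omega -> R) (lam : I -> R) :
  is_qbfs mu Y -> 0 < p -> p_convex p Y ->
  (forall i, measurable (sigma @^-1` [set i])) -> locally_power_integrable leb p gam ->
  (forall i, fs_mem Y (y i)) -> (forall i, fs_norm Y (y i) <= lam i) ->
  mean_controlled Y p (fun x o => gam x * y (sigma x) o) (fun x => gam x * lam (sigma x)).
Proof.
move=> hY p0 cY ms gi my ylam; split.
- by move=> o; exact: (finite_valued_power_integrable ms gi (fun i => y i o)).
- exact: finite_valued_power_integrable.
- by move=> Q mQ Q0; exact: (finite_valued_pmean hY p0 cY ms gi my ylam).
Qed.

Lemma simple_mean_controlled (Y : funspace R Omega) (p : R) (f : Rd -> Omega -> R) :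
  is_qbfs mu Y -> 0 < p -> p_convex p Y -> simple_function Y f ->
  mean_controlled Y p f (fun x => fs_norm Y (f x)).
Proof.
move=> hY p0 cY sf; have [I [sigma [y [ms my fE]]]] := simple_functionP hY sf.
have := @finite_valued_mean_controlled Y p I sigma (fun=> 1) y (fun i => fs_norm Y (y i))
  hY p0 cY ms (cst1_power_integrable p) my (fun i => lexx _).
congr (mean_controlled Y p _ _).
  by apply/funext => x; apply/funext => o; rewrite mul1r fE.
by apply/funext => x; rewrite mul1r fE.
Qed.

Lemma simple_Linfc_section (Y : funspace R Omega) (f : Rd -> Omega -> R) (o : Omega) :
  (0 < d)%N -> simple_Linfc Y f -> Linfc (f ^~ o).
Proof.
move=> d0 [[N [A [xi [mA mxi fE]]]] [K [cK fK]]].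
apply: (@Linfc_bounded _ _ _ (\sum_k `|xi k o|) K) => //.
- rewrite (_ : f ^~ o = fun x => \sum_k \1_(A k) x * xi k o); last first.
    by apply/funext => x; rewrite fE.
  by apply: measurable_sum => k; apply: measurable_funM => //; exact: measurable_indic.
- move=> x; rewrite fE; apply: le_trans (ler_norm_sum _ _ _) _; apply: ler_sum => k _.
  by rewrite normrM indicE; case: (_ \in _); rewrite ?normr1 ?mul1r// normr0 mul0r.
- by move=> x; exact: fK.
Qed.

Lemma sparse_formE (n : nat) (r : 'I_n -> R) (q : R) (S : set (set Rd))
    (f : 'I_n -> Rd -> R) (g : Rd -> R) :
  sparse_form r q S f g = product_form (snoc r q) (snoc f g) S.
Proof.
apply: eq_esum => Q _; rewrite big_ord_recr/= !snoc_max; congr (_ * _ * _)%E.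
by apply: eq_bigr => j _; rewrite !snoc_widen.
Qed.

Lemma snoc_comp (A B : Type) (h : A -> B) (n : nat) (u : 'I_n -> A) (a : A) :
  (fun j => h (snoc u a j)) = snoc (fun j => h (u j)) (h a).
Proof. by apply/funext => j; rewrite /snoc; case: unlift. Qed.

End euclidean.

(** * The sparse bound for the vector-valued extension *)

Unset Implicit Arguments. Set Strict Implicit. Set Printing Implicit Defensive.

Theorem theorem1p2 (R : realType) (d m : nat) (hd : (0 < d)%N) (hm : (0 < m)%N)
  (dO : measure_display) (Omega : measurableType dO)
  (mu : {sigma_finite_measure set Omega -> \bar R})
  (r : 'I_m -> R) (hr : forall j, 0 < r j)
  (s : \bar R) (hs : (1 < s)%E)
  (X : 'I_m -> funspace R Omega)
  (hXbfs : forall j, is_bfs mu (X j)) (hXtuple : qbfs_tuple mu X)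
  (hUMD : UMD mu r s X) :
  exists C : R,
  forall (T : ('I_m -> euclid R d -> R) -> euclid R d -> R) (C_T : R),
    0 < C_T ->
    (forall f : 'I_m -> euclid R d -> R,
      (forall j, Linfc (f j)) -> measurable_fun setT (T f)) ->
    (forall (f : 'I_m -> euclid R d -> R) (g : euclid R d -> R),
      (forall j, Linfc (f j)) -> Linfc g ->
      exists S : set (set (euclid R d)), sparse S /\
        (\int[lebesgue R d]_x (`|T f x| * `|g x|)%:E <=
         C_T%:E * sparse_form r (fine (hoelder_conjugate s)) S f g)%E) ->
  forall Text : ('I_m -> euclid R d -> Omega -> R) -> euclid R d -> Omega -> R,
    (forall f : 'I_m -> euclid R d -> Omega -> R,
      (forall j, simple_Linfc (X j) (f j)) ->
      is_extension mu T f (Text f) /\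
      strongly_measurable (lebesgue R d) (fs_prod mu X) (Text f)) ->
  forall (f : 'I_m -> euclid R d -> Omega -> R) (g : euclid R d -> R),
    (forall j, simple_Linfc (X j) (f j)) -> Linfc g ->
    exists S : set (set (euclid R d)), sparse S /\
      (\int[lebesgue R d]_x (fs_norm (fs_prod mu X) (Text f x) * `|g x|)%:E <=
       C%:E * C_T%:E *
       sparse_form r (fine (hoelder_conjugate s)) S
         (fun j x => fs_norm (X j) (f j x)) g)%E.
Proof.
pose leb := lebesgue R d.
pose s' := fine (hoelder_conjugate s); pose rho := snoc r s'.
pose Y := snoc X (fs_dual mu (fs_prod mu X)).
have hX j : is_qbfs mu (X j) by case: (hXbfs j).
have [_ bX0 ocX0 [[hY _] convY _]] := hUMD.
have rho_gt0 j : 0 < rho j by exact: snoc_conjugate_gt0.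
have [K K0 majorant] := integral_majorant_le hd hX hr hs hUMD.
pose dil := @dilation_const R d _ rho.
have dil0 : 0 <= dil by rewrite mulr_ge0// prodr_ge0// => j _; exact: powR_ge0.
(* [dil] is lost in passing to the dyadic majorant, [K] in integrating it, and the number of trees
   in keeping the best one. *)
exists (dil * (K * #|{: {ffun 'I_d -> bool}}|%:R)).
move=> T C_T CT0 measT sparseT Text hText f g sf Lg.
have [[mF extF] smF] := hText f sf.
set F := Text f in mF extF smF *.
have [eta [heta norming]] := norming_sequence bX0 ocX0 smF.
have eta_mem i : fs_mem (fs_dual mu (fs_prod mu X)) (eta i) by case: (heta i).
have eta_norm i : fs_norm (fs_dual mu (fs_prod mu X)) (eta i) <= 1 by case: (heta i).
have eta_ge0 i w : 0 <= eta i w by case: (heta i).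
have meta i : measurable_fun setT (eta i) by case: (eta_mem i).
have [mg _ _] := Lg.
have [M M0 suppM] : exists2 M : R, 0 < M &
    forall x o, f (Ordinal hm) x o != 0 -> forall i, `|tnth x i| < M / 2.
  have [_ [Kc [cK fK]]] := sf (Ordinal hm).
  have [M M0 KM] := compact_euclid_bounded cK; exists M => // x o /eqP fx; apply: KM.
  by apply: contrapT => nK; exact/fx/fK.
(* The last entry is [g] itself since the functionals have norm at most 1. Hence the collection,
   chosen from [psi], is independent of the number [n] of functionals in use below. *)
pose psi := snoc (fun j x => fs_norm (X j) (f j x)) g.
have [t best] := best_principal_cubes rho M psi.
have psi_int j : locally_power_integrable leb (rho j) (psi j).
  move: j; rewrite /psi; apply: (snocP (P := fun j z => locally_power_integrable leb (rho j) z)) => [j|].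
    rewrite /rho snoc_widen.
    have hYj := hY (widen_ord (leqnSn m) j); have cYj := convY (widen_ord (leqnSn m) j).
    rewrite !snoc_widen in cYj hYj.
    by have [] := simple_mean_controlled (hX j) (hr j) cYj (sf j).1.
  by rewrite /rho snoc_max; apply: Linfc_power_integrable => //; exact: hoelder_conjugate_gt0.
exists (principal_cubes rho M psi t); split; first exact: sparse_principal_cubes.
rewrite sparse_formE -/s' -/rho -/psi; set form := product_form _ _ _.
pose u i x := (\int[mu]_w (`|F x w| * eta i w)%:E)%E.
have meas_pair (h : Omega -> R) : measurable_fun setT h ->
    measurable_fun setT (fun z : euclid R d * Omega => (`|F z.1 z.2| * h z.2)%:E).
  move=> mh; apply/measurable_EFinP/measurable_funM; first exact: measurableT_comp.
  exact: measurableT_comp.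
have mu_ i : measurable_fun setT (u i).
  apply: (measurable_fun_fubini_tonelli_F (fun z : euclid R d * Omega => (`|F z.1 z.2| * eta i z.2)%:E)).
    exact: meas_pair.
  by move=> z; rewrite lee_fin mulr_ge0.
have u_ge0 i x : (0 <= u i x)%E by apply: integral_ge0 => w _; rewrite lee_fin mulr_ge0.
apply: (integral_le_running_max mu_ u_ge0 mg).
  by apply: filterS norming => x [].
move=> n.
(* Choosing the best of the first functionals at each point linearises the supremum. *)
pose sigma x : 'I_n.+1 := inord (argmax u n x).
have msigma i : measurable (sigma @^-1` [set i]).
  rewrite (_ : _ @^-1` _ = [set x | argmax u n x = i]); first exact: measurable_argmax.
  apply/seteqP; split => x /=.
    by move=> <-; rewrite inordK// ltnS argmax_le.
  by move=> E; apply: val_inj; rewrite /= inordK ?E.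
pose Gl (x : euclid R d) w := g x * eta (sigma x) w.
pose G := snoc f Gl.
have hG j : mean_controlled (Y j) (rho j) (G j) (psi j).
  rewrite /G /psi; apply: (snocP (P := fun j z => mean_controlled (Y j) (rho j) z (psi j))).
    move=> i; rewrite /Y /rho /psi !snoc_widen.
    have hYj := hY (widen_ord (leqnSn m) i); have cYj := convY (widen_ord (leqnSn m) i).
    rewrite !snoc_widen in cYj hYj.
    exact: simple_mean_controlled (hX i) (hr i) cYj (sf i).1.
  have hYj := hY ord_max; have cYj := convY ord_max.
  rewrite /Y /rho /psi !snoc_max in hYj cYj *.
  have := @finite_valued_mean_controlled R d _ _ mu _ s' _ sigma g (fun i => eta i) (fun=> 1)
    hYj (hoelder_conjugate_gt0 hs) cYj msigma (Linfc_power_integrable (hoelder_conjugate_gt0 hs) Lg)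
    (fun i => eta_mem i) (fun i => eta_norm i).
  by congr (mean_controlled _ _ _ _); apply/funext => x; rewrite mulr1.
have [mH intH] := majorant M G psi M0 hG.
set H := fun o => ereal_sup _ in mH intH.
have H_ge0 o : (0 <= H o)%E.
  apply: ereal_sup_ge; exists (dyadic_majorant rho M (fun j => G j ^~ o) 0)%:E; first by exists 0%N.
  rewrite lee_fin /dyadic_majorant addr_ge0//.
    apply: sumr_ge0 => t' _; rewrite mulr_ge0 ?exprn_ge0 ?mulr_ge0 ?(ltW M0)//=.
    by apply: prodr_ge0 => j _; exact: powR_ge0.
  by rewrite big_ord0.
have mGl : measurable_fun setT (fun z : euclid R d * Omega => Gl z.1 z.2).
  rewrite (_ : (fun z => _) =
      fun z : euclid R d * Omega => \sum_(i < n.+1) (g z.1 * \1_(sigma @^-1` [set i]) z.1) * eta i z.2).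
    apply: measurable_sum => i; apply: measurable_funM; last exact: measurableT_comp.
    apply: measurable_funM; first exact: measurableT_comp.
    by apply: (measurableT_comp (measurable_indic _)).
  apply/funext => -[x w] /=; rewrite (bigD1 (sigma x))//= indicE mem_set// mulr1 big1 ?addr0//.
  by move=> i /eqP ix; rewrite indicE memNset ?mulr0 ?mul0r// => /esym.
pose k (z : euclid R d * Omega) := (`|F z.1 z.2| * `|Gl z.1 z.2|)%:E.
have mk : measurable_fun setT k.
  by apply/measurable_EFinP/measurable_funM; exact: measurableT_comp.
have k0 z : (0 <= k z)%E by rewrite lee_fin mulr_ge0.
(* The running maximum is the pairing with the selected functional, so this is an integral over
   [R^d] and [Omega] to which Tonelli's theorem applies. *)
have -> : (\int[lebesgue R d]_x (running_max u n x * `|g x|%:E) = \int[leb]_x \int[mu]_w k (x, w))%E.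
  apply: eq_integral => x _; rewrite /running_max /u muleC.
  rewrite -ge0_integralZl_EFin//; last 2 first.
  - by move=> w _; rewrite lee_fin mulr_ge0.
  - apply/measurable_EFinP/measurable_funM => //; apply: measurableT_comp => //.
    exact: (measurableT_comp mF (measurable_pair1 _)).
  apply: eq_integral => w _; rewrite -EFinM /k /Gl /=; congr (_%:E).
  rewrite normrM (ger0_norm (eta_ge0 _ _)) /sigma inordK ?ltnS ?argmax_le//.
  by rewrite mulrCA.
rewrite (fubini_tonelli k mk k0).
apply: (@le_trans _ _ (\int[mu]_w ((C_T * dil)%:E * H w))%E).
  apply: integral_le_ae_measurable.
  - exact: measurable_funeM.
  - by move=> w; rewrite mule_ge0// lee_fin mulr_ge0// ltW.
  apply: filterS extF => w Fw.
  have Lf j : Linfc (f j ^~ w) by exact: simple_Linfc_section.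
  have LG : Linfc (Gl ^~ w).
    (* For fixed [w] the selected functional takes at most [n + 1] values, each bounded by their
       sum. *)
    apply: (@Linfc_dominated _ _ g _ (\sum_(i < n.+1) eta i w) Lg).
    - exact: (measurableT_comp mGl (measurable_pair2 _)).
    - exact: sumr_ge0.
    - move=> x; rewrite normrM mulrC ler_wpM2r// ger0_norm//.
      by rewrite (bigD1 (sigma x))//= lerDl sumr_ge0.
  (* The collection [Sw] varies with [w]; it is used only to reach the bound by [H w]. *)
  have [Sw [spSw leSw]] := sparseT (fun j => f j ^~ w) (Gl ^~ w) Lf LG.
  have -> : (\int[leb]_x k (x, w) =
      \int[leb]_x (`|T (fun j => f j ^~ w) x| * `|Gl x w|)%:E)%E.
    apply: ge0_ae_eq_integral => //.
    - exact: (measurableT_comp mk (measurable_pair2 _)).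
    - have mT : measurable_fun setT (T (fun j => f j ^~ w)) by exact: measT.
      have mGw : measurable_fun setT (Gl ^~ w) by case: LG.
      apply/measurable_EFinP/measurable_funM; exact: measurableT_comp.
    - by apply: filterS Fw => x Fx _; rewrite /k /= Fx.
  apply: le_trans leSw _; rewrite EFinM -muleA; apply: lee_wpmul2l; first by rewrite lee_fin ltW.
  rewrite sparse_formE -/s' -/rho -(snoc_comp (fun h : euclid R d -> Omega -> R => h ^~ w)).
  have Gw_int j : locally_power_integrable leb (rho j) (G j ^~ w) by case: (hG j).
  apply: (sparse_sum_le_majorant rho_gt0 M0 (F := fun j => G j ^~ w) Gw_int
    (j0 := widen_ord (leqnSn m) (Ordinal hm)) _ spSw).
  by move=> x; rewrite /G snoc_widen; exact: suppM.
rewrite ge0_integralZl_EFin//; last by rewrite mulr_ge0// ltW.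
apply: (@le_trans _ _ ((C_T * dil)%:E * (K%:E * (#|{: {ffun 'I_d -> bool}}|%:R%:E * form)))%E).
  apply: lee_wpmul2l; first by rewrite lee_fin mulr_ge0// ltW.
  by apply: le_trans intH _; apply: lee_wpmul2l best; rewrite lee_fin.
rewrite !muleA -!EFinM le_eqVlt; apply/orP; left; apply/eqP; congr (_%:E * _)%E.
by ring.
Qed.
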